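(* Let $k\ge0$, $\ell\ge2$ be integers with $k+\ell\ge3$ and let $\psi$ be an $\mathrm{OptSP}_{k,\ell}$ formula. Then $\mathrm{Opt}(\psi)$ can be solved exactly in time $O(m^{k+\ell-3/2})$.
   Context: A relational structure consists of a finite set of objects and relations on them of arbitrary fixed arities, given as an explicit list of all records; $m$ is the total number of records. An $\mathrm{OptSP}_{k,\ell}$ formula is $\psi=\mathrm{opt}_{x_1,\dots,x_k}\#\{(y_1,\dots,y_\ell):\phi(x_1,\dots,x_k,y_1,\dots,y_\ell)\}$ with $\mathrm{opt}\in\{\max,\min\}$ and $\phi$ a fixed quantifier-free Boolean combination of relational atoms over the variables; $\mathrm{Opt}(\psi)$ is the problem of computing the optimum value on a given structure, all variables ranging over the objects. Constants depending on the formula are hidden in $O$-notation. *)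

(* Defs.v *)
(* MathComp / MathComp-Analysis *)
From mathcomp Require Import all_boot all_order all_algebra.
From mathcomp Require Import reals exp.

Set Implicit Arguments.
Unset Strict Implicit.
Unset Printing Implicit Defensive.

Import Order.TTheory GRing.Theory Num.Theory.

(** * Relational structures *)

Record signature := Signature { nrel : nat; arity : 'I_nrel -> nat }.

(* The objects are 0, ..., nobj - 1. A relation is a set, presented as a
   duplicate-free list of its records, in any order. Objects need not occur
   in a record, so nobj is not bounded in terms of the number of records. *)
Record structure (sigma : signature) := Structure {
  nobj : nat;
  rel_of : forall r : 'I_(nrel sigma), seq ((arity r).-tuple 'I_nobj);
  rel_uniq : forall r, uniq (rel_of r)
}.

Definition nrec (sigma : signature) (A : structure sigma) : nat :=
  \sum_(r < nrel sigma) size (rel_of A r).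

(** * Formulas *)

(* Equality of variables is not an atom. *)
Inductive qf_formula (sigma : signature) (V : Type) : Type :=
| FTrue
| FAtom (r : 'I_(nrel sigma)) (args : (arity r).-tuple V)
| FNot (phi : qf_formula sigma V)
| FAnd (phi1 phi2 : qf_formula sigma V)
| FOr (phi1 phi2 : qf_formula sigma V).

Fixpoint sat (sigma : signature) (V : Type) (A : structure sigma)
    (v : V -> 'I_(nobj A)) (phi : qf_formula sigma V) : bool :=
  match phi with
  | FTrue => true
  | FAtom r args => map_tuple v args \in rel_of A r
  | FNot phi1 => ~~ sat v phi1
  | FAnd phi1 phi2 => sat v phi1 && sat v phi2
  | FOr phi1 phi2 => sat v phi1 || sat v phi2
  end.

Inductive direction := Max | Min.

(* [inl i] is the variable x_i and [inr j] the variable y_j. *)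
Record optsp (sigma : signature) (k l : nat) := OptSP {
  opt : direction;
  matrix : qf_formula sigma ('I_k + 'I_l)
}.

Section Optimum.
Variables (sigma : signature) (k l : nat) (psi : optsp sigma k l).
Variable A : structure sigma.

Definition assign (x : k.-tuple 'I_(nobj A)) (y : l.-tuple 'I_(nobj A))
    (z : 'I_k + 'I_l) : 'I_(nobj A) :=
  match z with inl i => tnth x i | inr j => tnth y j end.

Definition value (x : k.-tuple 'I_(nobj A)) : nat :=
  #|[set y : l.-tuple 'I_(nobj A) | sat (assign x y) (matrix psi)]|.

Definition is_optimum (v : nat) : Prop :=
  (exists x, value x = v) /\
  match opt psi with
  | Max => forall x, value x <= v
  | Min => forall x, v <= value x
  end.

End Optimum.

(** * Word RAM *)

(* Structured word RAM programs: unboundedly many named registers (a program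
   uses finitely many) and a random access memory. *)
Inductive binop := OAdd | OSub | OMul | ODiv | OLt | OEq.

Inductive expr :=
| ECst (c : nat)
| EReg (i : nat)
| EMem (e : expr)
| EOp (o : binop) (e1 e2 : expr).

Inductive cmd :=
| CSkip
| CSet (i : nat) (e : expr)
| CStore (addr e : expr)
| CSeq (c1 c2 : cmd)
| CIf (e : expr) (c1 c2 : cmd)
| CWhile (e : expr) (c : cmd).

Record state := State { reg : nat -> nat; mem : nat -> nat }.

Definition update (f : nat -> nat) (a v : nat) : nat -> nat :=
  fun b => if b == a then v else f b.

(* Arithmetic on w-bit words is modulo 2 ^ w; division by 0 gives 0. *)
Definition eval_op (w : nat) (o : binop) (a b : nat) : nat :=
  match o with
  | OAdd => (a + b) %% 2 ^ w
  | OSub => (a + (2 ^ w - b)) %% 2 ^ w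
  | OMul => (a * b) %% 2 ^ w
  | ODiv => a %/ b
  | OLt => (a < b) %% 2 ^ w
  | OEq => (a == b) %% 2 ^ w
  end.

Fixpoint eval (w : nat) (s : state) (e : expr) : nat :=
  match e with
  | ECst c => c %% 2 ^ w
  | EReg i => reg s i
  | EMem e1 => mem s (eval w s e1)
  | EOp o e1 e2 => eval_op w o (eval w s e1) (eval w s e2)
  end.

(* One time unit per constant, register access, memory access and word
   operation. *)
Fixpoint cost (e : expr) : nat :=
  match e with
  | ECst _ | EReg _ => 1
  | EMem e1 => (cost e1).+1
  | EOp _ e1 e2 => (cost e1 + cost e2).+1
  end.

(* [exec w c s s' t]: on w-bit words, c started in s halts in s' after t time
   units. *)
Inductive exec (w : nat) : cmd -> state -> state -> nat -> Prop :=
| ExecSkip s : exec w CSkip s s 1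
| ExecSet i e s :
    exec w (CSet i e) s
      (State (update (reg s) i (eval w s e)) (mem s)) (cost e).+1
| ExecStore a e s :
    exec w (CStore a e) s
      (State (reg s) (update (mem s) (eval w s a) (eval w s e)))
      (cost a + cost e).+1
| ExecSeq c1 c2 s s1 s2 t1 t2 :
    exec w c1 s s1 t1 -> exec w c2 s1 s2 t2 ->
    exec w (CSeq c1 c2) s s2 (t1 + t2)
| ExecIfTrue e c1 c2 s s1 t :
    eval w s e != 0 -> exec w c1 s s1 t ->
    exec w (CIf e c1 c2) s s1 (cost e + t).+1
| ExecIfFalse e c1 c2 s s1 t :
    eval w s e = 0 -> exec w c2 s s1 t ->
    exec w (CIf e c1 c2) s s1 (cost e + t).+1
| ExecWhileTrue e c s s1 s2 t1 t2 :
    eval w s e != 0 -> exec w c s s1 t1 -> exec w (CWhile e c) s1 s2 t2 ->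
    exec w (CWhile e c) s s2 (cost e + t1 + t2).+1
| ExecWhileFalse e c s :
    eval w s e = 0 -> exec w (CWhile e c) s s (cost e).+1.

(** * Solving Opt(psi) *)

(* The number of objects, then for each relation the number of its records
   followed by the entries of these records. *)
Definition encode (sigma : signature) (A : structure sigma) : seq nat :=
  nobj A ::
  flatten [seq size (rel_of A r) ::
               flatten [seq [seq nat_of_ord a | a <- tval rec]
                       | rec <- rel_of A r]
          | r <- enum 'I_(nrel sigma)].

Definition init (sigma : signature) (A : structure sigma) : state :=
  State (fun _ => 0) (nth 0 (encode A)).

Local Open Scope ring_scope.

(* Opt(psi) is solvable in time O(f(m)) on a word RAM whose word size w is at
   least a constant times log (nobj + m + 2). The program and the constants
   depend only on the formula. The answer is left in register 0. An instance without an optimum (k > 0 and no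
   objects) is not an admissible input. As f(0) may be 0, a structure without
   records is charged like one with a single record. *)
Definition solvable_in_time (R : realType) (sigma : signature) (k l : nat)
    (psi : optsp sigma k l) (f : nat -> R) : Prop :=
  exists (prog : cmd) (c : nat) (C : R),
    forall (A : structure sigma) (v : nat), is_optimum psi A v ->
    forall w : nat, ((nobj A + nrec A + 2) ^ c <= 2 ^ w)%N ->
    exists (s : state) (t : nat),
      [/\ exec w prog (init A) s t,
          reg s 0 = v
        & t%:R <= C * f (maxn (nrec A) 1)].

(* Main.v *)
(* Write s = k + l. A quantifier-free formula is, over the integers, a signed sum
   of products of atoms, so it suffices to count the solutions of conjunctions
   of atoms. The first s - 3 variables are enumerated. For the last three, say
   a, b, c, of which b and c are counted, we need for every a the number of
   pairs (b, c). If some two of the three variables share no atom, these numbers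
   come from two products of a sparse (or rank one) matrix with a vector, in
   time O(m). Otherwise a, b, c are pairwise neighbours in the graph joining
   objects that occur in a common record; each edge (a, b) is extended by
   scanning the shorter of the two neighbour lists, and the sum of
   min (deg a, deg b) over the O(m) edges is O(m^(3/2)).
   Objects without records are interchangeable; they are represented by a single
   object, weighted by their number. *)
Require Import Defs.
From mathcomp Require Import all_boot all_order all_algebra.
From mathcomp Require Import reals exp.
From mathcomp Require Import zify ring.

Set Implicit Arguments.
Unset Strict Implicit.
Unset Printing Implicit Defensive.

Import Order.TTheory GRing.Theory Num.Theory.

(** * Time-bounded program logic *)

(** Exact counts must come out of signed sums whose partial values may be negative or too large for
    a word. All sums are therefore taken in the ring of residues modulo 2^w; a final count is at
    most N^l, which the word size keeps below 2^w, so its residue determines it. N is not bounded in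
    terms of m, so loops run over the nodes of the graph, never over all objects, and no array is
    ever cleared: arrays are addressed directly by strings of digits to a base B linear in N + m, in
    a memory that is 0 beyond the input. Merging the objects without records is sound because
    equality is not an atom. The merged class may be empty; its node then has weight 0 and must not
    compete for the optimum. Since l >= 2, at most the first s - 2 variables are x-variables. The
    counters are thus indexed by values known before b and c are summed out, and the final search
    over them costs O(m^(s-2)), within the bound. *)

Section Logic.
Variable w : nat.

Definition runs (c : cmd) (s : state) (Q : state -> Prop) (T : nat) : Prop :=
  exists s' t, [/\ exec w c s s' t, Q s' & t <= T].

Lemma runs_weaken c s (Q Q' : state -> Prop) T T' :
  runs c s Q T -> (forall s', Q s' -> Q' s') -> T <= T' -> runs c s Q' T'.
Proof.
case=> s' [t [ex Qs' tT]] QQ' TT'.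
by exists s', t; split=> //; [exact: QQ' | exact: leq_trans TT'].
Qed.

Lemma runs_skip s (Q : state -> Prop) : Q s -> runs CSkip s Q 1.
Proof. by move=> Qs; exists s, 1; split=> //; constructor. Qed.

Definition set_reg (s : state) i v := State (update (reg s) i v) (Defs.mem s).
Definition set_mem (s : state) a v := State (reg s) (update (Defs.mem s) a v).

Lemma runs_set i e s (Q : state -> Prop) :
  Q (set_reg s i (eval w s e)) -> runs (CSet i e) s Q (cost e).+1.
Proof. by move=> Qs; eexists; eexists; split; [constructor | exact: Qs |]. Qed.

Lemma runs_store a e s (Q : state -> Prop) :
  Q (set_mem s (eval w s a) (eval w s e)) ->
  runs (CStore a e) s Q (cost a + cost e).+1.
Proof. by move=> Qs; eexists; eexists; split; [constructor | exact: Qs |]. Qed.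

Lemma runs_seq c1 c2 s (Q : state -> Prop) T1 T2 :
  runs c1 s (fun s1 => runs c2 s1 Q T2) T1 -> runs (CSeq c1 c2) s Q (T1 + T2).
Proof.
case=> s1 [t1 [ex1 [s2 [t2 [ex2 Qs2 le2]]] le1]].
exists s2, (t1 + t2); split=> //; first exact: ExecSeq ex1 ex2.
exact: leq_add.
Qed.

Lemma runs_if e c1 c2 s (Q : state -> Prop) T :
  (eval w s e != 0 -> runs c1 s Q T) -> (eval w s e = 0 -> runs c2 s Q T) ->
  runs (CIf e c1 c2) s Q (cost e + T).+1.
Proof.
move=> H1 H2; case: (eqVneq (eval w s e) 0) => [e0|ne0].
  have [s' [t [ex Qs' le]]] := H2 e0.
  exists s', (cost e + t).+1; split=> //; first exact: ExecIfFalse.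
  by rewrite ltnS leq_add2l.
have [s' [t [ex Qs' le]]] := H1 ne0.
exists s', (cost e + t).+1; split=> //; first exact: ExecIfTrue.
by rewrite ltnS leq_add2l.
Qed.

(** The number of rounds is fixed in advance, while the cost of a round may depend on its index:
    scanning the neighbours of a node costs its degree. *)
Lemma runs_while e c (n : nat) (Inv : nat -> state -> Prop) (T : nat -> nat) s :
  (forall j s, j < n -> Inv j s -> eval w s e != 0 /\ runs c s (Inv j.+1) (T j)) ->
  (forall s, Inv n s -> eval w s e = 0) ->
  Inv 0 s ->
  runs (CWhile e c) s (Inv n) (\sum_(j < n) (T j + (cost e).+1) + (cost e).+1).
Proof.
move=> body stop I0.
suff: forall d j s, d + j = n -> Inv j s ->
    runs (CWhile e c) s (Inv n) (\sum_(j <= i < n) (T i + (cost e).+1) + (cost e).+1).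
  by move=> /(_ n 0 s); rewrite addn0 big_mkord; apply.
elim=> [|d IH] j s1 dj Ij.
  rewrite add0n in dj; subst j.
  exists s1, (cost e).+1; split=> //; first by constructor; apply: stop.
  by rewrite leq_addl.
have jn : j < n by lia.
have [ne0 [s2 [t2 [ex2 Is2 le2]]]] := body j s1 jn Ij.
have [s3 [t3 [ex3 Is3 le3]]] := IH j.+1 s2 ltac:(lia) Is2.
exists s3, (cost e + t2 + t3).+1; split=> //; first exact: ExecWhileTrue ex2 ex3.
rewrite big_ltn //; lia.
Qed.

(** A syntactic bound on the assigned registers, giving a frame rule for registers; changes of the
    memory are tracked by region instead. *)
Fixpoint mods (c : cmd) : seq nat :=
  match c with
  | CSkip | CStore _ _ => [::]
  | CSet i _ => [:: i]
  | CSeq c1 c2 | CIf _ c1 c2 => mods c1 ++ mods c2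
  | CWhile _ c => mods c
  end.

Lemma exec_mods c s s' t i : exec w c s s' t -> i \notin mods c -> reg s' i = reg s i.
Proof.
move=> ex; elim: ex => //=.
- by move=> j e s0; rewrite inE /update => /negbTE ->.
- move=> c1 c2 s0 s1 s2 t1 t2 _ IH1 _ IH2; rewrite mem_cat negb_or => /andP[n1 n2].
  by rewrite IH2 // IH1.
- by move=> e c1 c2 s0 s1 t0 _ _ IH; rewrite mem_cat negb_or => /andP[n1 n2]; exact: IH.
- by move=> e c1 c2 s0 s1 t0 _ _ IH; rewrite mem_cat negb_or => /andP[n1 n2]; exact: IH.
- by move=> e c1 s0 s1 s2 t1 t2 _ _ IH1 _ IH2 ni; rewrite IH2 // IH1.
Qed.

Lemma runs_frame c s (Q : state -> Prop) T :
  runs c s Q T ->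
  runs c s (fun s' => Q s' /\ forall i, i \notin mods c -> reg s' i = reg s i) T.
Proof.
case=> s' [t [ex Qs' le]]; exists s', t; split=> //; split=> // i.
exact: exec_mods ex.
Qed.

End Logic.

(** * Arrays in the memory *)

Lemma update_same f a v : update f a v a = v.
Proof. by rewrite /update eqxx. Qed.

Lemma update_other f a v b : b != a -> update f a v b = f b.
Proof. by rewrite /update => /negbTE ->. Qed.

Lemma reg_set_same s i v : reg (set_reg s i v) i = v.
Proof. exact: update_same. Qed.

Lemma reg_set_other s i v j : j != i -> reg (set_reg s i v) j = reg s j.
Proof. exact: update_other. Qed.

(* The region number is followed by a digit 0 and by the indices: the leading
   digit is nonzero, so the address determines region and indices, and it is at
   least B, beyond the input. *)
Definition addr (B r : nat) (ds : seq nat) : nat :=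
  foldl (fun a d => a * B + d) (r.+1 * B) ds.

Definition eaddr (r : nat) (es : seq expr) : expr :=
  foldl (fun a e => EOp OAdd (EOp OMul a (EReg 1)) e)
    (EOp OMul (ECst r.+1) (EReg 1)) es.

Definition earr r es := EMem (eaddr r es).

Definition cell (B : nat) (s : state) r ds := Defs.mem s (addr B r ds).

Lemma addr_nil B r : addr B r [::] = r.+1 * B.
Proof. by []. Qed.

Lemma addr_rcons B r ds d : addr B r (rcons ds d) = addr B r ds * B + d.
Proof. by rewrite /addr foldl_rcons. Qed.

Lemma leq_addr_base B r ds : 0 < B -> r.+1 * B <= addr B r ds.
Proof.
move=> B0; elim/last_ind: ds => [|ds d IH]; first by rewrite addr_nil.
by rewrite addr_rcons; nia.
Qed.

Lemma addr_rcons_neq B r r' ds d : r'.+1 < B -> addr B r (rcons ds d) <> addr B r' [::].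
Proof.
move=> rB; rewrite addr_rcons addr_nil => E.
have B0 : 0 < B by lia.
have := leq_addr_base r ds B0; move: (addr B r ds) E => x E x1.
have xB : B * B <= x * B by rewrite leq_pmul2r //; nia.
have : r'.+1 * B < B * B by rewrite ltn_pmul2r.
lia.
Qed.

(** The last index is the residue modulo B and can be peeled off. If one list ends first, the other
    address is at least B * B and so exceeds every address without indices. *)
Lemma addr_inj B r r' ds ds' :
  r.+1 < B -> r'.+1 < B -> all (gtn B) ds -> all (gtn B) ds' ->
  addr B r ds = addr B r' ds' -> r = r' /\ ds = ds'.
Proof.
move=> rB r'B; have B0 : 0 < B by lia.
elim/last_ind: ds ds' => [|ds d IH] ds'; case/lastP: ds' => [|ds' d'].
- by move=> _ _ /eqP; rewrite !addr_nil eqn_pmul2r // => /eqP [->].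
- by move=> _ _ /esym /(addr_rcons_neq rB).
- by move=> _ _ /(addr_rcons_neq r'B).
- rewrite !all_rcons => /andP[dB dsB] /andP[d'B ds'B].
  rewrite !addr_rcons => E.
  have E1 : d = d'.
    have := congr1 (modn^~ B) E.
    by rewrite !modnMDl !modn_small.
  subst d'; move/eqP: E; rewrite eqn_add2r eqn_pmul2r // => /eqP E.
  by have [-> ->] := IH ds' dsB ds'B E.
Qed.

(** The digits to base B are [r.+1], 0 and the indices, [size ds + 2] in all. *)
Lemma addr_lt B r ds :
  r.+1 < B -> all (gtn B) ds -> addr B r ds < B ^ (size ds + 2).
Proof.
move=> rB; elim/last_ind: ds => [|ds d IH] /=.
  by rewrite /addr /= add0n -mulnn ltn_pmul2r //; lia.
rewrite all_rcons size_rcons addr_rcons => /andP[dB dsB].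
have := IH dsB; rewrite addSn expnSr; set X := B ^ _; move: (addr B r ds) => a /= aX.
have : a.+1 * B <= X * B by rewrite leq_pmul2r //; lia.
by move: dB => /=; nia.
Qed.

Section Memory.
Variables (w B D : nat).
Hypothesis hB : B ^ (D + 2) <= 2 ^ w.

(** At most D indices, hence at most D + 2 digits in an address; this is what [hB] is made for. *)
Definition digits_ok ds := all (gtn B) ds && (size ds <= D).

Lemma addr_lt_word r ds : r.+1 < B -> digits_ok ds -> addr B r ds < 2 ^ w.
Proof.
move=> rB /andP[dsB szD]; apply: leq_trans (addr_lt rB dsB) (leq_trans _ hB).
by apply: leq_pexp2l; lia.
Qed.

Lemma eval_eaddr s r es :
  reg s 1 = B -> r.+1 < B -> digits_ok [seq eval w s e | e <- es] ->
  eval w s (eaddr r es) = addr B r [seq eval w s e | e <- es].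
Proof.
move=> r1 rB.
elim/last_ind: es => [|es e IH] gd.
  have := addr_lt_word rB gd; rewrite /addr /= r1 => lt.
  rewrite (@modn_small r.+1) ?modn_small //; nia.
have := addr_lt_word rB gd; move: gd.
rewrite map_rcons /digits_ok all_rcons size_rcons => /andP[/andP[eB esB] sz].
rewrite /eaddr foldl_rcons -/(eaddr _ _) addr_rcons /= => lt.
rewrite IH; last by rewrite /digits_ok esB ltnW.
by rewrite r1 (@modn_small (_ * _)) ?modn_small //; lia.
Qed.

Lemma eval_earr s r es :
  reg s 1 = B -> r.+1 < B -> digits_ok [seq eval w s e | e <- es] ->
  eval w s (earr r es) = cell B s r [seq eval w s e | e <- es].
Proof. by move=> *; rewrite /earr /= eval_eaddr. Qed.

Lemma cell_set_mem s r ds v r' ds' :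
  r.+1 < B -> r'.+1 < B -> digits_ok ds -> digits_ok ds' ->
  cell B (set_mem s (addr B r ds) v) r' ds' =
  if (r' == r) && (ds' == ds) then v else cell B s r' ds'.
Proof.
move=> rB rB' /andP[g _] /andP[g' _]; rewrite /cell /set_mem /update /=.
case: (eqVneq (addr B r' ds') _) => [E|ne].
  by have [-> ->] := addr_inj rB' rB g' g E; rewrite !eqxx.
case: andP => // -[/eqP Er /eqP Ed]; subst; by rewrite eqxx in ne.
Qed.

Lemma runs_store_arr r es e s (Q : state -> Prop) :
  reg s 1 = B -> r.+1 < B -> digits_ok [seq eval w s e | e <- es] ->
  Q (set_mem s (addr B r [seq eval w s e | e <- es]) (eval w s e)) ->
  runs w (CStore (eaddr r es) e) s Q (cost (eaddr r es) + cost e).+1.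
Proof. by move=> r1 rB gd; rewrite -eval_eaddr //; exact: runs_store. Qed.

End Memory.

(** * Word arithmetic as arithmetic in a commutative ring *)

Section WordRing.
Variables (w : nat) (K : comPzRingType).
Hypothesis hK : forall n, ((n %% 2 ^ w)%:R = n%:R :> K)%R.
Hypothesis hw : 0 < w.
Local Open Scope ring_scope.

(** Read in K, which will be the ring of residues modulo 2^w, sums and products of words need no
    bound against overflow. *)
Lemma eval_add s e1 e2 :
  (eval w s (EOp OAdd e1 e2))%:R = (eval w s e1)%:R + (eval w s e2)%:R :> K.
Proof. by rewrite /= hK natrD. Qed.

Lemma eval_mul s e1 e2 :
  (eval w s (EOp OMul e1 e2))%:R = (eval w s e1)%:R * (eval w s e2)%:R :> K.
Proof. by rewrite /= hK natrM. Qed.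

Lemma eval_cst s n : (eval w s (ECst n))%:R = n%:R :> K.
Proof. by rewrite /= hK. Qed.

Lemma word_gt1 : (1 < 2 ^ w)%N.
Proof. by rewrite -{1}(expn0 2) ltn_exp2l. Qed.

Lemma bool_lt_word (b : bool) : ((b %% 2 ^ w) = b)%N.
Proof. by rewrite modn_small // (leq_ltn_trans (leq_b1 b)) ?word_gt1. Qed.

Lemma eval_lt s e1 e2 : eval w s (EOp OLt e1 e2) = (eval w s e1 < eval w s e2)%N.
Proof. exact: bool_lt_word. Qed.

Lemma eval_eq s e1 e2 : eval w s (EOp OEq e1 e2) = (eval w s e1 == eval w s e2)%N.
Proof. exact: bool_lt_word. Qed.

(** The word 2^w - 1: it is -1 in the ring and, as the largest word, also the start value of a
    minimisation. *)
Definition eneg1 := EOp OSub (ECst 0) (ECst 1).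

Lemma eval_neg1 s : (eval w s eneg1)%:R = -1 :> K.
Proof.
rewrite /= mod0n add0n (@modn_small 1); last exact: word_gt1.
rewrite hK natrB ?expn_gt0 //.
by rewrite -[(2 ^ w)%:R]hK modnn sub0r.
Qed.

End WordRing.

(** * Loops over neighbours *)

Fixpoint tups (d : nat) (L : seq nat) : seq (seq nat) :=
  if d is d'.+1 then [seq v :: t | v <- L, t <- tups d' L] else [:: [::]].

Lemma tupsP d L t : reflect (size t = d /\ {subset t <= L}) (t \in tups d L).
Proof.
elim: d t => [|d IH] t /=.
  by rewrite inE; apply: (iffP eqP) => [-> | [/size0nil]].
apply: (iffP allpairsP) => [[[v t'] /= [vL /IH[<- t'L] ->]]|].
  by split=> // x; rewrite inE => /orP[/eqP ->|/t'L].
case: t => [[]//|v t] [[sz] tL]; exists (v, t); split=> //=.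
  by apply: tL; rewrite inE eqxx.
by apply/IH; split=> // x xt; apply: tL; rewrite inE xt orbT.
Qed.

Lemma foldl_flatten (X Y : Type) (f : X -> Y -> X) x (ss : seq (seq Y)) :
  foldl f x (flatten ss) = foldl (foldl f) x ss.
Proof. by elim: ss x => //= s ss IH x; rewrite foldl_cat IH. Qed.

Lemma foldl_map (X Y Z : Type) (f : X -> Y -> X) (g : Z -> Y) x (s : seq Z) :
  foldl f x (map g s) = foldl (fun x z => f x (g z)) x s.
Proof. by elim: s x => //= a s IH x. Qed.

Lemma eq_foldl (X Y : Type) (f g : X -> Y -> X) : f =2 g -> forall x s, foldl f x s = foldl
  g x s.
Proof. by move=> fg x s; elim: s x => //= a s IH x; rewrite fg. Qed.

(* Register 0 holds the answer, 1 the base B of the addresses, 2 the number N of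
   objects, 3 the position in the input; 4 to 8 are scratch. The i-th variable is
   in [var_reg i], the position of the loop over its values in [ctr_reg i]. *)
Definition var_reg i := 10 + i.*2.
Definition ctr_reg i := 11 + i.*2.

Section Regions.
Variable nr : nat.
(** The regions below [nr] are the membership tables of the relations. Then come the degrees, the
    adjacency lists, the adjacency matrix, two auxiliary vectors and the counters indexed by values
    of the x-variables. *)
Definition Rdeg := nr.
Definition Radj := nr.+1.
Definition Rbit := nr.+2.
Definition Rvec1 := nr.+3.
Definition Rvec2 := nr.+4.
Definition Rcnt := nr.+4.+1.

Definition edeg p := earr Rdeg [:: EReg p].

(* Variable i runs through the neighbours of the object in register p. The
   neighbours of N are all nodes, so that [foreach i 2] loops over all nodes. *)
Definition foreach i p body :=
  CSeq (CSet (ctr_reg i) (ECst 0))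
    (CWhile (EOp OLt (EReg (ctr_reg i)) (edeg p))
      (CSeq (CSet (var_reg i) (earr Radj [:: EReg p; EReg (ctr_reg i)]))
        (CSeq body (CSet (ctr_reg i) (EOp OAdd (EReg (ctr_reg i)) (ECst 1)))))).

Fixpoint nest lo d body :=
  if d is d'.+1 then foreach lo 2 (nest lo.+1 d' body) else body.

Definition eatom (at_ : nat * seq nat) := earr at_.1 [seq EReg (var_reg v) | v <- at_.2].
Definition emon (M : seq (nat * seq nat)) :=
  foldr (fun at_ e => EOp OMul (eatom at_) e) (ECst 1) M.

(** A branch-free form of [weight] below: register 2 holds N, so [edeg 2] is the degree of N, which
    is the number of all nodes. *)
Definition ewt z :=
  EOp OAdd (EOp OLt (EReg z) (EReg 2))
    (EOp OMul (EOp OEq (EReg z) (EReg 2))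
      (EOp OAdd (EOp OAdd (EReg 2) (ECst 1)) (EOp OMul eneg1 (edeg 2)))).

(** Such a program preserves B, N and all variables and counters of the loops outside level [lo]. *)
Definition low_mods lo c :=
  all (fun i => ((i < 10) && (i != 1) && (i != 2)) || (var_reg lo <= i)) (mods c).

Lemma mem_mods_foreach i p body j :
  (j \in mods (foreach i p body)) = (j == var_reg i) || (j == ctr_reg i) || (j \in mods
    body).
Proof.
rewrite /= !inE mem_cat inE; case: (j == ctr_reg i); case: (j == var_reg i); case: (_ \in
  _) => //.
Qed.

Lemma mem_mods_seq c1 c2 j : (j \in mods (CSeq c1 c2)) = (j \in mods c1) || (j \in mods c2).
Proof. exact: mem_cat. Qed.

Lemma mem_mods_if e c1 c2 j : (j \in mods (CIf e c1 c2)) = (j \in mods c1) || (j \in mods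
  c2).
Proof. exact: mem_cat. Qed.

Lemma mem_mods_set i e j : (j \in mods (CSet i e)) = (j == i).
Proof. exact: mem_seq1. Qed.

Lemma mem_mods_store a e j : (j \in mods (CStore a e)) = false.
Proof. by []. Qed.

Definition mem_mods :=
  (mem_mods_foreach, mem_mods_seq, mem_mods_if, mem_mods_set, mem_mods_store).

Lemma low_mods_nest lo d body : low_mods (lo + d) body -> low_mods lo (nest lo d body).
Proof.
elim: d lo => [|d IH] lo; first by rewrite addn0.
rewrite addnS -addSn => /IH; rewrite /low_mods /= !all_cat /= => /allP H.
have -> : var_reg lo <= ctr_reg lo by rewrite /var_reg /ctr_reg; lia.
rewrite leqnn /= andbT; apply/allP => i /H /orP[->//|le].
by apply/orP; right; move: le; rewrite /var_reg; lia.
Qed.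

End Regions.

Arguments foreach : simpl never.
Arguments earr : simpl never.
Arguments emon : simpl never.
Arguments ewt : simpl never.
Arguments edeg : simpl never.
Arguments eaddr : simpl never.
Arguments eneg1 : simpl never.

Record env (w B D N nr : nat) (G : nat -> seq nat) : Prop := Env {
  env_word : B ^ (D + 2) <= 2 ^ w;
  env_w : 0 < w;
  env_nr : nr.+4.+3 < B;
  env_N : N < B;
  env_D : 2 <= D;
  env_G : forall u, size (G u) < B
}.

Section Env.
Variables (w B D N nr : nat) (G : nat -> seq nat) (tbl : nat -> seq nat -> bool).
Hypothesis ENV : env w B D N nr G.
Let hB := env_word ENV.
Let hw := env_w ENV.
Let nrB := env_nr ENV.
Let NB := env_N ENV.
Let D2 := env_D ENV.
Let Gsz := env_G ENV.

Notation good := (digits_ok B D).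
Notation arr := (cell B).
Notation L := (G N).

(** The data that parsing leaves and counting only reads; writes to the regions from [Rbit] on
    preserve it. *)
Definition static (s : state) : Prop :=
  [/\ reg s 1 = B, reg s 2 = N,
      (forall r ds, r < nr -> good ds -> arr s r ds = tbl r ds :> nat),
      (forall u, u <= N -> arr s (Rdeg nr) [:: u] = size (G u)) &
      (forall u i, u <= N -> i < size (G u) -> arr s (Radj nr) [:: u; i] = nth 0 (G u) i)].

Lemma good_le ds : all (geq N) ds -> size ds <= D -> good ds.
Proof.
move=> H sz; rewrite /digits_ok sz andbT; apply: sub_all H => x /= xN.
exact: leq_ltn_trans NB.
Qed.

Lemma region_lt r : r <= (Rcnt nr) -> r.+1 < B.
Proof. by rewrite /Rcnt; lia. Qed.

Lemma static_set_reg s i v : i != 1 -> i != 2 -> static s -> static (set_reg s i v).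
Proof.
move=> i1 i2 [S1 S2 S3 S4 S5]; split=> //=; rewrite update_other //; by rewrite eq_sym.
Qed.

Lemma static_set_mem s r ds v :
  Rbit nr <= r <= (Rcnt nr) -> good ds -> static s -> static (set_mem s (addr B r ds) v).
Proof.
move=> /andP[r1 r2] gd [S1 S2 S3 S4 S5].
have rB : r.+1 < B by apply: region_lt.
have nDeg : (Rdeg nr == r) = false by apply/eqP => E; move: r1; rewrite -E /Rdeg /Rbit; lia.
have nAdj : (Radj nr == r) = false by apply/eqP => E; move: r1; rewrite -E /Radj /Rbit; lia.
split=> //.
- move=> r' ds' lt gd'; rewrite (cell_set_mem (D := D) _ _ rB) //; last by apply:
    region_lt; rewrite /Rcnt; lia.
  case: eqP => [E|_] /=; last exact: S3.
  by move: r1; rewrite -E /Rbit; lia.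
- move=> u uN; rewrite (cell_set_mem (D := D) _ _ rB) //; first by rewrite nDeg; apply: S4.
    by apply: region_lt; rewrite /Rdeg /Rcnt; lia.
  by apply: good_le => /=; rewrite ?uN //; lia.
- move=> u i uN lt; rewrite (cell_set_mem (D := D) _ _ rB) //; first by rewrite nAdj;
    apply: S5.
    by apply: region_lt; rewrite /Radj /Rcnt; lia.
  by rewrite /digits_ok /= (leq_ltn_trans uN) //= (ltn_trans lt) // D2.
Qed.

Lemma eval_deg s p u : static s -> reg s p = u -> u <= N -> eval w s (edeg nr p) = size (G
  u).
Proof.
move=> st rp uN; have [S1 S2 S3 S4 S5] := st.
rewrite (eval_earr hB) /= ?rp ?S4 //; first by apply: region_lt; rewrite /Rdeg /Rcnt; lia.
by apply: good_le => /=; rewrite ?uN //; lia.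
Qed.

Lemma leq_B_word : B <= 2 ^ w.
Proof. by apply: leq_trans hB; rewrite -{1}(expn1 B) leq_pexp2l //; lia. Qed.

(** A round costs 13 for loading the neighbour, 4 for the increment and 11 for the test, here
    rounded up from 28. The same constant covers the initialisation and the last test, 2 + 11. *)
Definition loop_cost := 31.

(** [X] is a ghost value folded along the neighbour list. It is chosen per use: a ring element for a
    sum, a function for the counters, the list of finished nodes for a vector. *)
Lemma foreach_spec (X : Type) (Inv : X -> state -> Prop) (h : nat -> X -> X)
    (T : nat -> nat) i p body u x s :
  u <= N -> p != var_reg i -> p != ctr_reg i -> p \notin mods body -> ctr_reg i \notin mods
    body ->
  (forall x s r v, r = var_reg i \/ r = ctr_reg i -> Inv x s -> Inv x (set_reg s r v)) ->
  (forall v x s, v \in G u -> Inv x s -> static s -> reg s p = u -> reg s (var_reg i) = v ->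
     runs w body s (fun s' => static s' /\ Inv (h v x) s') (T v)) ->
  static s -> reg s p = u -> Inv x s ->
  runs w (foreach nr i p body) s
    (fun s' => static s' /\ Inv (foldl (fun x v => h v x) x (G u)) s')
    (loop_cost + \sum_(v <- G u) (T v + loop_cost)).
Proof.
move=> uN pz pc pm cm stab Hb st rp Ix.
pose Inv' j s := [/\ static s, reg s p = u, reg s (ctr_reg i) = j &
   Inv (foldl (fun x v => h v x) x (take j (G u))) s].
have stat_r s1 r v : r = var_reg i \/ r = ctr_reg i -> static s1 -> static (set_reg s1 r v).
  by move=> rr; apply: static_set_reg; case: rr => ->; rewrite /var_reg /ctr_reg; lia.
have I0 : Inv' 0 (set_reg s (ctr_reg i) (eval w s (ECst 0))).
  split; [apply: stat_r => //; by right | by rewrite /= update_other |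
    by rewrite /= update_same mod0n | rewrite take0; apply: stab => //; by right].
have tE : 2 + (\sum_(j < size (G u)) (T (nth 0 (G u) j) + 20 + 11) + 11) <=
   loop_cost + \sum_(v <- G u) (T v + loop_cost).
  rewrite (big_nth 0) big_mkord.
  have -> : \sum_(j < size (G u)) (T (nth 0 (G u) j) + 20 + 11) =
    \sum_(j < size (G u)) (T (nth 0 (G u) j) + loop_cost) by apply: eq_bigr => j _; rewrite
      /loop_cost; lia.
  rewrite /loop_cost; lia.
apply: (runs_weaken (Q := Inv' (size (G u)))) tE => [|s' [S1 S2 S3]]; last first.
  by rewrite take_size.
rewrite /foreach.
apply: runs_seq; apply: runs_set.
apply: (runs_while (T := fun j => T (nth 0 (G u) j) + 20)) => //.
- move=> j s1 js [st1 rp1 rc1 I1]; split.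
    rewrite eval_lt // (eval_deg st1 rp1 uN) /= rc1 js //.
  have gdj : good [:: u; j] by rewrite /digits_ok /= (leq_ltn_trans uN) //= (ltn_trans js)
    // D2.
  have adjE : eval w s1 (earr (Radj nr) [:: EReg p; EReg (ctr_reg i)]) = nth 0 (G u) j.
    have [S1 S2 S3 S4 S5] := st1.
    rewrite (eval_earr hB) /= ?rp1 ?rc1 ?S5 //.
    by apply: region_lt; rewrite /Radj /Rcnt; lia.
  apply: (runs_weaken (Q := Inv' j.+1) (T := 13 + (T (nth 0 (G u) j) + 4))) => //; last by
    lia.
  apply: runs_seq; apply: runs_set; rewrite adjE.
  apply: runs_seq.
  set s2 := set_reg _ _ _.
  have := Hb (nth 0 (G u) j) _ s2 (mem_nth 0 js) (stab _ _ _ _ (or_introl erefl) I1)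
    (stat_r _ _ _ (or_introl erefl) st1).
  rewrite /s2 /= update_same update_other // => /(_ rp1 erefl) /runs_frame Hr.
  apply: runs_weaken Hr _ (leqnn _) => s3 [[st3 I3] fr].
  apply: runs_set; rewrite /= fr //= update_other; last by rewrite /ctr_reg /var_reg; lia.
  rewrite rc1; split.
  + by apply: stat_r => //; right.
  + by rewrite /= update_other // fr //= update_other.
  + rewrite /= update_same (@modn_small 1) ?word_gt1 // addn1 modn_small //.
    apply: leq_trans leq_B_word; have := Gsz u; lia.
  + apply: stab; first by right.
    by rewrite (take_nth 0) // -cats1 foldl_cat.
- move=> s1 [st1 rp1 rc1 I1]; rewrite eval_lt // (eval_deg st1 rp1 uN) /= rc1 ltnn //.
Qed.

(** Nested loops visit the tuples in the order of [tups], after the values [zs0] of the outer loops.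
    The base [(size L).+1] instead of [size L] pays for starting a loop at each level. *)
Lemma nest_spec (X : Type) (Inv : X -> state -> Prop) (h : seq nat -> X -> X) T
    lo d body zs0 x s :
  N \in L ->
  (forall x s r v, 10 <= r -> Inv x s -> Inv x (set_reg s r v)) ->
  low_mods (lo + d) body ->
  (forall zs x s, size zs = lo + d -> {subset zs <= L} -> static s -> Inv x s ->
     (forall j, j < size zs -> reg s (var_reg j) = nth 0 zs j) ->
     runs w body s (fun s' => static s' /\ Inv (h zs x) s') T) ->
  size zs0 = lo -> {subset zs0 <= L} -> static s -> Inv x s ->
  (forall j, j < size zs0 -> reg s (var_reg j) = nth 0 zs0 j) ->
  runs w (nest nr lo d body) s
    (fun s' => static s' /\
       Inv (foldl (fun x t => h (zs0 ++ t) x) x (tups d L)) s')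
    ((size L).+1 ^ d * (T + loop_cost * d)).
Proof.
move=> NL stab; elim: d lo zs0 x s => [|d IH] lo zs0 x s lm Hb sz0 z0L st Ix rz.
  rewrite /= cats0 expn0 muln0 addn0 mul1n; apply: Hb => //; by rewrite addn0.
have rs2 s1 : static s1 -> reg s1 2 = N by case.
rewrite /nest -/(nest _ _ _ _).
pose J x s := Inv x s /\ (forall j, j < size zs0 -> reg s (var_reg j) = nth 0 zs0 j).
have lm' : low_mods lo.+1 (nest nr lo.+1 d body).
  by apply: low_mods_nest; rewrite addSnnS.
have nm i : 3 <= i -> (10 <= i) -> i < var_reg lo.+1 -> i \notin mods (nest nr lo.+1 d
  body).
  move=> i3 i10 i1; apply/negP => im; have := allP lm' i im; rewrite /= ; lia.
have n2 : 2 \notin mods (nest nr lo.+1 d body).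
  by apply/negP => im; have := allP lm' 2 im; rewrite /= /var_reg; lia.
have := @foreach_spec X J
  (fun v x => foldl (fun x t => h (zs0 ++ v :: t) x) x (tups d L))
  (fun=> (size L).+1 ^ d * (T + loop_cost * d)) lo 2 (nest nr lo.+1 d body) N x s
  (leqnn N) isT isT n2.
have -> : ctr_reg lo \notin mods (nest nr lo.+1 d body).
  by apply: nm; rewrite /ctr_reg /var_reg; lia.
move=> /(_ isT) H; apply: runs_weaken (H _ _ st (rs2 _ st) (conj Ix rz)) _ _; clear H.
- move=> x1 s1 r v rr [I1 z1]; split.
    by apply: stab => //; case: rr => ->.
  move=> j jl; rewrite /= update_other ?z1 //.
  by case: rr => ->; rewrite /var_reg /ctr_reg; lia.
- move=> v x1 s1 vL [I1 z1] st1 _ rv.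
  have := IH lo.+1 (rcons zs0 v) x1 s1.
  rewrite addSnnS => /(_ lm) H; have {}H := H Hb.
  have {}H : runs w (nest nr lo.+1 d body) s1 (fun s' => static s' /\ Inv
     (foldl (fun x t => h (rcons zs0 v ++ t) x) x1 (tups d L)) s') ((size L).+1 ^ d * (T +
       loop_cost * d)).
    apply: H => //; first by rewrite size_rcons sz0.
    + by move=> y; rewrite mem_rcons inE => /orP[/eqP ->//|/z0L].
    + move=> j; rewrite size_rcons ltnS leq_eqVlt nth_rcons => /orP[/eqP ->|jl].
        by rewrite ltnn eqxx sz0.
      by rewrite jl z1.
  apply: runs_weaken (runs_frame H) _ (leqnn _) => s2 [[st2 I2] fr]; split=> //; split.
    rewrite (@eq_foldl _ _ _ (fun x t => h (rcons zs0 v ++ t) x)) // => ? ?; by rewrite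
      cat_rcons.
  move=> j jl; rewrite fr ?z1 //; apply: nm; rewrite /var_reg; lia.
- move=> s' [st' [I' _]]; split=> //.
  rewrite /= foldl_flatten foldl_map.
  rewrite (@eq_foldl _ _ _ (fun x v => foldl (fun x t => h (zs0 ++ v :: t) x) x (tups d
    L))) //.
  by move=> ? ?; rewrite foldl_map.
- rewrite big_const_seq iter_addn count_predT addn0.
  rewrite expnS; set n := size L; set E := n.+1 ^ d.
  have E1 : 1 <= E by rewrite expn_gt0.
  nia.
Qed.

End Env.

(** * Counting the solutions of a conjunction *)

Definition avoid (X : nat) (M : seq (nat * seq nat)) := [seq a <- M | X \notin a.2].
Definition joined (X Y : nat) (M : seq (nat * seq nat)) :=
  has (fun a => (X \in a.2) && (Y \in a.2)) M.

Definition mon (tbl : nat -> seq nat -> bool) (M : seq (nat * seq nat)) (rho : nat -> nat)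
  :=
  all (fun a => tbl a.1 [seq rho v | v <- a.2]) M.

Lemma eq_mon tbl (M : seq (nat * seq nat)) (rho rho' : nat -> nat) :
  (forall a v, a \in M -> v \in a.2 -> rho v = rho' v) -> mon tbl M rho = mon tbl M rho'.
Proof.
move=> H; apply: eq_in_all => a aM; congr (tbl _ _); apply/eq_in_map => v va.
exact: H aM va.
Qed.

(** Every atom misses X or Y. An atom missing both is counted in both factors, which is harmless for
    truth values. *)
Lemma mon_split tbl X Y M (rho : nat -> nat) : ~~ joined X Y M ->
  mon tbl M rho = mon tbl (avoid X M) rho && mon tbl (avoid Y M) rho.
Proof.
rewrite /joined /mon /avoid; elim: M => //= a M IH; rewrite negb_or => /andP[nXY /IH ->].
case Xa: (X \in a.2) nXY => /=; last by case: (Y \in a.2) => /= _; case: (tbl _ _) => /=;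
  rewrite ?andbF.
by move=> /= -> /=; case: (tbl _ _); rewrite ?andbF.
Qed.

Lemma mem_foldl_cons (l s : seq nat) x :
  (x \in foldl (fun l v => v :: l) l s) = (x \in l) || (x \in s).
Proof. by elim: s l => [|v s IH] l /=; rewrite ?orbF // IH !inE orbCA orbA. Qed.

Lemma avoidP X (M : seq (nat * seq nat)) a : reflect (a \in M /\ X \notin a.2) (a \in avoid
  X M).
Proof. by rewrite mem_filter andbC; apply: andP. Qed.

(* The node N stands for the objects without records and is adjacent to every
   node. *)
Record graph (N nr : nat) (G : nat -> seq nat) (tbl : nat -> seq nat -> bool) : Prop :=
  Graph {
  graph_ghost : N \in G N;
  graph_sub : forall u, {subset G u <= G N};
  graph_uniq : forall u, uniq (G u);
  graph_le : forall v, v \in G N -> v <= N;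
  graph_tbl : forall r ds, tbl r ds -> forall x y, x \in ds -> y \in ds -> y \in G x
}.

Definition acc_add e := CSet 5 (EOp OAdd (EReg 5) e).

(** [None] stands for the all-ones vector. *)
Definition esrc (o : option nat) Y := if o is Some r then earr r [:: EReg (var_reg Y)] else
  ECst 1.

(** * Products of a matrix, sparse or of rank one, with a vector *)

Section Programs.
Variable nr : nat.

Definition mv_term Y M src := EOp OMul (ewt nr (var_reg Y)) (EOp OMul (emon M) (esrc src
  Y)).
Definition mv_store X dst e := CStore (eaddr dst [:: EReg (var_reg X)]) e.

(* The entry of dst at x is the weighted sum of M(x, y) * src(y) over y. If no
   atom joins x and y, then M(x, y) is a product f(x) * g(y) and one sum over y
   serves all x. *)
Definition matvec X Y M src dst :=
  if joined X Y M then
    foreach nr X 2 (CSeq (CSet 5 (ECst 0))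
      (CSeq (foreach nr Y (var_reg X) (acc_add (mv_term Y M src)))
        (mv_store X dst (EReg 5))))
  else
    CSeq (CSet 5 (ECst 0))
      (CSeq (foreach nr Y 2 (acc_add (mv_term Y (avoid X M) src)))
        (foreach nr X 2 (mv_store X dst (EOp OMul (EReg 5) (emon (avoid Y M)))))).

Definition store_cost X dst e := (cost (eaddr dst [:: EReg (var_reg X)]) + cost e).+1.
Definition mv_cost X Y M src dst :=
  cost (mv_term Y M src) + cost (mv_term Y (avoid X M) src) + store_cost X dst (EReg 5) +
  store_cost X dst (EOp OMul (EReg 5) (emon (avoid Y M))) + 5 * loop_cost + 20.

End Programs.

Section Env.
Variables (w B D N nr : nat) (G : nat -> seq nat) (tbl : nat -> seq nat -> bool).
Hypothesis ENV : env w B D N nr G.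
Hypothesis GR : graph N nr G tbl.
Variable K : comPzRingType.
Hypothesis hK : forall n, ((n %% 2 ^ w)%:R = n%:R :> K)%R.
Let hB := env_word ENV.
Let hw := env_w ENV.
Let nrB := env_nr ENV.
Let NB := env_N ENV.
Let D2 := env_D ENV.
Let Gsz := env_G ENV.

Notation good := (digits_ok B D).
Notation arr := (cell B).
Notation L := (G N).
Notation static := (static B D N nr G tbl).

Definition wf (M : seq (nat * seq nat)) := all (fun a => (a.1 < nr) && (size a.2 <= D)) M.

Lemma wf_avoid X (M : seq (nat * seq nat)) : wf M -> wf (avoid X M).
Proof. by move/allP => H; apply/allP => a /avoidP[aM _]; apply: H. Qed.

(* The number of objects that v stands for, given that L has one node besides
   the objects with records. *)
Definition weight (v : nat) : K :=
  ((v < N)%N%:R + (v == N)%N%:R * (N%:R + 1 - (size L)%:R))%R.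

Definition degsum := \sum_(x <- L) (size (G x)).+1.

Lemma L_le v : v \in L -> v <= N. Proof. exact: graph_le GR _. Qed.

Lemma size_L_degsum : size L <= degsum.
Proof. by rewrite /degsum -sum1_size; apply: leq_sum => x _. Qed.

Lemma size_L_gt0 : 0 < size L.
Proof. by have := graph_ghost GR; case: L. Qed.

Lemma good1 v : v <= N -> good [:: v].
Proof. by move=> vN; apply: (good_le ENV) => /=; rewrite ?vN //; lia. Qed.

Lemma eval_mon s M rho :
  static s -> wf M ->
  (forall a v, a \in M -> v \in a.2 -> reg s (var_reg v) = rho v /\ rho v <= N) ->
  ((eval w s (emon M))%:R = (mon tbl M rho)%:R :> K)%R.
Proof.
move=> st; elim: M => [|a M IH]; first by rewrite eval_cst.
case/andP => /andP[a1 a2] wfM H.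
have -> : emon (a :: M) = EOp OMul (eatom a) (emon M) by [].
rewrite eval_mul // [mon _ _ _]/= IH //; last first.
  by move=> b v bM vb; apply: (H b) => //; rewrite inE bM orbT.
have aE : [seq eval w s e | e <- [seq EReg (var_reg v) | v <- a.2]] = [seq rho v | v <-
  a.2].
  rewrite -map_comp; apply/eq_in_map => v va /=.
  by have [] := H a v (mem_head _ _) va.
have gd : good [seq rho v | v <- a.2].
  apply: (good_le ENV); last by rewrite size_map.
  by apply/allP => _ /mapP[v va ->]; have [] := H a v (mem_head _ _) va.
have [S1 S2 S3 S4 S5] := st.
rewrite /eatom (eval_earr hB) ?aE //; last by lia.
by rewrite S3 // -natrM mulnb.
Qed.

Lemma eval_wt s z v : static s -> reg s z = v -> ((eval w s (ewt nr z))%:R = weight v :>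
  K)%R.
Proof.
move=> st rz; have rN : reg s 2 = N by case: st.
rewrite /ewt eval_add // eval_lt // eval_mul // eval_eq // !eval_add // eval_mul //.
rewrite eval_neg1 // (eval_deg ENV st rN) // eval_cst // [eval w s (EReg z)]/= [eval w s
  (EReg 2)]/= rz rN.
by rewrite /weight mulN1r.
Qed.

(** [G x] is, up to order, a sublist of L; this is how scanning one neighbour list yields a sum over
    all nodes. *)
Lemma sum_G x (f : nat -> K) : x \in L ->
  (forall y, y \in L -> y \notin G x -> f y = 0%R) ->
  (\sum_(y <- G x) f y = \sum_(y <- L) f y)%R.
Proof.
move=> xL f0.
have pe : perm_eq (G x) [seq y <- L | y \in G x].
  apply: uniq_perm; rewrite ?filter_uniq ?(graph_uniq GR) // => y.
  rewrite mem_filter; case yG: (y \in G x) => //=; exact/esym/(graph_sub GR yG).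
rewrite (perm_big _ pe) big_filter big_mkcond /=.
apply: eq_big_seq => y yL; case: ifP => // /negbT yG; by rewrite f0.
Qed.

(** The atom containing X and Y must hold, and its record makes the two values adjacent. *)
Lemma mon_joined X Y M rho : joined X Y M -> mon tbl M rho -> rho Y \in G (rho X).
Proof.
case/hasP => a aM /andP[Xa Ya] /allP /(_ a aM) t.
by apply: (graph_tbl GR t); apply: map_f.
Qed.

Lemma acc_spec Y p e u s (f : nat -> K) :
  u <= N -> p != var_reg Y -> p != ctr_reg Y -> p != 5 ->
  (forall v s1, v \in G u -> static s1 ->
     (forall i, i != 5 -> i != var_reg Y -> i != ctr_reg Y -> reg s1 i = reg s i) ->
     Defs.mem s1 = Defs.mem s -> reg s1 (var_reg Y) = v ->
     ((eval w s1 e)%:R = f v)%R) ->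
  static s -> reg s p = u ->
  runs w (foreach nr Y p (acc_add e)) s (fun s' =>
    [/\ static s', Defs.mem s' = Defs.mem s,
        (forall i, i != 5 -> i != var_reg Y -> i != ctr_reg Y -> reg s' i = reg s i) &
        ((reg s' 5)%:R = (reg s 5)%:R + \sum_(v <- G u) f v)%R])
    (loop_cost + size (G u) * (cost e + 3 + loop_cost)).
Proof.
move=> uN pz pc p5 He st rp.
pose Inv (x : K) (s1 : state) := [/\ Defs.mem s1 = Defs.mem s,
  (forall i, i != 5 -> i != var_reg Y -> i != ctr_reg Y -> reg s1 i = reg s i) &
  ((reg s1 5)%:R = x)%R].
have H := @foreach_spec w B D N nr G tbl ENV K Inv (fun v x => x + f v)%R (fun=> cost e + 3)
  Y p (acc_add e) u ((reg s 5)%:R)%R s uN pz pc.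
apply: runs_weaken (H _ _ _ _ st rp _) _ _ => {H}.
- by rewrite mem_mods.
- by rewrite mem_mods /ctr_reg; lia.
- move=> x s1 r v rr [m1 r1 x1]; split=> //.
    by move=> i i5 iz ic /=; rewrite update_other ?r1 //; case: rr => ->.
  by rewrite /= update_other ?x1 //; case: rr => ->; rewrite /var_reg /ctr_reg; lia.
- move=> v x s1 vG [m1 r1 x1] st1 rp1 rz.
  apply: (runs_weaken (Q := fun s' => static s' /\ Inv (x + f v)%R s') (T := (cost (EOp
    OAdd (EReg 5) e)).+1)) => //; last by rewrite /=; lia.
  apply: runs_set; split; first exact: static_set_reg.
  split=> //.
    by move=> i i5 iz ic /=; rewrite update_other ?r1.
  rewrite reg_set_same eval_add //.
  by rewrite [eval w s1 (EReg 5)]/= x1 (He v).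
- by [].
- move=> s' [st' [m' r' x']]; split=> //.
  rewrite x'; elim: (G u) ((reg s 5)%:R)%R => [|v l IH] x /=; first by rewrite big_nil
    addr0.
  by rewrite IH big_cons addrA.
- by rewrite big_const_seq iter_addn count_predT addn0 mulnC.
Qed.

Lemma store_spec X r e s (x : nat) (v : K) :
  Rvec1 nr <= r <= Rcnt nr -> static s -> reg s (var_reg X) = x -> x <= N ->
  ((eval w s e)%:R = v)%R ->
  runs w (mv_store X r e) s (fun s' =>
    [/\ static s', reg s' = reg s,
      (forall r' ds, r' <= Rcnt nr -> good ds -> ~~ ((r' == r) && (ds == [:: x])) ->
         arr s' r' ds = arr s r' ds) &
      ((arr s' r [:: x])%:R = v)%R]) (store_cost X r e).
Proof.
move=> /andP[r1 r2] st rx xN ev.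
have rB := region_lt ENV r2.
have gx := good1 xN.
have S1 : reg s 1 = B by case: st.
have E : [seq eval w s e | e <- [:: EReg (var_reg X)]] = [:: x] by rewrite /= rx.
apply: (runs_store_arr hB) => //; rewrite E //; split=> //.
- apply: (static_set_mem ENV) => //; rewrite r2 andbT; exact: ltnW.
- move=> r' ds r'B gd /negbTE ne; rewrite (cell_set_mem (D := D)) // ?ne //.
  exact: (region_lt ENV).
- by rewrite (cell_set_mem (D := D)) // !eqxx.
Qed.

Definition vec_set (s s' : state) dst (f : nat -> K) (l : seq nat) : Prop :=
  [/\ static s',
      (forall r ds, r <= Rcnt nr -> good ds -> r != dst -> arr s' r ds = arr s r ds) &
      (forall x, x \in l -> ((arr s' dst [:: x])%:R = f x)%R)].

Lemma matvec_spec X Y M src dst s (rho : nat -> nat) (f : nat -> K) :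
  X != Y -> wf M -> Rvec1 nr <= dst <= Rcnt nr ->
  (forall a v, a \in M -> v \in a.2 -> v != X -> v != Y -> reg s (var_reg v) = rho v /\ rho
    v <= N) ->
  (if src is Some r then
     [/\ r <= Rcnt nr, r != dst & forall y, y \in L -> ((arr s r [:: y])%:R = f y)%R]
   else forall y, f y = 1%R) ->
  static s ->
  runs w (matvec nr X Y M src dst) s (fun s' =>
    vec_set s s' dst (fun x => \sum_(y <- L)
        weight y * ((mon tbl M (update (update rho Y y) X x))%:R * f y))%R L)
    (mv_cost nr X Y M src dst * degsum).
Proof.
move=> XY wfM hdst Hrho Hsrc st.
have [d1 d2] := andP hdst.
have zz i j : (var_reg i == var_reg j) = (i == j) by rewrite /var_reg; lia.
have zc i j : (var_reg i == ctr_reg j) = false by rewrite /var_reg /ctr_reg; lia.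
have z5 i : (var_reg i == 5) = false by rewrite /var_reg; lia.
have esrcE s1 (y : nat) : static s1 -> y \in L -> reg s1 (var_reg Y) = y ->
    (forall r ds, r <= Rcnt nr -> good ds -> r != dst -> arr s1 r ds = arr s r ds) ->
    ((eval w s1 (esrc src Y))%:R = f y)%R.
  move=> st1 yL ry fr; case: src Hsrc => [r [rR rd Hr]|Hf]; last first.
    by rewrite /esrc eval_cst // Hf.
  have E : [seq eval w s1 e | e <- [:: EReg (var_reg Y)]] = [:: y] by rewrite /= ry.
  have gy := good1 (L_le yL).
  rewrite /esrc (eval_earr hB) ?E ?fr ?Hr //; last exact: (region_lt ENV).
  by case: st1.
have termE M' s1 (x y : nat) : wf M' -> {subset M' <= M} -> static s1 -> y \in L -> x <= N
  ->
    reg s1 (var_reg Y) = y ->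
    (forall a v, a \in M' -> v \in a.2 -> v = X -> reg s1 (var_reg X) = x) ->
    (forall i, i != X -> i != Y -> reg s1 (var_reg i) = reg s (var_reg i)) ->
    (forall r ds, r <= Rcnt nr -> good ds -> r != dst -> arr s1 r ds = arr s r ds) ->
    ((eval w s1 (mv_term nr Y M' src))%:R =
     weight y * ((mon tbl M' (update (update rho Y y) X x))%:R * f y))%R.
  move=> wfM' sub st1 yL xN ry rx fr fm; rewrite /mv_term !eval_mul //.
  rewrite (eval_wt st1 ry) (esrcE s1 y) //; congr (_ * (_ * _))%R.
  apply: eval_mon => // a v aM va; rewrite /update.
  case: (eqVneq v X) => [vX|vX]; first by rewrite vX (rx a v).
  case: (eqVneq v Y) => [->|vY]; first by split=> //; exact: L_le.
  by rewrite fr //; apply: Hrho (sub _ aM) va _ _.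
have degL : 1 <= degsum by apply: leq_trans size_L_degsum; exact: size_L_gt0.
rewrite /matvec; case: ifP => [jn|/negbT njn].
(* The ghost value [l] lists the nodes whose entry of [dst] is final. *)
- pose Inv (l : seq nat) s1 := {subset l <= L} /\ (forall r ds, r <= Rcnt nr -> good ds ->
    r != dst -> arr s1 r ds = arr s r ds) /\
     (forall i, i != X -> i != Y -> reg s1 (var_reg i) = reg s (var_reg i)) /\
     (forall x, x \in l -> ((arr s1 dst [:: x])%:R = \sum_(y <- L)
        weight y * ((mon tbl M (update (update rho Y y) X x))%:R * f y))%R).
  have S2 : reg s 2 = N by case: st.
  set cT := cost (mv_term nr Y M src).
  set cS := store_cost X dst (EReg 5).
  have H := @foreach_spec w B D N nr G tbl ENV (seq nat) Inv (fun v l => v :: l)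
    (fun x => 2 + ((loop_cost + size (G x) * (cT + 3 + loop_cost)) + cS)) X 2
    (CSeq (CSet 5 (ECst 0))
      (CSeq (foreach nr Y (var_reg X) (acc_add (mv_term nr Y M src)))
        (mv_store X dst (EReg 5)))) N [::] s (leqnn N) isT isT.
  apply: runs_weaken (H _ _ _ _ st S2 _) _ _ => {H} //.
  + rewrite !mem_mods /var_reg /ctr_reg; lia.
  + move=> l s1 r v rr [I0 [I1 [I2 I3]]]; split=> //; split=> //; split=> // i iX iY /=.
    by rewrite update_other ?I2 //; case: rr => ->; rewrite ?zz ?zc.
  + move=> x l s1 xL [I0 [I1 [I2 I3]]] st1 _ rx.
    apply: runs_seq; apply: runs_set; apply: runs_seq.
    set s2 := set_reg _ _ _.
    have st2 : static s2 by apply: static_set_reg.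
    have xN := L_le xL.
    have HA := @acc_spec Y (var_reg X) (mv_term nr Y M src) x s2 (fun y => weight y * ((mon
      tbl M (update (update rho Y y) X x))%:R * f y))%R xN.
    apply: runs_weaken (HA _ _ _ _ st2 _) _ _ => {HA} //; rewrite ?zz ?zc ?z5 //.
    * move=> y s3 yG st3 fr3 m3 ry; apply: termE => //.
      -- exact: (graph_sub GR yG).
      -- by move=> a v _ _ _; rewrite fr3 ?zz ?zc ?z5 //= update_other ?z5.
      -- by move=> i iX iY; rewrite fr3 ?zz ?zc ?z5 //= update_other ?z5 // I2.
      -- by move=> r ds rR gd rd; rewrite /cell m3; exact: I1.
    * move=> s3 [st3 m3 fr3 acc3].
      have rx3 : reg s3 (var_reg X) = x.
        by rewrite fr3 ?zz ?zc ?z5 //= update_other ?z5.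
      have HS := store_spec (e := EReg 5) hdst st3 rx3 xN acc3.
      apply: runs_weaken HS _ (leqnn _) => s4 [st4 r4 m4 v4]; split=> //; split; last
        split; last split.
      -- by move=> x'; rewrite inE => /orP[/eqP ->//|/I0].
      -- move=> r ds rR gd rd; rewrite m4 //; last by rewrite (negbTE rd).
         by rewrite /cell m3; exact: I1.
      -- by move=> i iX iY; rewrite r4 fr3 ?zz ?zc ?z5 //= update_other ?z5 // I2.
      -- move=> x'; rewrite inE; case: (eqVneq x' x) => [->|ne] /= x'l.
           rewrite v4 /s2 /= update_same mod0n add0r; apply: sum_G => // y yL yG.
           (* A true monomial would make y a neighbour of x, since some atom joins X and Y. *)
           case E: (mon _ _ _); last by rewrite mul0r mulr0.
           have := mon_joined jn E; rewrite /update eqxx (eq_sym Y X) (negbTE XY) eqxx.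
           by rewrite (negbTE yG).
         have x'N := L_le (I0 _ x'l).
         rewrite m4 // ?eqxx ?eqseq_cons ?andbT //; last exact: good1.
         by rewrite /cell m3; apply: I3.
  + by move=> s' [st' [I0 [I1 [I2 I3]]]]; split=> // x xL; apply: I3;
       rewrite mem_foldl_cons xL.
  + set cc := cT + cS + 2 * loop_cost + 5.
    have le1 : \sum_(v <- L) (2 + (loop_cost + size (G v) * (cT + 3 + loop_cost) + cS) +
      loop_cost) <= cc * degsum.
      rewrite /degsum big_distrr /=; apply: leq_sum => v _; rewrite /cc; nia.
    apply: leq_trans (leq_add (leqnn loop_cost) le1) _.
    have le2 : loop_cost + cc <= mv_cost nr X Y M src dst by rewrite /mv_cost -/cT -/cS
      /cc; lia.
    apply: leq_trans (leq_mul le2 (leqnn degsum)).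
    by rewrite mulnDl leq_add2r; nia.
- set cT := cost (mv_term nr Y (avoid X M) src).
  set cS := store_cost X dst (EOp OMul (EReg 5) (emon (avoid Y M))).
  have S2 : reg s 2 = N by case: st.
  have le2 : 2 + ((loop_cost + size L * (cT + 3 + loop_cost)) + (loop_cost + \sum_(v <- L)
    (cS + loop_cost))) <=
      mv_cost nr X Y M src dst * degsum.
    have le1 := size_L_degsum.
    rewrite big_const_seq iter_addn count_predT addn0.
    apply: (@leq_trans ((cT + cS + 4 * loop_cost + 5) * degsum)).
      move: degL le1; move: degsum (size L) => d n; nia.
    by rewrite leq_mul2r; apply/orP; right; rewrite /mv_cost -/cT -/cS; lia.
  apply: runs_weaken le2 => [|s' H]; last exact: H.
  apply: runs_seq; apply: runs_set; apply: runs_seq.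
  set s2 := set_reg _ _ _.
  have st2 : static s2 by apply: static_set_reg.
  have wfX := wf_avoid X wfM; have wfY := wf_avoid Y wfM.
  have subX : {subset avoid X M <= M} by move=> a /avoidP[].
  have subY : {subset avoid Y M <= M} by move=> a /avoidP[].
  pose g y := (weight y * ((mon tbl (avoid X M) (update rho Y y))%:R * f y))%R.
  have HA := @acc_spec Y 2 (mv_term nr Y (avoid X M) src) N s2 g (leqnn N).
  apply: runs_weaken (HA _ _ _ _ st2 _) _ _ => {HA} //.
  (* The 0 is a dummy value for X, which occurs in no atom of [avoid X M]. *)
  + move=> y s3 yL st3 fr3 m3 ry; rewrite (termE (avoid X M) s3 0 y) //.
    * congr (_ * (_ %:R * _))%R; congr nat_of_bool; apply: eq_mon => a v /avoidP[aM Xa] va.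
      by rewrite [update _ X _ _]update_other //; apply: contraNneq Xa => <-.
    * by move=> a v /avoidP[aM Xa] va vX; rewrite vX (negbTE Xa) in va.
    * move=> i iX iY; rewrite fr3 ?zz ?zc ?z5 // reg_set_other ?z5 //.
    * by move=> r ds rR gd rd; rewrite /cell m3.
  + move=> s3 [st3 m3 fr3 acc3].
    pose Inv (l : seq nat) s1 := {subset l <= L} /\ (forall r ds, r <= Rcnt nr -> good ds
      -> r != dst -> arr s1 r ds = arr s r ds) /\
     (forall i, i != X -> i != Y -> reg s1 (var_reg i) = reg s (var_reg i)) /\
     ((reg s1 5)%:R = \sum_(y <- L) g y)%R /\
     (forall x, x \in l -> ((arr s1 dst [:: x])%:R = \sum_(y <- L)
        weight y * ((mon tbl M (update (update rho Y y) X x))%:R * f y))%R).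
    have H := @foreach_spec w B D N nr G tbl ENV (seq nat) Inv (fun v l => v :: l)
      (fun=> cS) X 2 (mv_store X dst (EOp OMul (EReg 5) (emon (avoid Y M)))) N [::] s3
        (leqnn N) isT isT isT isT.
    apply: runs_weaken (H _ _ st3 _ _) _ _ => {H} //.
    * move=> l s1 r v rr [I0 [I1 [I2 [I4 I3]]]]; split=> //; split=> //; split; last
        split=> //.
        by move=> i iX iY; rewrite reg_set_other ?I2 //; case: rr => ->; rewrite ?zz ?zc.
      by rewrite reg_set_other ?I4 //; case: rr => ->; rewrite eq_sym ?z5 // /ctr_reg; lia.
    * move=> x l s1 xL [I0 [I1 [I2 [I4 I3]]]] st1 _ rx.
      have xN := L_le xL.
      have ev : ((eval w s1 (EOp OMul (EReg 5) (emon (avoid Y M))))%:R =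
        \sum_(y <- L) weight y * ((mon tbl M (update (update rho Y y) X x))%:R * f y))%R.
        rewrite eval_mul // [eval w s1 (EReg 5)]/= I4 mulr_suml.
        rewrite (@eval_mon s1 _ (update rho X x)) //.
          apply: eq_bigr => y _; rewrite (mon_split _ _ njn) -mulnb natrM.
          have -> : mon tbl (avoid X M) (update (update rho Y y) X x) = mon tbl (avoid X M)
            (update rho Y y).
            apply: eq_mon => a v /avoidP[aM Xa] va.
            by rewrite [update _ X _ _]update_other //; apply: contraNneq Xa => <-.
          have -> : mon tbl (avoid Y M) (update (update rho Y y) X x) = mon tbl (avoid Y M)
            (update rho X x).
            apply: eq_mon => a v /avoidP[aM Ya] va.
            by rewrite /update; case: eqP => // _; case: eqP => // vY; rewrite -vY va in Ya.
          rewrite /g; ring.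
        move=> a v /avoidP[aM Ya] va; rewrite /update; case: (eqVneq v X) => [->|vX]; first
          by rewrite rx.
        have vY : v != Y by apply: contraNneq Ya => <-.
        by rewrite I2 //; apply: Hrho aM va _ _.
      have HS := store_spec hdst st1 rx xN ev.
      apply: runs_weaken HS _ (leqnn _) => s4 [st4 r4 m4 v4]; split=> //.
      split; first by move=> x'; rewrite inE => /orP[/eqP ->//|/I0].
      split; first by move=> r ds rR gd rd; rewrite m4 ?I1 // (negbTE rd).
      split; first by move=> i iX iY; rewrite r4 I2.
      split; first by rewrite r4.
      move=> x'; rewrite inE; case: (eqVneq x' x) => [-> _ //|ne] /= x'l.
      have x'N := L_le (I0 _ x'l).
      by rewrite m4 // ?eqxx ?eqseq_cons ?andbT ?I3 //; exact: good1.
    * by case: st3.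
    * split=> //; split; first by move=> r ds rR gd rd; rewrite /cell m3.
      split; first by move=> i iX iY; rewrite fr3 ?zz ?zc ?z5 // reg_set_other ?z5.
      by split=> //; rewrite acc3 reg_set_same /= mod0n add0r.
    * by move=> s' [st' [I0 [I1 [I2 [I4 I3]]]]]; split=> // x xL; apply: I3;
       rewrite mem_foldl_cons xL.
Qed.
End Env.

(** * One conjunction: the last three variables a, b, c have indices n, n + 1, n + 2 *)

Section Programs.
Variables (nr k n : nat).

Definition ecoef (b : bool) := if b then eneg1 else ECst 1.
(** Weights of the counted variables up to a; those of b and c enter the inner sums. The variables
    below k are chosen, not counted, and carry no weight. *)
Definition ewts :=
  foldr (fun j e => EOp OMul (ewt nr (var_reg j)) e) (ECst 1) (iota k (n.+1 - k)).
Definition exs := [seq EReg (var_reg j) | j <- iota 0 k].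
(** The counter is selected by the first k values. With k <= n + 1 these are enumerated values,
    possibly with a as the last one, never b or c. *)
Definition addcnt b fe :=
  CStore (eaddr (Rcnt nr) exs)
    (EOp OAdd (earr (Rcnt nr) exs) (EOp OMul (EOp OMul (ecoef b) ewts) fe)).
Definition addall b fe := foreach nr n 2 (addcnt b fe).
Definition evec r := earr r [:: EReg (var_reg n)].

Definition tri_term M :=
  EOp OMul (ewt nr (var_reg n.+1)) (EOp OMul (ewt nr (var_reg n.+2)) (emon M)).
Definition pick_smaller :=
  CIf (EOp OLt (edeg nr (var_reg n)) (edeg nr (var_reg n.+1)))
    (CSet 6 (EReg (var_reg n))) (CSet 6 (EReg (var_reg n.+1))).
Definition tri b M :=
  foreach nr n 2 (CSeq (CSet 5 (ECst 0))
    (CSeq (foreach nr n.+1 (var_reg n)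
             (CSeq pick_smaller (foreach nr n.+2 6 (acc_add (tri_term M)))))
      (addcnt b (EReg 5)))).

(** If b and c are not joined, the count at a is the product of a sum over b and a sum over c. If a
    and c are not joined, it is a matrix product along the path a, b, c, evaluated from the far end.
    If a and b are not joined, the path is a, c, b. Dropping the atoms with the third variable
    leaves the factor for the other two. *)
Definition mon_prog b M :=
  if ~~ joined n.+1 n.+2 M then
    CSeq (matvec nr n n.+1 (avoid n.+2 M) None (Rvec1 nr))
      (CSeq (matvec nr n n.+2 (avoid n.+1 M) None (Rvec2 nr))
        (addall b (EOp OMul (evec (Rvec1 nr)) (evec (Rvec2 nr)))))
  else if ~~ joined n n.+2 M then
    CSeq (matvec nr n.+1 n.+2 (avoid n M) None (Rvec1 nr))
      (CSeq (matvec nr n n.+1 (avoid n.+2 M) (Some (Rvec1 nr)) (Rvec2 nr))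
        (addall b (evec (Rvec2 nr))))
  else if ~~ joined n n.+1 M then
    CSeq (matvec nr n.+2 n.+1 (avoid n M) None (Rvec1 nr))
      (CSeq (matvec nr n n.+2 (avoid n.+1 M) (Some (Rvec1 nr)) (Rvec2 nr))
        (addall b (evec (Rvec2 nr))))
  else tri b M.

Definition addcnt_cost b fe :=
  (cost (eaddr (Rcnt nr) exs) +
    cost (EOp OAdd (earr (Rcnt nr) exs) (EOp OMul (EOp OMul (ecoef b) ewts) fe))).+1.

Definition mon_cost b M :=
  mv_cost nr n n.+1 (avoid n.+2 M) None (Rvec1 nr) +
  mv_cost nr n n.+2 (avoid n.+1 M) None (Rvec2 nr) +
  mv_cost nr n.+1 n.+2 (avoid n M) None (Rvec1 nr) +
  mv_cost nr n n.+1 (avoid n.+2 M) (Some (Rvec1 nr)) (Rvec2 nr) +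
  mv_cost nr n.+2 n.+1 (avoid n M) None (Rvec1 nr) +
  mv_cost nr n n.+2 (avoid n.+1 M) (Some (Rvec1 nr)) (Rvec2 nr) +
  addcnt_cost b (EOp OMul (evec (Rvec1 nr)) (evec (Rvec2 nr))) +
  addcnt_cost b (evec (Rvec2 nr)) + addcnt_cost b (EReg 5) +
  cost (tri_term M) + 20 * loop_cost + 100.

Lemma low_mods_seq c1 c2 : low_mods n c1 -> low_mods n c2 -> low_mods n (CSeq c1 c2).
Proof. by rewrite /low_mods /= all_cat => -> ->. Qed.

Lemma low_mods_foreach i p c : n <= i -> low_mods n c -> low_mods n (foreach nr i p c).
Proof.
move=> ni /allP H; apply/allP => j; rewrite mem_mods.
by move=> /orP[/orP[/eqP ->|/eqP ->]|/H //]; apply/orP; right; rewrite /var_reg /ctr_reg;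
  lia.
Qed.

Lemma low_mods_matvec X Y M src dst :
  n <= X -> n <= Y -> low_mods n (matvec nr X Y M src dst).
Proof.
move=> nX nY; rewrite /matvec; case: ifP => _.
  apply: low_mods_foreach => //; apply: low_mods_seq => //; apply: low_mods_seq => //.
  exact: low_mods_foreach.
by apply: low_mods_seq => //; apply: low_mods_seq; apply: low_mods_foreach.
Qed.

Lemma low_mods_mon b M : low_mods n (mon_prog b M).
Proof.
have n1 := leqnSn n; have n2 := leq_trans n1 (leqnSn n.+1).
rewrite /mon_prog; case: ifP => _; [|case: ifP => _; [|case: ifP => _]].
1-3: apply: low_mods_seq; first exact: low_mods_matvec.
1-3: apply: low_mods_seq; first exact: low_mods_matvec.
1-3: exact: low_mods_foreach.
apply: low_mods_foreach => //; apply: low_mods_seq => //; apply: low_mods_seq => //.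
apply: low_mods_foreach => //; apply: low_mods_seq => //.
exact: low_mods_foreach.
Qed.

End Programs.

Section Env.
Variables (w B D N nr : nat) (G : nat -> seq nat) (tbl : nat -> seq nat -> bool).
Hypothesis ENV : env w B D N nr G.
Hypothesis GR : graph N nr G tbl.
Variable K : comPzRingType.
Hypothesis hK : forall n, ((n %% 2 ^ w)%:R = n%:R :> K)%R.
Variables (k n : nat).
Hypothesis kn : k <= n.+1.
Hypothesis kD : k <= D.
Let hB := env_word ENV.
Let hw := env_w ENV.

Notation good := (digits_ok B D).
Notation arr := (cell B).
Notation L := (G N).
Notation static := (static B D N nr G tbl).
Notation wt := (weight N G K).
Notation wf := (wf D nr).

(** The work of the triangle loops up to a constant; each [.+1] pays for the overhead of one loop
    level. *)
Definition trisum :=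
  \sum_(x <- L) (\sum_(y <- G x) (minn (size (G x)) (size (G y))).+1).+1.

Definition coef (b : bool) : K := if b then (-1)%R else 1%R.
Definition wts zs : K := (\prod_(v <- drop k zs) wt v)%R.

(** Only the residues of the counters are described: before all signed monomials have been added, a
    counter need not be a count. *)
Definition counts_are (F : seq nat -> K) (s : state) :=
  forall xs, size xs = k -> all (geq N) xs -> ((arr s (Rcnt nr) xs)%:R = F xs)%R.

Lemma counts_are_ext F F' s : F =1 F' -> counts_are F s -> counts_are F' s.
Proof. by move=> E H xs sz le; rewrite H // E. Qed.

Definition regs_are (s : state) (zs : seq nat) :=
  forall j, j < size zs -> reg s (var_reg j) = nth 0 zs j.

Lemma map_exs s zs : regs_are s zs -> size zs = n.+1 ->
  [seq eval w s e | e <- exs k] = take k zs.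
Proof.
move=> rz sz; apply: (@eq_from_nth _ 0); rewrite !size_map size_iota.
  by rewrite size_takel // sz.
move=> i ik; rewrite (nth_map (ECst 0)) ?size_map ?size_iota //.
by rewrite (nth_map 0) ?size_iota // nth_iota // nth_take //= rz // sz; lia.
Qed.

Lemma eval_wts s zs : static s -> regs_are s zs -> size zs = n.+1 ->
  ((eval w s (ewts nr k n))%:R = wts zs)%R.
Proof.
move=> st rz sz; rewrite /ewts /wts.
have -> : drop k zs = [seq nth 0 zs j | j <- iota k (n.+1 - k)].
  apply: (@eq_from_nth _ 0); first by rewrite size_drop size_map size_iota sz.
  move=> i; rewrite size_drop sz => ik.
  by rewrite nth_drop (nth_map 0) ?size_iota // nth_iota.
have : all (gtn n.+1) (iota k (n.+1 - k)).
  by apply/allP => j; rewrite mem_iota /=; lia.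
elim: (iota _ _) => [_|j l IH /andP[jn ln]].
  by rewrite big_nil; exact: eval_cst.
rewrite [foldr _ _ _]/= eval_mul // IH // big_cons (eval_wt ENV hK st (rz j _)) // sz //.
Qed.

Lemma addcnt_spec b fe s F zs (v : K) :
  size zs = n.+1 -> all (geq N) zs -> regs_are s zs ->
  ((eval w s fe)%:R = v)%R -> static s -> counts_are F s ->
  runs w (addcnt nr k n b fe) s (fun s' =>
    [/\ static s', reg s' = reg s,
      (forall r ds, r <= Rcnt nr -> good ds -> r != Rcnt nr -> arr s' r ds = arr s r ds) &
      counts_are (fun xs => F xs + (xs == take k zs)%:R * (coef b * wts zs * v))%R s'])
    (addcnt_cost nr k n b fe).
Proof.
move=> sz zN rz ev st cI.
have S1 : reg s 1 = B by case: st.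
have rB : (Rcnt nr).+1 < B by exact: (region_lt ENV).
have ex := map_exs rz sz.
have tN : all (geq N) (take k zs).
  by apply/allP => x /mem_take; apply: (allP zN).
have szt : size (take k zs) = k by rewrite size_takel // sz.
have gt : good (take k zs) by apply: (good_le ENV) => //; rewrite szt.
apply: (runs_store_arr hB) => //; rewrite ex //; split=> //.
- apply: (static_set_mem ENV) => //; rewrite leqnn andbT /Rbit /Rcnt; lia.
- move=> r ds rR gd /negbTE ne; rewrite (cell_set_mem (D := D)) // ?ne //.
  exact: (region_lt ENV).
- move=> xs szx xN; rewrite (cell_set_mem (D := D)) //; last by apply: (good_le ENV) => //;
    rewrite szx.
  rewrite eqxx andTb; case: (eqVneq xs (take k zs)) => [E|_].
    rewrite eval_add // !eval_mul // ev (eval_wts st rz sz) (eval_earr hB) ?ex //.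
    rewrite cI // mul1r E; congr (_ + _ * _ * _)%R.
    by rewrite /ecoef /coef; case: b; [exact: eval_neg1|exact: eval_cst].
  by rewrite mul0r addr0; apply: cI.
Qed.

Lemma foldl_add (t : nat -> seq nat -> K) l F xs :
  (foldl (fun F v xs => F xs + t v xs) F l xs = F xs + \sum_(v <- l) t v xs)%R.
Proof.
elim: l F => [|v l IH] F /=; first by rewrite big_nil addr0.
by rewrite IH big_cons addrA.
Qed.

Lemma regs_rcons s zs a : size zs = n -> regs_are s zs -> reg s (var_reg n) = a ->
  regs_are s (rcons zs a).
Proof.
move=> sz rz rn j; rewrite size_rcons nth_rcons ltnS => jn.
case: ltnP => jz; first exact: rz.
have -> : j = n by lia.
by rewrite -sz eqxx sz.
Qed.

(** The contribution of the prefix [zs] and the value [a] to the counter [xs], which is 0 unless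
    [xs] is their x-part. *)
Definition add_term b zs (f : nat -> K) xs a : K :=
  ((xs == take k (rcons zs a))%:R * (coef b * wts (rcons zs a) * f a))%R.

(* Both the loop that adds up precomputed vectors and the triangle loop have
   this shape. *)
Lemma outer_spec b zs (f : nat -> K) body F s T :
  size zs = n -> {subset zs <= L} ->
  2 \notin mods body -> ctr_reg n \notin mods body ->
  (forall j, j < n -> var_reg j \notin mods body) ->
  (forall a s1 F, a \in L -> static s1 -> regs_are s1 (rcons zs a) -> counts_are F s1 ->
    (forall r ds, r <= Rcnt nr -> good ds -> r != Rcnt nr -> arr s1 r ds = arr s r ds) ->
    runs w body s1 (fun s' => [/\ static s',
       (forall r ds, r <= Rcnt nr -> good ds -> r != Rcnt nr -> arr s' r ds = arr s1 r ds) &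
       counts_are (fun xs => F xs + add_term b zs f xs a)%R s']) (T a)) ->
  static s -> regs_are s zs -> counts_are F s ->
  runs w (foreach nr n 2 body) s (fun s' => static s' /\
     counts_are (fun xs => F xs + \sum_(a <- L) add_term b zs f xs a)%R s')
     (loop_cost + \sum_(a <- L) (T a + loop_cost)).
Proof.
move=> sz zL m2 mc mz Hb st rz cI.
pose Inv F s1 := [/\ regs_are s1 zs,
  (forall r ds, r <= Rcnt nr -> good ds -> r != Rcnt nr -> arr s1 r ds = arr s r ds) &
  counts_are F s1].
have S2 : reg s 2 = N by case: st.
have H := @foreach_spec w B D N nr G tbl ENV _ Inv
  (fun v F xs => F xs + add_term b zs f xs v)%R T n 2 body N F s (leqnn N) isT isT m2 mc.
apply: runs_weaken (H _ _ st S2 _) _ (leqnn _) => {H}.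
- move=> F1 s1 r v rr [I1 I2 I3]; split=> // j jn.
  have jn1 : j < n by rewrite -sz.
  by rewrite reg_set_other ?I1 //; case: rr => ->; rewrite /var_reg /ctr_reg; lia.
- move=> a F1 s1 aL [I1 I2 I3] st1 _ ra.
  have rza := regs_rcons sz I1 ra.
  apply: runs_weaken (runs_frame (Hb a s1 F1 aL st1 rza I3 I2)) _ (leqnn _).
  move=> s' [[st' fm cI'] fr]; split=> //; split=> //.
    by move=> j jn; rewrite fr ?I1 //; apply: mz; rewrite -sz.
  by move=> r ds rR gd rc; rewrite fm ?I2.
- by split.
- move=> s' [st' [_ _ cI']]; split=> //; apply: counts_are_ext cI' => xs.
  by rewrite foldl_add.
Qed.

Lemma addall_spec b zs (f : nat -> K) fe F s :
  size zs = n -> {subset zs <= L} ->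
  (forall a s1, a \in L -> static s1 -> reg s1 (var_reg n) = a ->
    (forall r ds, r <= Rcnt nr -> good ds -> r != Rcnt nr -> arr s1 r ds = arr s r ds) ->
    ((eval w s1 fe)%:R = f a)%R) ->
  static s -> regs_are s zs -> counts_are F s ->
  runs w (addall nr k n b fe) s (fun s' => static s' /\
     counts_are (fun xs => F xs + \sum_(a <- L) add_term b zs f xs a)%R s')
     ((addcnt_cost nr k n b fe + 2 * loop_cost) * degsum N G).
Proof.
move=> sz zL Hfe st rz cI.
have := @outer_spec b zs f (addcnt nr k n b fe) F s (fun=> addcnt_cost nr k n b fe)
  sz zL isT isT (fun _ _ => isT) _ st rz cI.
move=> H; apply: runs_weaken (H _) _ _ => {H} //.
- move=> a s1 F1 aL st1 rza cI1 fm.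
  have aN : a <= N by exact: (L_le GR).
  have sza : size (rcons zs a) = n.+1 by rewrite size_rcons sz.
  have zaN : all (geq N) (rcons zs a).
    by rewrite all_rcons /= aN; apply/allP => x /zL; exact: (L_le GR).
  have ra : reg s1 (var_reg n) = a.
    by rewrite rza ?sza // nth_rcons sz ltnn eqxx.
  apply: runs_weaken (addcnt_spec b sza zaN rza (Hfe a s1 aL st1 ra fm) st1 cI1) _ (leqnn
    _).
  by move=> s' [].
- have le1 := size_L_degsum N G; have := size_L_gt0 GR.
  rewrite big_const_seq iter_addn count_predT addn0.
  move: (size L) (degsum N G) le1 => x y; nia.
Qed.

(** Each neighbour adds at least 1 to the inner sum. The cases solved by matrix-vector products thus
    obey the bound of the triangle case. *)
Lemma leq_degsum_trisum : degsum N G <= trisum.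
Proof.
apply: leq_sum => x _; rewrite ltnS -sum1_size; exact: leq_sum.
Qed.

Definition rho3 (rho : nat -> nat) a b c :=
  update (update (update rho n.+2 c) n.+1 b) n a.

Definition fmon M zs a : K :=
  (\sum_(b <- L) \sum_(c <- L)
     wt b * (wt c * (mon tbl M (rho3 (nth 0 zs) a b c))%:R))%R.

(** All three pairs must be joined: restricting b to the neighbours of a uses [jAB], and restricting
    c to the shorter list uses [jAC] if that list belongs to a and [jBC] if it belongs to b. *)
Lemma tri_spec b M zs F s :
  size zs = n -> {subset zs <= L} -> wf M ->
  (forall a v, a \in M -> v \in a.2 -> v < n.+3) ->
  joined n n.+1 M -> joined n n.+2 M -> joined n.+1 n.+2 M ->
  static s -> regs_are s zs -> counts_are F s ->
  runs w (tri nr k n b M) s (fun s' => static s' /\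
     counts_are (fun xs => F xs + \sum_(a <- L) add_term b zs (fmon M zs) xs a)%R s')
     (mon_cost nr k n b M * trisum).
Proof.
have n20 : (n.+2 == n) = false by lia.
have n21 : (n.+2 == n.+1) = false by lia.
have n10 : (n.+1 == n) = false by lia.
move=> sz zL wfM vM jAB jAC jBC st rz cI.
set cT := cost (tri_term nr n M).
set cA := addcnt_cost nr k n b (EReg 5).
pose Tb x y := 22 + (loop_cost + minn (size (G x)) (size (G y)) * (cT + 3 + loop_cost)).
pose Tx x := 2 + ((loop_cost + \sum_(y <- G x) (Tb x y + loop_cost)) + cA).
have le2 : loop_cost + \sum_(x <- L) (Tx x + loop_cost) <= mon_cost nr k n b M * trisum.
  set c1 := cT + 3 * loop_cost + 30; set c2 := c1 + cA + 2 * loop_cost + 5.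
  have l1 x y : Tb x y + loop_cost <= c1 * (minn (size (G x)) (size (G y))).+1.
    by rewrite /Tb /c1; move: (minn _ _) => q; nia.
  have l2 x : Tx x + loop_cost <= c2 * (\sum_(y <- G x) (minn (size (G x)) (size (G
    y))).+1).+1.
    rewrite mulnS /Tx.
    apply: (@leq_trans (2 + (loop_cost + c1 * (\sum_(y <- G x) (minn (size (G x)) (size (G
      y))).+1) + cA) + loop_cost)).
      rewrite leq_add2r leq_add2l leq_add2r leq_add2l big_distrr /=.
      by apply: leq_sum => y _; apply: l1.
    move: (\sum_(y <- G x) _) => q; rewrite /c2; nia.
  have l3 : \sum_(x <- L) (Tx x + loop_cost) <= c2 * trisum.
    by rewrite /trisum big_distrr /=; apply: leq_sum => x _; apply: l2.
  have l4 : 0 < trisum.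
    by apply: leq_trans leq_degsum_trisum; apply: leq_trans (size_L_degsum N G); exact:
      (size_L_gt0 GR).
  apply: leq_trans (leq_add (leqnn loop_cost) l3) _.
  apply: (@leq_trans ((loop_cost + c2) * trisum)); first by move: l4; move: trisum => q;
    nia.
  rewrite leq_mul2r; apply/orP; right; rewrite /mon_cost -/cT -/cA /c2 /c1; lia.
apply: runs_weaken le2 => [|s' H]; last exact: H.
have zz i j : (var_reg i == var_reg j) = (i == j) by rewrite /var_reg; lia.
have zc i j : (var_reg i == ctr_reg j) = false by rewrite /var_reg /ctr_reg; lia.
have z5 i : (var_reg i == 5) = false by rewrite /var_reg; lia.
have z6 i : (var_reg i == 6) = false by rewrite /var_reg; lia.
apply: (outer_spec sz zL) => //.
- rewrite !mem_mods /var_reg /ctr_reg; lia.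
- move=> j jn; rewrite !mem_mods /var_reg /ctr_reg; lia.
move=> a s1 F1 aL st1 rza cI1 fm.
have aN : a <= N by exact: (L_le GR).
have sza : size (rcons zs a) = n.+1 by rewrite size_rcons sz.
have zaN : all (geq N) (rcons zs a).
  by rewrite all_rcons /= aN; apply/allP => x /zL; exact: (L_le GR).
have ra : reg s1 (var_reg n) = a.
  by rewrite rza ?sza // nth_rcons sz ltnn eqxx.
apply: runs_seq; apply: runs_set; apply: runs_seq.
set s2 := set_reg _ _ _.
pose Inv (x : K) s3 := [/\ Defs.mem s3 = Defs.mem s1, regs_are s3 (rcons zs a) & ((reg s3
  5)%:R = x)%R].
pose g y := (\sum_(c <- L) wt y * (wt c * (mon tbl M (rho3 (nth 0 zs) a y c))%:R))%R.
have H := @foreach_spec w B D N nr G tbl ENV _ Inv (fun v x => x + g v)%R (Tb a) n.+1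
  (var_reg n)
  (CSeq (pick_smaller nr n) (foreach nr n.+2 6 (acc_add (tri_term nr n M)))) a 0%R s2 aN.
apply: runs_weaken (H _ _ _ _ _ _ _ _ _) _ _ => {H} //.
- by rewrite zz; lia.
- by rewrite zc.
- rewrite !mem_mods /var_reg /ctr_reg; lia.
- rewrite !mem_mods /var_reg /ctr_reg; lia.
- move=> x s3 r v rr [I1 I2 I3]; split=> //.
    move=> j jn; rewrite reg_set_other ?I2 //; move: jn; rewrite sza => jn.
    by case: rr => ->; rewrite ?zz ?zc //; lia.
  by rewrite reg_set_other //; case: rr => ->; rewrite /var_reg /ctr_reg; lia.
- move=> y x s3 yG [I1 I2 I3] st3 ra3 ry.
  have yL := graph_sub GR yG; have yN := L_le GR yL.
  (* u is the end of the edge (a, y) with the shorter list; 22 is a rounded cost of comparing the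
     two degrees. *)
  have [u [uN us uab Hset]] : exists u, [/\ u <= N, size (G u) = minn (size (G a)) (size (G
    y)),
     (u = a \/ u = y) &
     runs w (pick_smaller nr n) s3 (fun s4 => s4 = set_reg s3 6 u) 22].
    pose cnd := size (G a) < size (G y).
    exists (if cnd then a else y); split; first by case: ifP.
    - by rewrite /cnd /minn; case: ifP.
    - by case: ifP; [left|right].
    - apply: (runs_weaken (Q := fun s4 => s4 = set_reg s3 6 (if cnd then a else y)) (T :=
        (cost (EOp OLt (edeg nr (var_reg n)) (edeg nr (var_reg n.+1))) + 2).+1)) => //.
      apply: runs_if; rewrite eval_lt // (eval_deg ENV st3 ra3 aN) (eval_deg ENV st3 ry yN)
        -/cnd.
        by case: cnd => // _; apply: runs_set; rewrite /= ra3.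
      by case: cnd => // _; apply: runs_set; rewrite /= ry.
  apply: runs_seq; apply: runs_weaken Hset _ (leqnn _) => s4 s4E.
  have st4 : static s4 by rewrite s4E; exact: static_set_reg.
  have r6 : reg s4 6 = u by rewrite s4E reg_set_same.
  have HA := @acc_spec w B D N nr G tbl ENV K hK n.+2 6 (tri_term nr n M) u s4
    (fun c => wt y * (wt c * (mon tbl M (rho3 (nth 0 zs) a y c))%:R))%R uN isT isT isT.
  rewrite -us; apply: runs_weaken (HA _ st4 r6) _ (leqnn _) => {HA}.
  + move=> c s5 cG st5 fr5 m5 rc.
    have cL := graph_sub GR cG; have cN := L_le GR cL.
    have rz5 j : j < n.+2 -> reg s5 (var_reg j) = reg s3 (var_reg j).
      move=> jn; rewrite fr5 ?zz ?zc ?z5 ?(ltn_eqF jn) //.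
      by rewrite s4E reg_set_other ?z6.
    have rA5 : reg s5 (var_reg n) = a by rewrite rz5 // I2 ?sza // nth_rcons sz ltnn eqxx.
    have rB5 : reg s5 (var_reg n.+1) = y by rewrite rz5.
    rewrite /tri_term !eval_mul // (eval_wt ENV hK st5 rB5) (eval_wt ENV hK st5 rc).
    congr (_ * (_ * _))%R; apply: (eval_mon ENV hK st5 wfM) => at_ v aM va.
    rewrite /rho3 /update; case: eqP => [->|/eqP vA] //; case: eqP => [->|/eqP vB] //.
    case: eqP => [->|/eqP vC] //.
    have vn : v < n.
      by have := vM _ _ aM va; clear - vA vB vC; lia.
    rewrite rz5; last by clear -vn; lia.
    rewrite I2; last by rewrite sza ltnW.
    rewrite nth_rcons sz vn.
    by split=> //; apply: (L_le GR); apply: zL; rewrite mem_nth ?sz.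
  + move=> s5 [st5 m5 fr5 acc5]; split=> //; split.
    * by rewrite m5 s4E.
    * move=> j jn; have jn1 : j < n.+1 by rewrite -sza.
      have jn2 : j < n.+2 by exact: ltnW.
      rewrite fr5 ?zz ?zc ?z5 ?(ltn_eqF jn2) //.
      by rewrite s4E reg_set_other ?z6 // I2.
    * rewrite acc5 s4E reg_set_other // I3; congr (_ + _)%R; apply: (sum_G GR).
        by case: uab => ->.
      move=> c cL cG; case E: (mon _ _ _); last by rewrite !mulr0.
      case: uab => uE; rewrite uE in cG.
        have := mon_joined GR jAC E; rewrite /rho3 /update eqxx.
        by rewrite n20 n21 eqxx (negbTE cG).
      have := mon_joined GR jBC E; rewrite /rho3 /update eqxx.
      by rewrite n20 n21 n10 !eqxx (negbTE cG).
- split=> //; by rewrite /s2 reg_set_same /= mod0n.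
- move=> s3 [st3 [m3 rz3 acc3]].
  have cI3 : counts_are F1 s3 by move=> xs szx xN; rewrite /cell m3; exact: cI1.
  have fE : ((eval w s3 (EReg 5))%:R = fmon M zs a)%R.
    rewrite [eval _ _ _]/= acc3.
    have -> x : (foldl (fun x v => x + g v) x (G a) = x + \sum_(v <- G a) g v)%R.
      elim: (G a) x => [|v l IH] x /=; first by rewrite big_nil addr0.
      by rewrite IH big_cons addrA.
    rewrite add0r; apply: (sum_G GR) => // y yL yG; apply: big1 => c _.
    case E: (mon _ _ _); last by rewrite !mulr0.
    have := mon_joined GR jAB E; rewrite /rho3 /update eqxx.
    by rewrite n10 eqxx (negbTE yG).
  apply: runs_weaken (addcnt_spec b sza zaN rz3 fE st3 cI3) _ (leqnn _).
  move=> s' [st' r' fm' cI']; split=> // r ds rR gd rc.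
  by rewrite fm' // /cell m3.
Qed.

(** X, Y, Z are the last three variables in some order. Without the atoms containing Z, the only
    registers read besides X and Y belong to the enumerated prefix. *)
Lemma mv_step X Y Z M src dst (f : nat -> K) s zs F :
  n <= X -> n <= Y -> X != Y ->
  (forall v, v < n.+3 -> v != X -> v != Y -> v != Z -> v < n) ->
  dst = Rvec1 nr \/ dst = Rvec2 nr ->
  size zs = n -> {subset zs <= L} -> wf M ->
  (forall a v, a \in M -> v \in a.2 -> v < n.+3) ->
  (if src is Some r then
     [/\ r <= Rcnt nr, r != dst & forall y, y \in L -> ((arr s r [:: y])%:R = f y)%R]
   else forall y, f y = 1%R) ->
  static s -> regs_are s zs -> counts_are F s ->
  runs w (matvec nr X Y (avoid Z M) src dst) s (fun s' =>
    [/\ vec_set B D N nr G tbl s s' dst (fun x => \sum_(y <- L) wt y *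
          ((mon tbl (avoid Z M) (update (update (nth 0 zs) Y y) X x))%:R * f y))%R L,
        regs_are s' zs & counts_are F s'])
    (mv_cost nr X Y (avoid Z M) src dst * degsum N G).
Proof.
move=> nX nY XY Hv hdst sz zL wfM vM Hsrc st rz cI.
have hdst2 : Rvec1 nr <= dst <= Rcnt nr.
  by case: hdst => ->; rewrite /Rvec1 /Rvec2 /Rcnt; apply/andP; split; lia.
have dC : dst != Rcnt nr by case: hdst => ->; rewrite /Rvec1 /Rvec2 /Rcnt; lia.
have Hr : forall a v, a \in avoid Z M -> v \in a.2 -> v != X -> v != Y ->
    reg s (var_reg v) = nth 0 zs v /\ nth 0 zs v <= N.
  move=> a v /avoidP[aM Za] va vX vY.
  have vn : v < n.
    by apply: Hv vX vY _; [exact: vM aM va|apply: contraNneq Za => <-].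
  rewrite rz ?sz //; split=> //; apply: (L_le GR); apply: zL; by rewrite mem_nth ?sz.
have H := matvec_spec ENV GR hK XY (wf_avoid Z wfM) hdst2 Hr Hsrc st.
apply: runs_weaken (runs_frame H) _ (leqnn _) => s' [vs fr]; split=> //.
  move=> j jn; rewrite fr ?rz //; apply/negP => im.
  by have := allP (low_mods_matvec nr (avoid Z M) src dst nX nY) _ im; rewrite sz in jn;
    rewrite /= /var_reg; lia.
case: vs => _ fm _ xs szx xN; rewrite fm ?cI // ?(eq_sym _ dst) //.
by apply: (good_le ENV) => //; rewrite szx.
Qed.

Lemma eval_evec s r a : static s -> reg s (var_reg n) = a -> a \in L -> r <= Rcnt nr ->
  eval w s (evec n r) = arr s r [:: a].
Proof.
move=> st ra aL rR.
have E : [seq eval w s e | e <- [:: EReg (var_reg n)]] = [:: a] by rewrite /= ra.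
have ga := good1 ENV (L_le GR aL).
rewrite /evec (eval_earr hB) ?E //; first by case: st.
exact: (region_lt ENV).
Qed.

(** Each atom avoids n or Q. The factor avoiding Q does not depend on q and can be taken out of the
    inner sum. *)
Lemma path_sum P Q M zs a (f : nat -> K) :
  P != n -> Q != n -> P != Q -> ~~ joined n Q M ->
  (forall y, y \in L -> f y = \sum_(q <- L) wt q *
     ((mon tbl (avoid n M) (update (update (nth 0 zs) Q q) P y))%:R * 1))%R ->
  (\sum_(p <- L) wt p *
     ((mon tbl (avoid Q M) (update (update (nth 0 zs) P p) n a))%:R * f p) =
   \sum_(p <- L) \sum_(q <- L) wt p * (wt q *
     (mon tbl M (update (update (update (nth 0 zs) Q q) P p) n a))%:R))%R.
Proof.
move=> Pn Qn PQ nj Hf; apply: eq_big_seq => p pL; rewrite Hf // !mulr_sumr.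
apply: eq_bigr => q _; rewrite (mon_split _ _ nj) -mulnb natrM.
have -> : mon tbl (avoid n M) (update (update (update (nth 0 zs) Q q) P p) n a) =
  mon tbl (avoid n M) (update (update (nth 0 zs) Q q) P p).
  apply: eq_mon => at_ v /avoidP[aM na] va.
  by rewrite [update _ n _ _]update_other //; apply: contraNneq na => <-.
have -> : mon tbl (avoid Q M) (update (update (update (nth 0 zs) Q q) P p) n a) =
  mon tbl (avoid Q M) (update (update (nth 0 zs) P p) n a).
  apply: eq_mon => at_ v /avoidP[aM na] va; rewrite /update.
  do 2![case: eqP => // _]; case: eqP => // vQ; by rewrite -vQ va in na.
ring.
Qed.

(** For fixed a the conjunction is a product of a factor without c and one without b, so the double
    sum factors. *)
Lemma star_sum M zs a :
  ~~ joined n.+1 n.+2 M ->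
  ((\sum_(b <- L) wt b *
     ((mon tbl (avoid n.+2 M) (update (update (nth 0 zs) n.+1 b) n a))%:R * 1)) *
   (\sum_(c <- L) wt c *
     ((mon tbl (avoid n.+1 M) (update (update (nth 0 zs) n.+2 c) n a))%:R * 1)) =
   fmon M zs a)%R.
Proof.
move=> nj; rewrite mulr_suml; apply: eq_bigr => b _; rewrite mulr_sumr.
apply: eq_bigr => c _; rewrite (mon_split _ _ nj) -mulnb natrM.
have -> : mon tbl (avoid n.+1 M) (rho3 (nth 0 zs) a b c) =
  mon tbl (avoid n.+1 M) (update (update (nth 0 zs) n.+2 c) n a).
  apply: eq_mon => at_ v /avoidP[aM na] va; rewrite /rho3 /update.
  case: eqP => // _; case: eqP => // vQ; by rewrite -vQ va in na.
have -> : mon tbl (avoid n.+2 M) (rho3 (nth 0 zs) a b c) =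
  mon tbl (avoid n.+2 M) (update (update (nth 0 zs) n.+1 b) n a).
  apply: eq_mon => at_ v /avoidP[aM na] va; rewrite /rho3 /update.
  do 2![case: eqP => // _]; case: eqP => // vQ; by rewrite -vQ va in na.
ring.
Qed.

Lemma mon_spec b M zs F s :
  size zs = n -> {subset zs <= L} -> wf M ->
  (forall a v, a \in M -> v \in a.2 -> v < n.+3) ->
  static s -> regs_are s zs -> counts_are F s ->
  runs w (mon_prog nr k n b M) s (fun s' => static s' /\
     counts_are (fun xs => F xs + \sum_(a <- L) add_term b zs (fmon M zs) xs a)%R s')
     (mon_cost nr k n b M * trisum).
Proof.
have n20 : (n.+2 == n) = false by lia.
have n21 : (n.+2 == n.+1) = false by lia.
have n10 : (n.+1 == n) = false by lia.
have n01 : (n == n.+1) = false by lia.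
have n02 : (n == n.+2) = false by lia.
have n12 : (n.+1 == n.+2) = false by lia.
have ln1 := leqnSn n; have ln2 := leq_trans ln1 (leqnSn n.+1).
have V1R : Rvec1 nr <= Rcnt nr by rewrite /Rvec1 /Rcnt; lia.
have V2R : Rvec2 nr <= Rcnt nr by rewrite /Rvec2 /Rcnt; lia.
have V12 : Rvec1 nr != Rvec2 nr by rewrite /Rvec1 /Rvec2; lia.
have V1C : Rvec1 nr != Rcnt nr by rewrite /Rvec1 /Rcnt; lia.
have V2C : Rvec2 nr != Rcnt nr by rewrite /Rvec2 /Rcnt; lia.
move=> sz zL wfM vM st rz cI.
have tm T1 T2 T3 : T1 + (T2 + (T3 + 2 * loop_cost)) <= mon_cost nr k n b M ->
    T1 * degsum N G + (T2 * degsum N G + (T3 + 2 * loop_cost) * degsum N G) <=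
    mon_cost nr k n b M * trisum.
  by move=> le; rewrite -!mulnDl; apply: leq_mul le leq_degsum_trisum.
have one (y : nat) : (fun=> 1 : K)%R y = 1%R by [].
have H1 v : v < n.+3 -> v != n.+1 -> v != n.+2 -> v != n -> v < n by clear; lia.
have H1' v : v < n.+3 -> v != n -> v != n.+1 -> v != n.+2 -> v < n by clear; lia.
have H2 v : v < n.+3 -> v != n.+2 -> v != n.+1 -> v != n -> v < n by clear; lia.
have H2' v : v < n.+3 -> v != n -> v != n.+2 -> v != n.+1 -> v < n by clear; lia.
rewrite /mon_prog; case: ifP => [nBC|/negbFE jBC]; [|case: ifP => [nAC|/negbFE jAC];
  [|case: ifP => [nAB|/negbFE jAB]; last exact: tri_spec]].
- apply: runs_weaken (tm (mv_cost nr n n.+1 (avoid n.+2 M) None (Rvec1 nr)) (mv_cost nr n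
    n.+2 (avoid n.+1 M) None (Rvec2 nr)) (addcnt_cost nr k n b (EOp OMul (evec n (Rvec1
    nr)) (evec n (Rvec2 nr)))) _) => [|s' H|]; first last.
  + by rewrite /mon_cost; clear; lia.
  + exact: H.
  apply: runs_seq.
  apply: runs_weaken (@mv_step n n.+1 n.+2 M None (Rvec1 nr) (fun=> 1%R) s zs F (leqnn n)
    ln1 (negbT n01) H1'
    (or_introl erefl) sz zL wfM vM one st rz cI) _ (leqnn _) => //.
  move=> s1 [[st1 fm1 v1] rz1 cI1]; apply: runs_seq.
  apply: runs_weaken (@mv_step n n.+2 n.+1 M None (Rvec2 nr) (fun=> 1%R) s1 zs F (leqnn n)
    ln2 (negbT n02) H2'
    (or_intror erefl) sz zL wfM vM one st1 rz1 cI1) _ (leqnn _).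
  move=> s2 [[st2 fm2 v2] rz2 cI2].
  have ev a s3 : a \in L -> static s3 -> reg s3 (var_reg n) = a ->
      (forall r ds, r <= Rcnt nr -> good ds -> r != Rcnt nr -> arr s3 r ds = arr s2 r ds) ->
      ((eval w s3 (EOp OMul (evec n (Rvec1 nr)) (evec n (Rvec2 nr))))%:R = fmon M zs a)%R.
    move=> aL st3 ra fm3; have ga := good1 ENV (L_le GR aL).
    rewrite eval_mul // !(eval_evec st3 ra aL) // !fm3 // fm2 // v1 // v2 //.
    exact: star_sum.
  exact: addall_spec sz zL ev st2 rz2 cI2.
- apply: runs_weaken (tm (mv_cost nr n.+1 n.+2 (avoid n M) None (Rvec1 nr)) (mv_cost nr n
    n.+1 (avoid n.+2 M) (Some (Rvec1 nr)) (Rvec2 nr)) (addcnt_cost nr k n b (evec n (Rvec2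
    nr))) _) => [|s' H|]; first last.
  + by rewrite /mon_cost; clear; lia.
  + exact: H.
  apply: runs_seq.
  apply: runs_weaken (@mv_step n.+1 n.+2 n M None (Rvec1 nr) (fun=> 1%R) s zs F ln1 ln2
    (negbT n12) H1
    (or_introl erefl) sz zL wfM vM one st rz cI) _ (leqnn _) => //.
  move=> s1 [[st1 fm1 v1] rz1 cI1]; apply: runs_seq.
  apply: runs_weaken (@mv_step n n.+1 n.+2 M (Some (Rvec1 nr)) (Rvec2 nr) _ s1 zs F (leqnn
    n) ln1 (negbT n01) H1'
    (or_intror erefl) sz zL wfM vM (And3 V1R V12 v1) st1 rz1 cI1) _ (leqnn _).
  move=> s2 [[st2 fm2 v2] rz2 cI2].
  have ev a s3 : a \in L -> static s3 -> reg s3 (var_reg n) = a ->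
      (forall r ds, r <= Rcnt nr -> good ds -> r != Rcnt nr -> arr s3 r ds = arr s2 r ds) ->
      ((eval w s3 (evec n (Rvec2 nr)))%:R = fmon M zs a)%R.
    move=> aL st3 ra fm3; have ga := good1 ENV (L_le GR aL).
    rewrite (eval_evec st3 ra aL) // fm3 // v2 //.
    rewrite (path_sum a (negbT n10) (negbT n20) (negbT n12) nAC (fun y yL => erefl)).
    by [].
  exact: addall_spec sz zL ev st2 rz2 cI2.
- apply: runs_weaken (tm (mv_cost nr n.+2 n.+1 (avoid n M) None (Rvec1 nr)) (mv_cost nr n
    n.+2 (avoid n.+1 M) (Some (Rvec1 nr)) (Rvec2 nr)) (addcnt_cost nr k n b (evec n (Rvec2
    nr))) _) => [|s' H|]; first last.
  + by rewrite /mon_cost; clear; lia.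
  + exact: H.
  apply: runs_seq.
  apply: runs_weaken (@mv_step n.+2 n.+1 n M None (Rvec1 nr) (fun=> 1%R) s zs F ln2 ln1
    (negbT n21) H2
    (or_introl erefl) sz zL wfM vM one st rz cI) _ (leqnn _) => //.
  move=> s1 [[st1 fm1 v1] rz1 cI1]; apply: runs_seq.
  apply: runs_weaken (@mv_step n n.+2 n.+1 M (Some (Rvec1 nr)) (Rvec2 nr) _ s1 zs F (leqnn
    n) ln2 (negbT n02) H2'
    (or_intror erefl) sz zL wfM vM (And3 V1R V12 v1) st1 rz1 cI1) _ (leqnn _).
  move=> s2 [[st2 fm2 v2] rz2 cI2].
  have ev a s3 : a \in L -> static s3 -> reg s3 (var_reg n) = a ->
      (forall r ds, r <= Rcnt nr -> good ds -> r != Rcnt nr -> arr s3 r ds = arr s2 r ds) ->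
      ((eval w s3 (evec n (Rvec2 nr)))%:R = fmon M zs a)%R.
    move=> aL st3 ra fm3; have ga := good1 ENV (L_le GR aL).
    rewrite (eval_evec st3 ra aL) // fm3 // v2 //.
    rewrite (path_sum a (negbT n20) (negbT n10) (negbT n21) nAB (fun y yL => erefl)).
    (* The path is a, c, b here, so the sums come in the other order and the updates of b and c have
       to be commuted. *)
    rewrite exchange_big; apply: eq_bigr => p _; apply: eq_bigr => q _; rewrite mulrCA;
      congr (_ * (_ * (nat_of_bool _)%:R))%R; apply: eq_mon => at_ v _ _; rewrite /rho3
      /update; case: (v == n) => //; case: (eqVneq v n.+1) => [->|//]; by rewrite n12.
  exact: addall_spec sz zL ev st2 rz2 cI2.
Qed.

End Env.

(** * Reading the input *)

Definition ins (g : nat -> seq nat) (p : nat * nat) : nat -> seq nat :=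
  if p.2 \in g p.1 then g
  else fun x => if x == p.1 then rcons (g x) p.2 else g x.

(** Adding N to each record makes N adjacent to all its objects, so that its neighbours become the
    list of all nodes. Loops are included because two arguments of an atom may take the same
    value. *)
Definition pairs (N : nat) (rec : seq nat) := [seq (x, y) | x <- N :: rec, y <- N :: rec].

Definition add_rec N (acc : seq (nat * seq nat) * (nat -> seq nat)) (q : nat * seq nat) :=
  (q :: acc.1, foldl ins acc.2 (pairs N q.2)).

Lemma mem_ins g p u v : (v \in ins g p u) = (v \in g u) || (p == (u, v)).
Proof.
case: p => x y; rewrite /ins xpair_eqE /=; case yx: (y \in g x).
  by case: (eqVneq x u) => [<-|_]; case: (eqVneq y v) => [<-|_]; rewrite ?yx ?orbF.
rewrite (eq_sym x u); case: (eqVneq u x) => [->|_]; last by rewrite orbF.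
by rewrite mem_rcons inE orbC eq_sym.
Qed.

Lemma mem_foldl_ins l g u v : (v \in foldl ins g l u) = (v \in g u) || ((u, v) \in l).
Proof.
elim: l g => [|p l IH] g /=; first by rewrite orbF.
by rewrite IH mem_ins inE -orbA eq_sym.
Qed.

Lemma uniq_ins g p : (forall u, uniq (g u)) -> forall u, uniq (ins g p u).
Proof.
move=> ug u; rewrite /ins; case: ifP => // /negbT n; case: eqP => [->|_] //.
by rewrite rcons_uniq n ug.
Qed.

Lemma uniq_foldl_ins l g : (forall u, uniq (g u)) -> forall u, uniq (foldl ins g l u).
Proof. by elim: l g => //= p l IH g ug; apply: IH; apply: uniq_ins. Qed.

(** An insertion lengthens at most one list, by one entry; [uniq us] keeps that list from being
    counted twice. *)
Lemma size_foldl_ins (us : seq nat) l g : uniq us ->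
  \sum_(u <- us) size (foldl ins g l u) <= \sum_(u <- us) size (g u) + size l.
Proof.
move=> uus; elim: l g => [|p l IH] g /=; first by rewrite addn0.
apply: leq_trans (IH _) _; rewrite addnS -addSn leq_add2r.
rewrite /ins; case: ifP => _; first exact: leqnSn.
apply: (@leq_trans (\sum_(u <- us) (size (g u) + (u == p.1)))).
  by apply: leq_sum => u _; case: eqP => _; rewrite ?size_rcons ?addn1 ?addn0.
rewrite big_split /= -addn1 leq_add2l -big_mkcond /=.
rewrite sum1_count; have := count_uniq_mem p.1 uus => /= ->.
exact: leq_b1.
Qed.

Section Programs.
Variable nr : nat.

(** The adjacency matrix decides in constant time whether the entry is new. It is never cleared,
    because the memory beyond the input starts at 0. *)
Definition insert eu ev :=
  CSeq (CSet 4 eu) (CSeq (CSet 5 ev)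
    (CIf (earr (Rbit nr) [:: EReg 4; EReg 5]) CSkip
      (CSeq (CStore (eaddr (Rbit nr) [:: EReg 4; EReg 5]) (ECst 1))
        (CSeq (CStore (eaddr (Radj nr) [:: EReg 4; edeg nr 4]) (EReg 5))
          (CStore (eaddr (Rdeg nr) [:: EReg 4]) (EOp OAdd (edeg nr 4) (ECst 1))))))).

Definition entry i := EMem (EOp OAdd (EReg 3) (ECst i)).
(** The positions are those of [N :: rec]: index 0 is the node N, index j + 1 the j-th entry of the
    current record. *)
Definition node i := if i is j.+1 then entry j else EReg 2.

Definition inserts (l : seq (nat * nat)) :=
  foldr (fun p c => CSeq (insert (node p.1) (node p.2)) c) CSkip l.

Definition index_pairs ar := [seq (i, j) | i <- iota 0 ar.+1, j <- iota 0 ar.+1].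

Definition record_prog r ar :=
  CSeq (CStore (eaddr r [seq entry i | i <- iota 0 ar]) (ECst 1))
    (CSeq (inserts (index_pairs ar)) (CSet 3 (EOp OAdd (EReg 3) (ECst ar)))).

Definition block_prog r ar :=
  CSeq (CSet 7 (EMem (EReg 3)))
    (CSeq (CSet 3 (EOp OAdd (EReg 3) (ECst 1)))
      (CSeq (CSet 8 (ECst 0))
        (CWhile (EOp OLt (EReg 8) (EReg 7))
          (CSeq (record_prog r ar) (CSet 8 (EOp OAdd (EReg 8) (ECst 1))))))).

Definition blocks (ars : seq (nat * nat)) :=
  foldr (fun p c => CSeq (block_prog p.1 p.2) c) CSkip ars.

(** The length of a block follows from its first entry and the arity, so whole blocks are skipped at
    constant cost per relation. *)
Definition sizes (ars : seq (nat * nat)) :=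
  foldr (fun p c => CSeq (CSet 3 (EOp OAdd (EReg 3) (EOp OAdd (ECst 1)
           (EOp OMul (EMem (EReg 3)) (ECst p.2))))) c) CSkip ars.

(* First the length of the input is computed, from which a base for the
   addresses is obtained. *)
Definition parse_prog (ars : seq (nat * nat)) :=
  CSeq (CSet 3 (ECst 1)) (CSeq (sizes ars)
    (CSeq (CSet 1 (EOp OAdd (EOp OAdd (EReg 3) (EMem (ECst 0))) (ECst (nr + 10 + sumn [seq
      p.2 | p <- ars]))))
      (CSeq (CSet 2 (EMem (ECst 0))) (CSeq (CSet 3 (ECst 1))
        (CSeq (insert (EReg 2) (EReg 2)) (blocks ars)))))).

(** An insertion costs 90 besides the two node expressions of cost at most 4, hence 100 per pair. *)
Definition record_cost r ar :=
  cost (eaddr r [seq entry i | i <- iota 0 ar]) + 2 + (100 * size (index_pairs ar) + 1 + 4).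

Definition blocks_cost (ars : seq (nat * nat)) :=
  \sum_(p <- ars) (record_cost p.1 p.2 + 30).

Definition parse_cost ars := 200 + 20 * size ars + blocks_cost ars.

End Programs.

Definition block_enc (recs : nat -> seq (seq nat)) (ars : seq (nat * nat)) :=
  flatten [seq size (recs p.1) :: flatten (recs p.1) | p <- ars].

Definition all_recs (recs : nat -> seq (seq nat)) (ars : seq (nat * nat)) :=
  [seq (p.1, rec) | p <- ars, rec <- recs p.1].

Arguments insert : simpl never.

Section Env.
Variables (w B D N nr : nat) (enc : seq nat).
Hypothesis hB : B ^ (D + 2) <= 2 ^ w.
Hypothesis hw : 0 < w.
Hypothesis nrB : nr.+4.+3 < B.
Hypothesis NB : N.+1 < B.
Hypothesis D2 : 2 <= D.
Hypothesis encB : size enc < B.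

Notation good := (digits_ok B D).
Notation arr := (cell B).

(** Ghost values: [T] lists the records read so far, [g] is their graph. That the counters are still
    0 is part of the invariant, so counting needs no initialisation. *)
Definition parsed (T : seq (nat * seq nat)) (g : nat -> seq nat) (s : state) : Prop :=
  [/\ reg s 1 = B /\ reg s 2 = N,
      (forall a, a < size enc -> Defs.mem s a = nth 0 enc a),
      (forall r ds, r < nr -> good ds -> arr s r ds = ((r, ds) \in T) :> nat),
      [/\ (forall u, u <= N -> arr s (Rdeg nr) [:: u] = size (g u)),
       (forall u i, u <= N -> i < size (g u) -> arr s (Radj nr) [:: u; i] = nth 0 (g u) i) &
       (forall u v, u <= N -> v <= N -> arr s (Rbit nr) [:: u; v] = (v \in g u) :> nat)] &
      (forall ds, good ds -> arr s (Rcnt nr) ds = 0)].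

Definition graph_ok (g : nat -> seq nat) :=
  (forall u, uniq (g u)) /\ (forall u v, v \in g u -> v <= N).

Lemma graph_ok_ins g u v : v <= N -> graph_ok g -> graph_ok (ins g (u, v)).
Proof.
move=> vN [ug gN]; split; first exact: uniq_ins.
by move=> x y; rewrite mem_ins => /orP[/gN //|/eqP[_ <-]].
Qed.

Lemma graph_ok_size g u : graph_ok g -> size (g u) <= N.+1.
Proof.
case=> ug gN; rewrite -(size_iota 0 N.+1); apply: uniq_leq_size => // v /gN.
by rewrite mem_iota add0n ltnS.
Qed.

Lemma input_set_mem s a r ds v : a < size enc -> Defs.mem (set_mem s (addr B r ds) v) a =
  Defs.mem s a.
Proof.
move=> aP; rewrite /set_mem /= update_other //.
have := @leq_addr_base B r ds ltac:(lia); move: encB aP; nia.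
Qed.

Lemma B_lt_word : B <= 2 ^ w.
Proof. by apply: leq_trans hB; rewrite -{1}(expn1 B) leq_pexp2l //; lia. Qed.

Lemma good2 u v : u <= N -> v < B -> good [:: u; v].
Proof. by move=> uN vB; rewrite /digits_ok /= vB D2 (leq_ltn_trans uN) // ltnW. Qed.

Lemma good1' u : u <= N -> good [:: u].
Proof. by move=> uN; rewrite /digits_ok /= (leq_ltn_trans uN) 1?ltnW //; lia. Qed.

Lemma insert_spec T g s eu ev u v :
  u <= N -> v <= N -> graph_ok g -> parsed T g s ->
  eval w s eu = u -> eval w (set_reg s 4 u) ev = v ->
  runs w (insert nr eu ev) s (fun s' =>
    parsed T (ins g (u, v)) s' /\ (forall i, i != 4 -> i != 5 -> reg s' i = reg s i))
    (cost eu + cost ev + 90).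
Proof.
move=> uN vN gok [[S1 S2] Sin ST [Sd Sa Sb] Sc] Hu Hv.
have rD : (Rdeg nr).+1 < B by rewrite /Rdeg; lia.
have rA : (Radj nr).+1 < B by rewrite /Radj; lia.
have rB : (Rbit nr).+1 < B by rewrite /Rbit; lia.
have rC : (Rcnt nr).+1 < B by rewrite /Rcnt; lia.
have Ead : (Radj nr == Rdeg nr) = false by rewrite /Rdeg /Radj; lia.
have Ebd : (Rbit nr == Rdeg nr) = false by rewrite /Rdeg /Rbit; lia.
have Eba : (Rbit nr == Radj nr) = false by rewrite /Radj /Rbit; lia.
have Eda : (Rdeg nr == Radj nr) = false by rewrite /Radj /Rdeg; lia.
have Edb : (Rdeg nr == Rbit nr) = false by rewrite /Rbit /Rdeg; lia.
have Eab : (Radj nr == Rbit nr) = false by rewrite /Rbit /Radj; lia.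
have vB : v < B by apply: leq_ltn_trans vN (ltnW NB).
have -> : cost eu + cost ev + 90 = (cost eu).+1 + ((cost ev).+1 + 88) by lia.
apply: runs_seq; apply: runs_set.
rewrite Hu; apply: runs_seq; apply: runs_set; rewrite Hv.
set s2 := set_reg _ _ _.
have r4 : reg s2 4 = u by rewrite /s2 reg_set_other // reg_set_same.
have r5 : reg s2 5 = v by rewrite /s2 reg_set_same.
have r1 : reg s2 1 = B by rewrite /s2 !reg_set_other.
have r2 : reg s2 2 = N by rewrite /s2 !reg_set_other.
have m2 : Defs.mem s2 = Defs.mem s by [].
have fr i : i != 4 -> i != 5 -> reg s2 i = reg s i.
  by move=> i4 i5; rewrite /s2 !reg_set_other.
clearbody s2.
have am2 r ds : arr s2 r ds = arr s r ds by rewrite /cell m2.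
have E45 : [seq eval w s2 e | e <- [:: EReg 4; EReg 5]] = [:: u; v] by rewrite /= r4 r5.
apply: (runs_weaken (Q := fun s' => parsed T (ins g (u, v)) s' /\
  (forall i, i != 4 -> i != 5 -> reg s' i = reg s i)) (T := (cost (earr (Rbit nr) [:: EReg
    4; EReg 5]) + (14 + (30 + 30))).+1)) => //.
apply: runs_if.
- rewrite (eval_earr hB) // E45 ?good2 // am2 Sb // => h.
  have vg : v \in g u by move: h; case: (v \in g u).
  apply: runs_weaken (runs_skip w (s := s2) (Q := fun s' => s' = s2) erefl) _ _ => // s' ->.
  split=> //; rewrite /ins vg; split=> //; rewrite ?fr ?m2 //.
  + by move=> *; rewrite am2 ST.
  + by split=> *; rewrite am2 ?Sd ?Sa ?Sb.
  + by move=> *; rewrite am2 Sc.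
rewrite (eval_earr hB) // E45 ?good2 // am2 Sb // => h.
have vg : v \notin g u by move: h; case: (v \in g u).
(* v is missing among the N + 1 possible neighbours, so the new degree is at most N + 1 and still a
   digit. *)
have szu : size (g u) <= N.
  have [ug gN] := gok.
  rewrite -ltnS -(size_iota 0 N.+1); apply: (@uniq_leq_size _ (v :: g u)); first by rewrite
    /= vg ug.
  by move=> x; rewrite inE mem_iota add0n ltnS => /orP[/eqP->//|/gN].
have szB : size (g u) < B by lia.
apply: runs_seq.
apply: (runs_weaken (Q := fun s3 => s3 = set_mem s2 (addr B (Rbit nr) [:: u; v]) 1) (T :=
  13)) => //.
  apply: (runs_store_arr hB) => //; rewrite E45 ?good2 // /= modn_small //.
  exact: word_gt1.
move=> s3 s3E; apply: runs_seq.
have degE s' : reg s' 4 = u -> reg s' 1 = B -> arr s' (Rdeg nr) [:: u] = size (g u) ->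
    eval w s' (edeg nr 4) = size (g u).
  move=> r4' r1' H.
  have E4 : [seq eval w s' e | e <- [:: EReg 4]] = [:: u] by rewrite /= r4'.
  by rewrite /edeg (eval_earr hB) ?E4 // good1'.
have deg3 : arr s3 (Rdeg nr) [:: u] = size (g u).
  by rewrite s3E (cell_set_mem (D := D)) ?good1' ?good2 // Edb am2 Sd.
have d3 : eval w s3 (edeg nr 4) = size (g u) by apply: degE => //; rewrite s3E.
have E43 : [seq eval w s3 e | e <- [:: EReg 4; edeg nr 4]] = [:: u; size (g u)].
  by rewrite -[LHS]/[:: reg s3 4; eval w s3 (edeg nr 4)] d3 s3E [reg _ _]r4.
apply: (runs_weaken (Q := fun s4 => s4 = set_mem s3 (addr B (Radj nr) [:: u; size (g u)])
  v) (T := 30)) => //.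
  have H := @runs_store_arr w B D hB (Radj nr) [:: EReg 4; edeg nr 4] (EReg 5) s3.
  apply: runs_weaken (H (fun s4 => s4 = set_mem s3 (addr B (Radj nr) [:: u; size (g u)]) v)
    _ _ _ _) _ _ => //.
  + by rewrite s3E.
  + by rewrite E43 good2.
  + by rewrite E43 s3E /=  r5.
move=> s4 s4E.
have d4 : eval w s4 (edeg nr 4) = size (g u).
  apply: degE => //; try by rewrite s4E s3E.
  by rewrite s4E (cell_set_mem (D := D)) ?good1' ?good2 // Eda.
have E44 : [seq eval w s4 e | e <- [:: EReg 4]] = [:: u] by rewrite /= s4E s3E /=  r4.
set s5 := set_mem s4 (addr B (Rdeg nr) [:: u]) (size (g u)).+1.
apply: (runs_weaken (Q := fun s' => s' = s5) (T := 30)) => //.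
  have H := @runs_store_arr w B D hB (Rdeg nr) [:: EReg 4] (EOp OAdd (edeg nr 4) (ECst 1))
    s4.
  apply: runs_weaken (H (fun s' => s' = s5) _ _ _ _) _ _ => //.
  + by rewrite s4E s3E.
  + by rewrite E44 good1'.
  + rewrite E44 /s5; congr set_mem.
    rewrite -[LHS]/((eval w s4 (edeg nr 4) + 1 %% 2 ^ w) %% 2 ^ w) d4.
    rewrite (@modn_small 1) ?word_gt1 // addn1 modn_small //.
    apply: leq_trans B_lt_word; lia.
move=> s' ->.
have amE r ds : r.+1 < B -> good ds -> arr s5 r ds =
   if (r == Rdeg nr) && (ds == [:: u]) then (size (g u)).+1 else
   if (r == Radj nr) && (ds == [:: u; size (g u)]) then v else
   if (r == Rbit nr) && (ds == [:: u; v]) then 1 else arr s r ds.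
  move=> rb gd; by rewrite /s5 s4E s3E !(cell_set_mem (D := D)) ?good1' ?good2 // am2.
have fr5 i : i != 4 -> i != 5 -> reg s5 i = reg s i.
  by rewrite /s5 s4E s3E; exact: fr.
split=> //; rewrite /ins /= (negbTE vg).
split; first by rewrite !fr5.
- by move=> a aP; rewrite /s5 s4E s3E !input_set_mem // m2 Sin.
- move=> r ds rn gd; rewrite amE //; last by lia.
  rewrite /Rdeg /Radj /Rbit.
  have -> : (r == nr) = false by lia.
  have -> : (r == nr.+1) = false by lia.
  have -> : (r == nr.+2) = false by lia.
  exact: ST.
- split.
  + move=> x xN; rewrite amE ?good1' // eqxx Eda Edb !andFb eqseq_cons eqxx !andbT.
    by case: eqP => [->|_]; rewrite ?size_rcons // Sd.
  + move=> x i xN ix.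
    have iB : i < B.
      by move: ix; case: eqP => _; rewrite ?size_rcons; have := graph_ok_size x gok; have
        := graph_ok_size u gok; lia.
    rewrite amE ?good2 // eqxx Ead Eab !andFb !eqseq_cons eqxx !andbT !andTb.
    move: ix; case: (eqVneq x u) => [->|_] /=; last by move=> ix; rewrite Sa.
    rewrite size_rcons nth_rcons ltnS leq_eqVlt; case: eqP => [->|ne] /=; first by rewrite
      ltnn.
    by move=> lt; rewrite lt Sa.
  + move=> x y xN yN; rewrite amE; [|by []|by apply: good2 => //; lia].
    rewrite eqxx Ebd Eba !andFb !eqseq_cons eqxx !andbT !andTb.
    case: (eqVneq x u) => [->|_] /=; last by rewrite Sb.
    by rewrite mem_rcons inE; case: (eqVneq y v) => [->|_] //=; rewrite Sb.
- move=> ds gd; rewrite amE //.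
  have -> : (Rcnt nr == Rdeg nr) = false by rewrite /Rdeg /Rcnt; lia.
  have -> : (Rcnt nr == Radj nr) = false by rewrite /Radj /Rcnt; lia.
  have -> : (Rcnt nr == Rbit nr) = false by rewrite /Rbit /Rcnt; lia.
  exact: Sc.
Qed.

Lemma parsed_set_reg T g s i x : i != 1 -> i != 2 -> parsed T g s -> parsed T g (set_reg s
  i x).
Proof.
by move=> i1 i2 [[S1 S2] *]; split=> //; rewrite !reg_set_other // eq_sym.
Qed.

Lemma eval_node T g s p rec i :
  parsed T g s -> reg s 3 = p -> p + size rec <= size enc ->
  (forall j, j < size rec -> nth 0 enc (p + j) = nth 0 rec j) ->
  i <= size rec -> eval w s (node i) = nth 0 (N :: rec) i.
Proof.
move=> [[S1 S2] Sin _ _ _] r3 pe He; case: i => [|i] ile //=; rewrite r3.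
have BW := B_lt_word.
rewrite (@modn_small i) ?modn_small; try lia.
by rewrite Sin ?He //; lia.
Qed.

Lemma inserts_spec T g s p rec l :
  graph_ok g -> parsed T g s -> reg s 3 = p -> p + size rec <= size enc ->
  (forall j, j < size rec -> nth 0 enc (p + j) = nth 0 rec j) ->
  all (geq N) rec ->
  all (fun q => (q.1 <= size rec) && (q.2 <= size rec)) l ->
  runs w (inserts nr l) s (fun s' =>
    parsed T (foldl ins g [seq (nth 0 (N :: rec) q.1, nth 0 (N :: rec) q.2) | q <- l]) s' /\
    (forall i, i != 4 -> i != 5 -> reg s' i = reg s i)) (100 * size l + 1).
Proof.
move=> gok ps r3 pe He recN; elim: l g s gok ps r3 => [|[i j] l IH] g s gok ps r3.
  by move=> _; apply: runs_skip; split.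
move=> /= /andP[/andP[/= iz jz] lz].
have ndN q : q <= size rec -> nth 0 (N :: rec) q <= N.
  case: q => //= q qz; exact: (allP recN _ (mem_nth 0 qz)).
have cn q : cost (node q) <= 4 by case: q.
apply: (runs_weaken (T := (cost (node i) + cost (node j) + 90) + (100 * size l + 1))); last
  first.
- by have := cn i; have := cn j; lia.
- by move=> s' H; exact: H.
apply: runs_seq.
have ps4 := parsed_set_reg (nth 0 (N :: rec) i) (isT : 4 != 1) (isT : 4 != 2) ps.
have H := insert_spec (ndN i iz) (ndN j jz) gok ps (eval_node ps r3 pe He iz)
  (eval_node ps4 r3 pe He jz).
apply: runs_weaken H _ (leqnn _) => s1 [ps1 fr1].
have gok1 := graph_ok_ins (nth 0 (N :: rec) i) (ndN j jz) gok.
apply: runs_weaken (IH _ s1 gok1 ps1 _ lz) _ (leqnn _).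
  by rewrite fr1.
move=> s2 [ps2 fr2]; split=> // x x4 x5; by rewrite fr2 ?fr1.
Qed.

Lemma index_pairsE rec :
  [seq (nth 0 (N :: rec) q.1, nth 0 (N :: rec) q.2) | q <- index_pairs (size rec)] = pairs
    N rec.
Proof.
rewrite /index_pairs /pairs map_allpairs.
have E : N :: rec = map (nth 0 (N :: rec)) (iota 0 (size rec).+1).
  by rewrite -[(size rec).+1]/(size (N :: rec)) map_nth_iota0 // take_size.
by rewrite {3 4}E allpairs_mapl allpairs_mapr.
Qed.

Lemma graph_ok_foldl g l : all (fun q => q.2 <= N) l -> graph_ok g -> graph_ok (foldl ins g
  l).
Proof.
elim: l g => //= -[u v] l IH g /andP[vN lN] gok; apply: IH => //; exact: graph_ok_ins.
Qed.

Lemma pairs_le rec : all (geq N) rec -> all (fun q => q.2 <= N) (pairs N rec).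
Proof.
move=> H; apply/allP => _ /allpairsP[[x y] /= [_ + ->]] /=.
by rewrite inE => /orP[/eqP ->|/(allP H)].
Qed.

Lemma record_spec acc s p r ar rec :
  graph_ok acc.2 -> parsed acc.1 acc.2 s -> reg s 3 = p -> p + ar <= size enc ->
  r < nr -> size rec = ar -> ar <= D ->
  (forall j, j < ar -> nth 0 enc (p + j) = nth 0 rec j) ->
  all (geq N) rec ->
  runs w (record_prog nr r ar) s (fun s' =>
    [/\ parsed (add_rec N acc (r, rec)).1 (add_rec N acc (r, rec)).2 s',
        graph_ok (add_rec N acc (r, rec)).2, reg s' 3 = p + ar &
        (forall i, i != 3 -> i != 4 -> i != 5 -> reg s' i = reg s i)])
    (record_cost r ar).
Proof.
case: acc => T g /= gok ps r3 pe rn sz arD He recN.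
have BW := B_lt_word.
have Eent : [seq eval w s e | e <- [seq entry i | i <- iota 0 ar]] = rec.
  apply: (@eq_from_nth _ 0); rewrite !size_map size_iota ?sz // => i ia.
  rewrite (nth_map (ECst 0)) ?size_map ?size_iota // (nth_map 0) ?size_iota // nth_iota //
    add0n.
  by rewrite -[entry i]/(node i.+1) (eval_node (rec := rec) ps r3) ?sz.
have gr : good rec.
  by rewrite /digits_ok sz arD andbT; apply: sub_all recN => x /= xN; lia.
have rB : r.+1 < B by lia.
have S1 : reg s 1 = B by case: ps => [[]].
apply: (runs_weaken (T := (cost (eaddr r [seq entry i | i <- iota 0 ar]) + 1).+1 +
   ((100 * size (index_pairs ar) + 1) + 4))); first last.
- by rewrite /record_cost; lia.
- by move=> s' H; exact: H.
apply: runs_seq; apply: (runs_store_arr hB) => //; rewrite Eent // /= modn_small ?word_gt1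
  //.
set s1 := set_mem _ _ _.
have ps1 : parsed ((r, rec) :: T) g s1.
  have [[S1' S2] Sin ST [Sd Sa Sb] Sc] := ps.
  have other r' ds : nr <= r' -> r' <= Rcnt nr -> good ds -> arr s1 r' ds = arr s r' ds.
    move=> r1 r2 gd; rewrite (cell_set_mem (D := D)) //; last by move: r2; rewrite /Rcnt;
      lia.
    by have -> : (r' == r) = false by lia.
  split=> //.
  - by move=> a ap; rewrite input_set_mem // Sin.
  - move=> r' ds r'n gd; rewrite (cell_set_mem (D := D)) //; last by lia.
    by rewrite inE xpair_eqE; case: ifP => // _; exact: ST.
  - split.
    + by move=> u uN; rewrite other ?Sd ?good1' // /Rdeg /Rcnt; lia.
    + move=> u i uN ig; rewrite other ?Sa //; try (rewrite /Radj /Rcnt; lia).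
      by apply: good2 => //; have := graph_ok_size u gok; lia.
    + move=> u v uN vN; rewrite other ?Sb //; try (rewrite /Rbit /Rcnt; lia).
      by apply: good2 => //; lia.
  - by move=> ds gd; rewrite other ?Sc // /Rcnt; lia.
have s1r : reg s1 = reg s by [].
clearbody s1.
apply: runs_seq.
have r31 : reg s1 3 = p by rewrite s1r.
have lz : all (fun q => (q.1 <= size rec) && (q.2 <= size rec)) (index_pairs ar).
  apply/allP => _ /allpairsP[[x y] [xi yi ->]].
  by move: xi yi; rewrite !mem_iota sz !add0n !ltnS => /= -> ->.
have H := inserts_spec gok ps1 r31 _ _ recN lz.
rewrite sz in H; apply: runs_weaken (H pe He) _ (leqnn _) => s2 [ps2 fr2].
rewrite -sz index_pairsE in ps2.
apply: runs_set.
have E3 : eval w s2 (EOp OAdd (EReg 3) (ECst ar)) = p + ar.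
  by rewrite /= fr2 // r31 (@modn_small ar) ?modn_small //; lia.
rewrite E3; split.
- exact: parsed_set_reg.
- exact: graph_ok_foldl (pairs_le recN) gok.
- exact: reg_set_same.
- by move=> i i3 i4 i5; rewrite reg_set_other // fr2 // s1r.
Qed.

Lemma nth_flatten_size (rs : seq (seq nat)) ar j i :
  all (fun rec => size rec == ar) rs -> j < size rs -> i < ar ->
  nth 0 (flatten rs) (j * ar + i) = nth 0 (nth [::] rs j) i.
Proof.
elim: rs j => // rec rs IH [|j] /= /andP[/eqP sz rsz] jr ia; rewrite nth_cat sz.
  by rewrite ia.
rewrite mulSn; have -> : ar + j * ar + i < ar = false by lia.
by rewrite -addnA addKn IH.
Qed.

Lemma size_flatten_const (rs : seq (seq nat)) ar :
  all (fun rec => size rec == ar) rs -> size (flatten rs) = size rs * ar.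
Proof.
by elim: rs => //= rec rs IH /andP[/eqP sz /IH E]; rewrite size_cat sz E mulSn.
Qed.

Lemma block_spec acc s pre post r ar (rs : seq (seq nat)) :
  enc = pre ++ (size rs :: flatten rs) ++ post ->
  graph_ok acc.2 -> parsed acc.1 acc.2 s -> reg s 3 = size pre ->
  r < nr -> ar <= D -> size rs < B ->
  all (fun rec => (size rec == ar) && all (geq N) rec) rs ->
  let acc' := foldl (add_rec N) acc [seq (r, rec) | rec <- rs] in
  runs w (block_prog nr r ar) s (fun s' =>
    [/\ parsed acc'.1 acc'.2 s', graph_ok acc'.2 &
        reg s' 3 = size (pre ++ (size rs :: flatten rs))])
    ((record_cost r ar + 30) * (size rs).+1).
Proof.
move=> encE gok ps r3 rn arD szB rsok acc'.
have BW := B_lt_word.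
have sza : all (fun rec => size rec == ar) rs.
  by apply: sub_all rsok => x /andP[].
have szf := size_flatten_const sza.
have szpre : size pre + 1 + size rs * ar <= size enc.
  by rewrite encE !size_cat /= szf; lia.
have rd0 : nth 0 enc (size pre) = size rs by rewrite encE nth_cat ltnn subnn.
have rd j i : j < size rs -> i < ar ->
    nth 0 enc (size pre + 1 + j * ar + i) = nth 0 (nth [::] rs j) i.
  move=> jr ia; rewrite encE nth_cat -!addnA ltnNge leq_addr addKn add1n /=.
  rewrite nth_cat szf ifT ?nth_flatten_size //.
  by apply: (@leq_trans (j.+1 * ar)); [rewrite mulSn; lia|rewrite leq_mul2r jr orbT].
pose Inv j s1 := let acc1 := foldl (add_rec N) acc [seq (r, rec) | rec <- take j rs] in
  [/\ parsed acc1.1 acc1.2 s1, graph_ok acc1.2, reg s1 3 = size pre + 1 + j * ar,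
     reg s1 7 = size rs & reg s1 8 = j].
have -> : (record_cost r ar + 30) * (size rs).+1 =
   3 + (4 + (2 + (\sum_(j < size rs) ((record_cost r ar + 26) + 4) + 4 + (record_cost r ar
     + 17)))).
  rewrite sum_nat_const card_ord; lia.
have [[S1 S2] Sin _ _ _] := ps.
apply: runs_seq; apply: runs_set.
have -> : eval w s (EMem (EReg 3)) = size rs.
  by rewrite /= r3 Sin ?rd0 //; lia.
apply: runs_seq; apply: runs_set; set s1 := set_reg s 7 _.
have -> : eval w s1 (EOp OAdd (EReg 3) (ECst 1)) = size pre + 1.
  by rewrite /= update_other // r3 (@modn_small 1) ?word_gt1 // modn_small //; lia.
apply: runs_seq; apply: runs_set; set s2 := set_reg s1 3 _.
apply: (runs_weaken (Q := Inv (size rs)) (T := \sum_(j < size rs) ((record_cost r ar + 26)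
  + 4) + 4)); first last.
- lia.
- move=> s'; rewrite /Inv take_size => -[ps' gok' r3' _ _]; split=> //.
  by rewrite r3' size_cat /= szf; lia.
apply: (runs_while (T := fun=> record_cost r ar + 26)); first last.
- rewrite /Inv take0 /=; split=> //.
  + by rewrite /update /= mul0n addn0.
  + by rewrite /update /= mod0n.
- by move=> s3 [_ _ _ r7 r8]; rewrite eval_lt //= r7 r8 ltnn.
move=> j s3 jr [ps3 gok3 r33 r7 r8]; split; first by rewrite eval_lt //= r7 r8 jr.
apply: (runs_weaken (T := record_cost r ar + 4)); first last.
- lia.
- by move=> s' H; exact: H.
apply: runs_seq.
have recok : (size (nth [::] rs j) == ar) && all (geq N) (nth [::] rs j).
  exact: (allP rsok _ (mem_nth [::] jr)).
have [/eqP szr recN] := andP recok.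
have jar : j * ar + ar <= size rs * ar.
  by rewrite addnC -mulSn leq_mul2r jr orbT.
have H := record_spec gok3 ps3 r33 _ rn szr arD (fun i ia => rd j i jr ia) recN.
apply: runs_weaken (H _) _ (leqnn _) => {H}; first by lia.
move=> s4 [ps4 gok4 r34 fr4]; apply: runs_set.
have -> : eval w s4 (EOp OAdd (EReg 8) (ECst 1)) = j.+1.
  rewrite /= fr4 // r8 (@modn_small 1) ?word_gt1 // addn1 modn_small //.
  by lia.
have accE : foldl (add_rec N) acc [seq (r, rec) | rec <- take j.+1 rs] =
  add_rec N (foldl (add_rec N) acc [seq (r, rec) | rec <- take j rs]) (r, nth [::] rs j).
  by rewrite (take_nth [::]) // map_rcons -cats1 foldl_cat.
rewrite /Inv accE; split=> //.
- by rewrite reg_set_other // r34 mulSn; lia.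
- by rewrite reg_set_other // fr4.
Qed.

Lemma blocks_spec recs ars acc s pre :
  enc = pre ++ block_enc recs ars ->
  graph_ok acc.2 -> parsed acc.1 acc.2 s -> reg s 3 = size pre ->
  (forall p, p \in ars -> [/\ p.1 < nr, p.2 <= D, size (recs p.1) < B &
     all (fun rec => (size rec == p.2) && all (geq N) rec) (recs p.1)]) ->
  let acc' := foldl (add_rec N) acc (all_recs recs ars) in
  runs w (blocks nr ars) s (fun s' => parsed acc'.1 acc'.2 s' /\ graph_ok acc'.2)
    (\sum_(p <- ars) (record_cost p.1 p.2 + 30) * (size (recs p.1)).+1 + 1).
Proof.
elim: ars acc s pre => [|[r ar] ars IH] acc s pre encE gok ps r3 Hp acc'.
  by rewrite big_nil; apply: runs_skip.
have [rn arD szB rsok] := Hp (r, ar) (mem_head _ _).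
rewrite big_cons -addnA; apply: runs_seq.
have H := block_spec encE gok ps r3 rn arD szB rsok.
apply: runs_weaken H _ (leqnn _) => s1 [ps1 gok1 r31].
apply: runs_weaken (IH _ s1 (pre ++ (size (recs r) :: flatten (recs r))) _ gok1 ps1 r31 _)
  _ (leqnn _).
- by rewrite encE -catA.
- by move=> p pa; apply: Hp; rewrite inE pa orbT.
- by rewrite /acc' /all_recs /= foldl_cat.
Qed.

Lemma sizes_spec recs ars s pre :
  enc = pre ++ block_enc recs ars ->
  reg s 3 = size pre -> 0 < size pre -> (forall a, Defs.mem s a = nth 0 enc a) ->
  (forall p, p \in ars -> p.2 < B /\ all (fun rec => size rec == p.2) (recs p.1)) ->
  (forall p, p \in ars -> size (recs p.1) < B) ->
  runs w (sizes ars) s (fun s' => reg s' 3 = size enc /\ Defs.mem s' = Defs.mem s)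
    (20 * size ars + 1).
Proof.
elim: ars s pre => [|[r ar] ars IH] s pre encE r3 p0 ms Hp Hq.
  by apply: runs_skip; rewrite r3 encE cats0.
have BW := B_lt_word.
have /= [arB sza] := Hp (r, ar) (mem_head _ _).
have /= szB := Hq (r, ar) (mem_head _ _).
have szf := size_flatten_const sza.
have szE : size pre + (1 + size (recs r) * ar) <= size enc.
  by rewrite encE size_cat /block_enc /= size_cat szf; lia.
apply: (runs_weaken (T := 9 + (20 * size ars + 1))); first last.
- by rewrite /=; lia.
- by move=> s' H; exact: H.
apply: runs_seq; apply: runs_set.
have m3 : Defs.mem s (size pre) = size (recs r) by rewrite ms encE nth_cat ltnn subnn.
set s1 := set_reg _ _ _.
have r31 : reg s1 3 = size (pre ++ (size (recs r) :: flatten (recs r))).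
  rewrite reg_set_same /= r3 m3 size_cat /= szf.
  move: szE arB szB szf encB BW (word_gt1 hw); move: (size (recs r)) (size pre) (size enc)
    (2 ^ w) => a b c W.
  move=> *; rewrite (@modn_small 1) // (@modn_small ar) 1?(@modn_small (a * ar))
    1?(@modn_small (1 + a * ar)) ?modn_small; lia.
apply: runs_weaken (IH s1 (pre ++ (size (recs r) :: flatten (recs r))) _ r31 _ _ _ _) _
  (leqnn _) => //.
- by rewrite encE -catA.
- by rewrite size_cat /=; lia.
- by move=> p pa; apply: Hp; rewrite inE pa orbT.
- by move=> p pa; apply: Hq; rewrite inE pa orbT.
Qed.

Lemma parse_spec recs ars :
  enc = N :: block_enc recs ars -> B = size enc + N + (nr + 10 + sumn [seq p.2 | p <- ars])
    ->
  (forall p, p \in ars -> [/\ p.1 < nr, p.2 <= D, size (recs p.1) < B & p.2 < B] /\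
     all (fun rec => (size rec == p.2) && all (geq N) rec) (recs p.1)) ->
  let acc := foldl (add_rec N) ([::], ins (fun=> [::]) (N, N)) (all_recs recs ars) in
  runs w (parse_prog nr ars) (State (fun=> 0) (nth 0 enc))
    (fun s' => parsed acc.1 acc.2 s' /\ graph_ok acc.2)
    (parse_cost ars * (\sum_(p <- ars) size (recs p.1)).+1).
Proof.
move=> encE BE Hp acc.
have BW := B_lt_word.
set S := \sum_(p <- ars) size _.
apply: (runs_weaken (T := 2 + ((20 * size ars + 1) + (7 + (3 + (2 +
  ((1 + 1 + 90) + (\sum_(p <- ars) (record_cost p.1 p.2 + 30) * (size (recs p.1)).+1 +
    1)))))))); first last.
- have le1 : \sum_(p <- ars) (record_cost p.1 p.2 + 30) * (size (recs p.1)).+1 <=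
    blocks_cost ars * S.+1.
    rewrite /blocks_cost big_distrl /=.
    rewrite big_seq [X in _ <= X]big_seq; apply: leq_sum => p pa.
    by rewrite leq_mul2l ltnS /S (big_rem p pa) leq_addr orbT.
  rewrite /parse_cost; move: le1; set X := blocks_cost ars; set Y := \sum_(p <- ars) _; nia.
- by move=> s' H; exact: H.
apply: runs_seq; apply: runs_set; rewrite [eval _ _ _]/= modn_small ?word_gt1 //.
set s1 := set_reg _ _ _.
apply: runs_seq.
have H := @sizes_spec recs ars s1 [:: N] encE erefl isT (fun=> erefl).
apply: runs_weaken (H _ _) _ (leqnn _) => {H}.
- by move=> p /Hp [[_ _ _ pB] al]; split=> //; apply: sub_all al => x /andP[].
- by move=> p /Hp [[]].
move=> s2 [r32 m2].
apply: runs_seq; apply: runs_set.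
have m20 : Defs.mem s2 0 = N by rewrite m2 /= encE.
have -> : eval w s2 (EOp OAdd (EOp OAdd (EReg 3) (EMem (ECst 0))) (ECst (nr + 10 + sumn
  [seq p.2 | p <- ars]))) = B.
  rewrite /= mod0n m20 r32 (@modn_small (nr + 10 + sumn [seq p.2 | p <- ars])); last first.
    by apply: leq_trans BW; rewrite BE encE /=; lia.
  rewrite (@modn_small (size enc + N)); last first.
    by apply: leq_trans BW; rewrite BE; lia.
  rewrite -BE modn_small //.
  apply: leq_trans hB; rewrite -{1}(expn1 B) ltn_exp2l; lia.
apply: runs_seq; apply: runs_set.
have -> : eval w (set_reg s2 1 B) (EMem (ECst 0)) = N by rewrite /= mod0n m20.
apply: runs_seq; apply: runs_set; rewrite [eval _ _ _]/= modn_small ?word_gt1 //.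
set s3 := set_reg _ _ _.
(* All array addresses lie beyond the input, where the memory is 0: this encodes empty tables, the
   empty graph and zero counters. *)
have ps3 : parsed [::] (fun=> [::]) s3.
  have am0 r ds : arr s3 r ds = 0.
    rewrite /cell /s3 /= m2 /= nth_default //.
    have := @leq_addr_base B r ds; move: (addr _ _ _) => x; nia.
  split=> //; first by move=> a ap; rewrite /s3 /= m2.
apply: runs_seq.
have gok0 : graph_ok (fun=> [::]) by split.
(* The loop at N makes N a node even if there are no records. *)
have H := @insert_spec _ _ s3 (EReg 2) (EReg 2) N N (leqnn N) (leqnn N) gok0 ps3 erefl
  erefl.
apply: runs_weaken H _ (leqnn _) => s4 [ps4 fr4].
have gok4 := graph_ok_ins N (leqnn N) gok0.
apply: (@blocks_spec recs ars ([::], ins (fun=> [::]) (N, N)) s4 [:: N]) => //.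
  by rewrite fr4.
by move=> p /Hp [[]].
Qed.

End Env.

(** * From conjunctions to the optimum *)

Lemma big_tups_cons (K : pzRingType) d L (f : seq nat -> K) :
  (\sum_(z <- tups d.+1 L) f z = \sum_(a <- L) \sum_(t <- tups d L) f (a :: t))%R.
Proof. by rewrite /= big_allpairs_dep. Qed.

Lemma big_tups_cat (K : pzRingType) p q L (f : seq nat -> K) :
  (\sum_(z <- tups (p + q) L) f z = \sum_(t <- tups p L) \sum_(u <- tups q L) f (t ++ u))%R.
Proof.
elim: p f => [|p IH] f; first by rewrite big_seq1.
by rewrite addSn !big_tups_cons; apply: eq_bigr => a _; rewrite IH.
Qed.

Lemma big_tups3 (K : pzRingType) L (f : seq nat -> K) :
  (\sum_(z <- tups 3 L) f z =
   \sum_(a <- L) \sum_(b <- L) \sum_(c <- L) f [:: a; b; c])%R.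
Proof.
rewrite big_tups_cons; apply: eq_bigr => a _; rewrite big_tups_cons.
apply: eq_bigr => b _; rewrite big_tups_cons; apply: eq_bigr => c _; exact: big_seq1.
Qed.

Lemma tups_uniq d (L : seq nat) : uniq L -> uniq (tups d L).
Proof.
move=> uL; elim: d => //= d IH; apply: allpairs_uniq => // -[a t] [b u] _ _ /= [-> ->] //.
Qed.

(** * Adding up the monomials and searching for the best counter *)

Section Programs.
Variables (nr k n : nat).

Definition poly_prog (P : seq (bool * seq (nat * seq nat))) :=
  foldr (fun q c => CSeq (mon_prog nr k n q.1 q.2) c) CSkip P.
Definition count_prog P := nest nr 0 n (poly_prog P).

(** If every object occurs in a record, N stands for no object and has weight 0; tuples of nodes
    containing N must then be skipped. *)
Definition evalid :=
  foldr (fun j e => EOp OMul (EOp OLt (ECst 0) (ewt nr (var_reg j))) e) (ECst 1) (iota 0 k).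
(** Adding 0 reduces the cell modulo 2^w, which makes the compared number canonical. *)
Definition ecnt := EOp OAdd (earr (Rcnt nr) (exs k)) (ECst 0).
Definition better d :=
  if d is Max then EOp OLt (EReg 0) ecnt else EOp OLt ecnt (EReg 0).
Definition best_body d := CIf evalid (CIf (better d) (CSet 0 ecnt) CSkip) CSkip.
Definition best_prog d :=
  CSeq (CSet 0 (if d is Max then ECst 0 else eneg1)) (nest nr 0 k (best_body d)).

Definition poly_cost (P : seq (bool * seq (nat * seq nat))) :=
  \sum_(q <- P) mon_cost nr k n q.1 q.2.
Definition best_cost d :=
  (cost evalid + ((cost (better d) + (cost ecnt).+2).+1)).+1.

Lemma low_mods_poly P : low_mods n (poly_prog P).
Proof.
elim: P => // q P IH; apply: low_mods_seq => //; exact: low_mods_mon.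
Qed.

End Programs.

Definition best_step d (valid : seq nat -> bool) (V : seq nat -> nat) t b :=
  if valid t && (if d is Max then b < V t else V t < b) then V t else b.

Lemma best_foldP d valid V l b :
  let r := foldl (fun b t => best_step d valid V t b) b l in
  (r = b \/ exists t, [/\ t \in l, valid t & r = V t]) /\
  (forall t, t \in l -> valid t -> if d is Max then V t <= r else r <= V t) /\
  (if d is Max then b <= r else r <= b).
Proof.
elim: l b => [|t l IH] b /=; first by split; [left|split=> //; case: d].
have [H1 [H2 H3]] := IH (best_step d valid V t b).
set r := foldl _ _ _ in H1 H2 H3 *.
have key : (if d is Max then b <= r else r <= b) /\
  (valid t -> if d is Max then V t <= r else r <= V t).
  by move: H3; rewrite /best_step; case: (valid t) => /=; case: (d); case: ltnP; lia.
split; last split; last by case: key.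
- case: H1 => [->|[t' [t'l v ->]]]; last by right; exists t'; rewrite inE t'l orbT.
  rewrite /best_step; case: ifP => [/andP[v _]|_]; last by left.
  by right; exists t; rewrite mem_head.
- by move=> t'; rewrite inE => /orP[/eqP ->|/H2 //]; case: key.
Qed.

Section Env.
Variables (w B D N nr : nat) (G : nat -> seq nat) (tbl : nat -> seq nat -> bool).
Hypothesis ENV : env w B D N nr G.
Hypothesis GR : graph N nr G tbl.
Variable K : comPzRingType.
Hypothesis hK : forall n, ((n %% 2 ^ w)%:R = n%:R :> K)%R.
Hypothesis hinj : forall a b, a < 2 ^ w -> b < 2 ^ w -> (a%:R = b%:R :> K)%R -> a = b.
Variables (k n : nat).
Hypothesis kn : k <= n.+1.
Hypothesis kD : k <= D.
Let hB := env_word ENV.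
Let hw := env_w ENV.

Notation good := (digits_ok B D).
Notation arr := (cell B).
Notation L := (G N).
Notation static := (static B D N nr G tbl).
Notation wt := (weight N G K).
Notation wf := (wf D nr).
Notation counts_are := (counts_are B N nr k).
Notation coef := (coef K).

Definition delta (P : seq (bool * seq (nat * seq nat))) zs xs : K :=
  (\sum_(q <- P) \sum_(a <- L) add_term N G k q.1 zs (fmon N G tbl K n q.2 zs) xs a)%R.

Lemma poly_spec P zs F s :
  (forall q, q \in P -> wf q.2) ->
  (forall q a v, q \in P -> a \in q.2 -> v \in a.2 -> v < n.+3) ->
  size zs = n -> {subset zs <= L} ->
  static s -> regs_are s zs -> counts_are F s ->
  runs w (poly_prog nr k n P) s (fun s' => static s' /\
     counts_are (fun xs => F xs + delta P zs xs)%R s')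
     (poly_cost nr k n P * trisum N G + 1).
Proof.
rewrite /delta /poly_cost; elim: P F s => [|q Q IH] F s wfQ varQ sz zL st rz cI.
  rewrite big_nil; apply: runs_skip; split=> //; apply: counts_are_ext cI => xs.
  by rewrite big_nil addr0.
rewrite big_cons mulnDl -addnA; apply: runs_seq.
have H := mon_spec ENV GR hK kn kD q.1 sz zL (wfQ q (mem_head _ _))
  (fun a v => @varQ q a v (mem_head _ _)) st rz cI.
apply: runs_weaken (runs_frame H) _ (leqnn _) => s1 [[st1 cI1] fr].
have rz1 : regs_are s1 zs.
  move=> j jn; rewrite fr ?rz //; apply/negP => im.
  by have := allP (low_mods_mon nr k n q.1 q.2) _ im; rewrite sz in jn; rewrite /=
    /var_reg; lia.
apply: runs_weaken (IH _ s1 _ _ sz zL st1 rz1 cI1) _ (leqnn _).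
- by move=> p pQ; apply: wfQ; rewrite inE pQ orbT.
- by move=> p a v pQ; apply: varQ; rewrite inE pQ orbT.
- move=> s2 [st2 cI2]; split=> //; apply: counts_are_ext cI2 => xs.
  by rewrite big_cons addrA.
Qed.

Variable P : seq (bool * seq (nat * seq nat)).
Hypothesis wfP : forall q, q \in P -> wf q.2.
Hypothesis varP : forall q a v, q \in P -> a \in q.2 -> v \in a.2 -> v < n.+3.

Lemma count_spec s :
  static s -> counts_are (fun=> 0%R : K) s ->
  runs w (count_prog nr k n P) s (fun s' => static s' /\
     counts_are (fun xs => \sum_(t <- tups n L) delta P t xs)%R s')
     ((size L).+1 ^ n * (poly_cost nr k n P * trisum N G + 1 + loop_cost * n)).
Proof.
move=> st cI.
have := @nest_spec w B D N nr G tbl ENV _ (fun F s => counts_are F s)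
  (fun t F xs => F xs + delta P t xs)%R (poly_cost nr k n P * trisum N G + 1) 0 n
  (poly_prog nr k n P) [::] (fun=> 0%R : K) s (graph_ghost GR).
move=> H; apply: runs_weaken (H _ _ _ _ _ _ _ _) _ (leqnn _) => {H} //.
- exact: low_mods_poly.
- by move=> zs F s1 sz zL st1 cI1 rz; apply: (poly_spec wfP varP).
- move=> s' [st' cI']; split=> //; apply: counts_are_ext cI' => xs.
  have E : forall l F, (foldl (fun x t => fun xs => x xs + delta P ([::] ++ t) xs) F l xs =
    F xs + \sum_(t <- l) delta P t xs)%R.
    elim=> [|t l IH] F /=; first by rewrite big_nil addr0.
    by rewrite IH big_cons addrA.
  by rewrite E add0r.
Qed.

Definition poly_val (rho : nat -> nat) : K :=
  (\sum_(q <- P) coef q.1 * (mon tbl q.2 rho)%:R)%R.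

(** Both sides are the sum of [Phi] over the tuples of length n + 3 with x-part [xs]: the left side
    splits a tuple after n entries, the right side after k. *)
Lemma count_sum l xs : k + l = n.+3 -> xs \in tups k L ->
  (\sum_(t <- tups n L) delta P t xs =
   \sum_(u <- tups l L) (\prod_(v <- u) wt v) * poly_val (nth 0 (xs ++ u)))%R.
Proof.
move=> kl xsL.
pose Phi z := ((\prod_(v <- drop k z) wt v) * poly_val (nth 0 z))%R.
have -> : (\sum_(u <- tups l L) (\prod_(v <- u) wt v) * poly_val (nth 0 (xs ++ u)) =
  \sum_(z <- tups n.+3 L) (xs == take k z)%:R * Phi z)%R.
  have [szx _] := tupsP _ _ _ xsL.
  rewrite -kl big_tups_cat (bigD1_seq xs xsL (tups_uniq k (graph_uniq GR N))) /=.
  rewrite [X in (_ = _ + X)%R]big1_seq ?addr0.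
    by apply: eq_bigr => u _; rewrite /Phi take_size_cat // drop_size_cat // eqxx mul1r.
  move=> t /andP[tx /tupsP[szt _]]; apply: big1 => u _.
  by rewrite take_size_cat // eq_sym (negbTE tx) mul0r.
rewrite -[n.+3]addn3 big_tups_cat; apply: eq_big_seq => t /tupsP[szt tL].
rewrite big_tups3 /delta exchange_big; apply: eq_bigr => a _.
under eq_bigr => q _ do rewrite /add_term /fmon mulr_sumr mulr_sumr.
rewrite exchange_big /=; apply: eq_bigr => b _.
under eq_bigr => q _ do rewrite mulr_sumr mulr_sumr.
rewrite exchange_big /=; apply: eq_bigr => c _.
rewrite /Phi /poly_val mulr_sumr mulr_sumr.
rewrite big_seq [RHS]big_seq; apply: eq_bigr => q qP.
have -> : t ++ [:: a; b; c] = rcons t a ++ [:: b; c] by rewrite -cats1 -catA.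
have sza : size (rcons t a) = n.+1 by rewrite size_rcons szt.
rewrite takel_cat ?sza // drop_cat sza.
(* The boundary k = n + 1 is the case l = 2, where a is the last x-variable. *)
have -> : (if k < n.+1 then drop k (rcons t a) ++ [:: b; c] else drop (k - n.+1) [:: b; c])
  =
   drop k (rcons t a) ++ [:: b; c].
  case: ltnP => // le; have -> : k = n.+1 by apply/eqP; rewrite eqn_leq kn.
  by rewrite subnn drop0 drop_oversize ?sza.
rewrite big_cat /= big_cons big_seq1 /wts.
have -> : mon tbl q.2 (nth 0 (rcons t a ++ [:: b; c])) = mon tbl q.2 (rho3 n (nth 0 t) a b
  c).
  apply: eq_mon => at_ v aq va; have := varP qP aq va.
  rewrite cat_rcons nth_cat szt /rho3 /update => vn.
  case: (eqVneq v n) => [->|vA]; first by rewrite ltnn subnn.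
  case: (eqVneq v n.+1) => [->|vB].
    by rewrite ltnNge leqnSn /= subSnn.
  case: (eqVneq v n.+2) => [->|vC].
    have -> : n.+2 < n = false by lia.
    by have -> : n.+2 - n = 2 by lia.
  by have -> : v < n by lia.
ring.
Qed.

Definition wtn v := if v < N then 1 else N.+1 - size L.

Lemma size_L_le : size L <= N.+1.
Proof.
rewrite -(size_iota 0 N.+1); apply: uniq_leq_size; first exact: (graph_uniq GR).
by move=> v vL; rewrite mem_iota add0n ltnS (L_le GR vL).
Qed.

Lemma wtnE v : v <= N -> ((wtn v)%:R = wt v)%R.
Proof.
move=> vN; rewrite /wtn /weight; case: (ltnP v N) => [lt|ge].
  by rewrite (ltn_eqF lt) mul0r addr0.
have -> : v = N by apply/eqP; rewrite eqn_leq vN.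
by rewrite eqxx mul1r add0r natrB ?size_L_le // -addn1 natrD.
Qed.

(** Words that agree in K are equal, so the weight, although computed with -1, is the number itself.
    Its sign can therefore be tested. *)
Lemma eval_wtn s z v : static s -> reg s z = v -> v <= N ->
  eval w s (ewt nr z) = wtn v.
Proof.
move=> st rz vN; apply: hinj; last by rewrite (eval_wt ENV hK st rz) wtnE.
  by rewrite /ewt; rewrite -[eval _ _ _]/(_ %% _) ltn_mod expn_gt0.
have BW := leq_B_word ENV; have NB := env_N ENV.
rewrite /wtn; case: ifP => _; first exact: word_gt1.
by have := size_L_gt0 GR; lia.
Qed.

Definition valid (xs : seq nat) := all (fun v => 0 < wtn v) xs.

Lemma eval_valid s zs : static s -> regs_are s zs -> size zs = k -> all (geq N) zs ->
  eval w s (evalid nr k) = valid zs.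
Proof.
move=> st rz sz zN; rewrite /evalid.
have zE : zs = [seq nth 0 zs j | j <- iota 0 k].
  by rewrite -sz map_nth_iota0 // take_size.
rewrite [in RHS]zE.
have : all (gtn k) (iota 0 k) by apply/allP => j; rewrite mem_iota.
elim: (iota 0 k) => [_|j l IH /andP[jk lk]].
  by rewrite -[LHS]/(1 %% 2 ^ w) modn_small ?word_gt1.
rewrite [foldr _ _ _]/= -[LHS]/(eval_op w OMul (eval w s (EOp OLt (ECst 0) (ewt nr (var_reg
  j)))) (eval w s _)).
rewrite IH // eval_lt // (@eval_wtn s _ (nth 0 zs j)) //; first last.
- by apply: (allP zN); rewrite mem_nth ?sz.
- by rewrite rz ?sz.
by rewrite /= mod0n mulnb bool_lt_word.
Qed.

Lemma best_spec d s :
  static s ->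
  runs w (best_prog nr k d) s (fun s' => reg s' 0 =
     foldl (fun b t => best_step d valid (fun xs => arr s (Rcnt nr) xs %% 2 ^ w) t b)
       (if d is Max then 0 else (2 ^ w).-1) (tups k L))
   (10 + (size L).+1 ^ k * (best_cost nr k d + loop_cost * k)).
Proof.
move=> st; set V := fun xs => arr s (Rcnt nr) xs %% 2 ^ w.
have W1 := word_gt1 hw.
apply: (runs_weaken (T := (cost (if d is Max then ECst 0 else eneg1)).+1 +
  (size L).+1 ^ k * (best_cost nr k d + loop_cost * k))); first last.
- by rewrite leq_add2r; case: d.
- by move=> s' H; exact: H.
apply: runs_seq; apply: runs_set.
have -> : eval w s (if d is Max then ECst 0 else eneg1) = if d is Max then 0 else (2 ^
  w).-1.
  case: d; first by rewrite /= mod0n.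
  by rewrite /eneg1 /= mod0n add0n (@modn_small 1) // modn_small subn1 // prednK //
    expn_gt0.
set b0 := if d is Max then 0 else _.
pose Inv b s1 := reg s1 0 = b /\ (forall ds, good ds -> arr s1 (Rcnt nr) ds = arr s (Rcnt
  nr) ds).
have := @nest_spec w B D N nr G tbl ENV _ Inv (fun t b => best_step d valid V t b)
  (best_cost nr k d) 0 k (best_body nr k d) [::] b0 (set_reg s 0 b0) (graph_ghost GR).
move=> H; apply: runs_weaken (H _ _ _ _ _ _ _ _) _ (leqnn _) => {H} //.
- by move=> b s1 r v r10 [I1 I2]; split=> //; rewrite reg_set_other // eq_sym; lia.
- move=> zs b s1 szz zL st1 [r0 m1] rz.
  have zN : all (geq N) zs by apply/allP => x /zL; exact: (L_le GR).
  have ex : [seq eval w s1 e | e <- exs k] = zs.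
    apply: (@eq_from_nth _ 0); rewrite !size_map size_iota ?szz // => i ik.
    rewrite (nth_map (ECst 0)) ?size_map ?size_iota // (nth_map 0) ?size_iota // nth_iota
      //.
    by rewrite /= rz ?szz.
  have gz : good zs by apply: (good_le ENV) => //; rewrite szz.
  have S1 : reg s1 1 = B by case: st1.
  have cE : eval w s1 (ecnt nr k) = V zs.
    rewrite /ecnt -[LHS]/((eval w s1 (earr (Rcnt nr) (exs k)) + 0 %% 2 ^ w) %% 2 ^ w).
    rewrite mod0n addn0 (eval_earr hB) ?ex ?m1 //; exact: (region_lt ENV).
  apply: runs_if => [|ev0].
    rewrite (eval_valid st1 rz szz zN) => va; have {}va : valid zs by case: (valid zs) va.
    apply: (runs_weaken (Q := fun s' => static s' /\ Inv (best_step d valid V zs b) s')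
      (T := (cost (better nr k d) + (cost (ecnt nr k)).+1).+1)) => //; last by lia.
    have bE : eval w s1 (better nr k d) = nat_of_bool (if d is Max then b < V zs else V zs
      < b).
      by rewrite /better; case: (d); rewrite eval_lt // cE /= r0.
    apply: runs_if => [|b0'].
      rewrite bE => bt; apply: runs_set; rewrite cE; split; first exact: static_set_reg.
      split=> //; rewrite reg_set_same /best_step va.
      by move: bt; rewrite eqb0 negbK => ->.
    apply: runs_weaken (runs_skip w (s := s1) (Q := fun s' => s' = s1) erefl) _ _ => // s'
      ->.
    split=> //; split=> //; rewrite r0 /best_step va.
    by move/eqP: b0'; rewrite bE eqb0 => /negbTE ->.
  apply: runs_weaken (runs_skip w (s := s1) (Q := fun s' => s' = s1) erefl) _ _ => // s' ->.
  split=> //; split=> //; rewrite r0 /best_step.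
  by move: ev0; rewrite (eval_valid st1 rz szz zN); case: (valid zs).
- by move=> s' [_ []].
Qed.

End Env.

(** * Number of triangles *)

(* A vertex y with more than r neighbours is heavy: [min (deg x) (deg y)] is at
   most r unless y is heavy, and at most q vertices are heavy. *)
Lemma trisum_bound N nr G tbl r q E : graph N nr G tbl ->
  \sum_(u <- G N) size (G u) <= E -> E <= q * r ->
  trisum N G <= (2 + r + q) * E.
Proof.
move=> GR EL Eqr; set L := G N.
have EL' : size L <= E.
  by apply: leq_trans EL; rewrite (big_rem N (graph_ghost GR)) leq_addr.
have heavy x : \sum_(y <- G x) (r < size (G y))%N <= q.
  have [r0|r0] := posnP r.
    have E0 : E = 0 by move: Eqr; rewrite r0 muln0; lia.
    rewrite big1_seq // => y /andP[_ yx]; rewrite r0.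
    have yL := graph_sub GR yx.
    have : size (G y) <= 0.
      by rewrite -E0; apply: leq_trans EL; rewrite (big_rem y yL) leq_addr.
    by rewrite leqn0 => /eqP ->.
  (* r times the number of heavy neighbours is at most the sum of all degrees, hence at most q *
     r. *)
  rewrite -(leq_pmul2r r0) big_distrl /=; apply: leq_trans Eqr; apply: leq_trans EL.
  apply: (@leq_trans (\sum_(y <- G x) size (G y))).
    by apply: leq_sum => y _; case: ltnP => [/ltnW|_]; rewrite ?mul1n ?mul0n.
  have pe : perm_eq (G x) [seq y <- L | y \in G x].
    apply: uniq_perm; rewrite ?filter_uniq ?(graph_uniq GR) // => y.
    by rewrite mem_filter; case yG: (y \in G x) => //=; rewrite (graph_sub GR yG).
  rewrite (perm_big _ pe) big_filter [leqRHS](bigID (fun y => y \in G x)) /=.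
  exact: leq_addr.
(* There are deg x summands; each is at most 1 + r, plus deg x for the at most q heavy y. *)
have inner x : \sum_(y <- G x) (minn (size (G x)) (size (G y))).+1 <= (1 + r + q) * size (G
  x).
  apply: (@leq_trans (\sum_(y <- G x) ((1 + r) + size (G x) * (r < size (G y))%N))).
    by apply: leq_sum => y _; case: ltnP => h; rewrite ?muln1 ?muln0; lia.
  rewrite big_split /= -big_distrr /= big_const_seq iter_addn count_predT addn0.
  by rewrite [leqRHS]mulnDl leq_add2l mulnC leq_mul2r heavy orbT.
apply: (@leq_trans (\sum_(x <- L) ((1 + r + q) * size (G x) + 1))).
  by apply: leq_sum => x _; rewrite addn1 ltnS.
rewrite big_split /= -big_distrr /= sum1_size.
apply: (@leq_trans ((1 + r + q) * E + E)); last by lia.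
by apply: leq_add => //; rewrite leq_mul2l EL orbT.
Qed.

(** * Formulas and structures *)

Section Formula.
Variables (sigma : signature) (k l : nat).
Implicit Types phi : qf_formula sigma ('I_k + 'I_l).

Definition vidx (z : 'I_k + 'I_l) : nat :=
  match z with inl i => i | inr j => k + j end.

Definition neg (P : seq (bool * seq (nat * seq nat))) := [seq (~~ q.1, q.2) | q <- P].
Definition mulp (P Q : seq (bool * seq (nat * seq nat))) :=
  [seq (p.1 (+) q.1, p.2 ++ q.2) | p <- P, q <- Q].

(* A formula as a signed sum of products of atoms; the sign is true for -1. *)
Fixpoint poly phi : seq (bool * seq (nat * seq nat)) :=
  match phi with
  | FTrue => [:: (false, [::])]
  | FAtom r args => [:: (false, [:: (nat_of_ord r, [seq vidx z | z <- tval args])])]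
  | FNot p => (false, [::]) :: neg (poly p)
  | FAnd p q => mulp (poly p) (poly q)
  | FOr p q => poly p ++ poly q ++ neg (mulp (poly p) (poly q))
  end.

Fixpoint nsat (tbl : nat -> seq nat -> bool) (rho : nat -> nat) phi : bool :=
  match phi with
  | FTrue => true
  | FAtom r args => tbl r [seq rho (vidx z) | z <- tval args]
  | FNot p => ~~ nsat tbl rho p
  | FAnd p q => nsat tbl rho p && nsat tbl rho q
  | FOr p q => nsat tbl rho p || nsat tbl rho q
  end.

Section Value.
Variables (K : comPzRingType) (tbl : nat -> seq nat -> bool) (rho : nat -> nat).
Local Notation pv := (poly_val tbl K ^~ rho).
Local Open Scope ring_scope.

Lemma pv_cat P Q : pv (P ++ Q) = pv P + pv Q.
Proof. exact: big_cat. Qed.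

Lemma pv_neg P : pv (neg P) = - pv P.
Proof.
rewrite /poly_val /neg big_map -sumrN; apply: eq_bigr => -[b M] _ /=.
by case: b; rewrite /coef ?mulN1r ?opprK mul1r.
Qed.

Lemma pv_mulp P Q : pv (mulp P Q) = pv P * pv Q.
Proof.
rewrite /poly_val /mulp big_allpairs_dep /= mulr_suml; apply: eq_bigr => -[b M] _.
rewrite mulr_sumr; apply: eq_bigr => -[c M'] _ /=.
rewrite /mon all_cat -mulnb natrM -/(mon _ _ _) -/(mon _ _ _).
by case: b; case: c; rewrite /coef /=; ring.
Qed.

(** Arithmetisation: negation is 1 - p, conjunction is the product, and disjunction is p + q - p
    q. *)
Lemma pv_poly phi : pv (poly phi) = (nsat tbl rho phi)%:R.
Proof.
elim: phi => [|r args|p IH|p IHp q IHq|p IHp q IHq] /=.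
- by rewrite /poly_val big_seq1 /coef mul1r.
- by rewrite /poly_val big_seq1 /coef mul1r /mon /= andbT -map_comp.
- rewrite -cat1s pv_cat pv_neg IH /poly_val big_seq1 /coef mul1r /=.
  by case: (nsat _ _ _); rewrite ?subrr ?subr0.
- by rewrite pv_mulp IHp IHq -natrM mulnb.
- rewrite !pv_cat pv_neg pv_mulp IHp IHq.
  by case: (nsat _ _ p); case: (nsat _ _ q) => /=; ring.
Qed.

End Value.

Lemma poly_wf D phi : (forall r : 'I_(nrel sigma), arity r <= D) ->
  (forall q, q \in poly phi -> wf D (nrel sigma) q.2) /\
  (forall q a v, q \in poly phi -> a \in q.2 -> v \in a.2 -> v < k + l).
Proof.
move=> aD.
pose ok (P : seq (bool * seq (nat * seq nat))) :=
  (forall q, q \in P -> wf D (nrel sigma) q.2) /\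
  (forall q a v, q \in P -> a \in q.2 -> v \in a.2 -> v < k + l).
have ok1 : ok [:: (false, [::])] by split=> [q|q a v]; rewrite inE => /eqP ->.
have okcat P Q : ok P -> ok Q -> ok (P ++ Q).
  move=> [P1 P2] [Q1 Q2]; split=> [q|q a v]; rewrite mem_cat => /orP[].
  - exact: P1.
  - exact: Q1.
  - exact: P2.
  - exact: Q2.
have okneg P : ok P -> ok (neg P).
  by move=> [P1 P2]; split=> [q|q a v] /mapP[p pP ->] /=; [exact: P1|exact: P2].
have okmul P Q : ok P -> ok Q -> ok (mulp P Q).
  move=> [P1 P2] [Q1 Q2]; split=> [q|q a v] /allpairsP[[p q'] [/= pP qQ ->]] /=.
    by rewrite /wf all_cat; apply/andP; split; [exact: P1|exact: Q1].
  by rewrite mem_cat => /orP[]; [exact: P2|exact: Q2].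
rewrite -/(ok _); elim: phi => [|r args|p IH|p IHp q IHq|p IHp q IHq] //=.
- split=> [q|q a v]; rewrite inE => /eqP -> /=.
    by rewrite ltn_ord size_map size_tuple aD.
  rewrite inE => /eqP -> /= /mapP[z _ ->]; rewrite /vidx.
  by case: z => i; [apply: ltn_addr|rewrite ltn_add2l].
- by rewrite -cat1s; apply: (okcat) => //; apply: (okneg).
- exact: (okmul).
- by apply: (okcat) => //; apply: (okcat) => //; apply: (okneg); apply: (okmul).
Qed.

End Formula.

Lemma mem_foldl_add_rec N l acc q :
  (q \in (foldl (add_rec N) acc l).1) = (q \in acc.1) || (q \in l).
Proof.
elim: l acc => [|p l IH] acc /=; first by rewrite orbF.
by rewrite IH /= !inE orbCA orbA.
Qed.

Lemma foldl_add_rec2 N l acc :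
  (foldl (add_rec N) acc l).2 = foldl ins acc.2 (flatten [seq pairs N q.2 | q <- l]).
Proof. by elim: l acc => //= p l IH acc; rewrite IH foldl_cat. Qed.

(** * The graph of a structure and the merging of objects without records *)

Section Structure.
Variables (sigma : signature) (A : structure sigma).
Local Notation nr := (nrel sigma).
Local Notation N := (nobj A).

Definition arities : seq (nat * nat) := [seq (nat_of_ord r, arity r) | r <- enum 'I_nr].
Definition records (r : 'I_nr) : seq (seq nat) :=
  [seq [seq nat_of_ord a | a <- tval rec] | rec <- rel_of A r].
Definition recs (i : nat) : seq (seq nat) := if insub i is Some r then records r else [::].
Definition all_of := all_recs recs arities.
Definition acc_of := foldl (add_rec N) ([::], ins (fun=> [::]) (N, N)) all_of.
Definition graph_of := acc_of.2.
Definition table_of r ds := (r, ds) \in acc_of.1.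
Local Notation L := (graph_of N).

Lemma recsE (r : 'I_nr) : recs r = records r.
Proof. by rewrite /recs valK. Qed.

Lemma encodeE : encode A = N :: block_enc recs arities.
Proof.
rewrite /encode /block_enc /arities -map_comp; congr (_ :: flatten _).
by apply: eq_map => r /=; rewrite recsE size_map.
Qed.

Lemma all_ofP q : reflect (exists r rec, rec \in rel_of A r /\
    q = (nat_of_ord r, [seq nat_of_ord a | a <- tval rec])) (q \in all_of).
Proof.
apply: (iffP allpairsPdep) => [[p [ds [/mapP[r _ ->] /= + ->]]]|[r [rec [rr ->]]]].
  by rewrite recsE => /mapP[rec rr ->]; exists r, rec.
exists (nat_of_ord r, arity r), [seq nat_of_ord a | a <- tval rec]; split=> //.
  by apply/mapP; exists r; rewrite ?mem_enum.
by rewrite /= recsE; apply/mapP; exists rec.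
Qed.

Lemma table_ofE r ds : table_of r ds = ((r, ds) \in all_of).
Proof. by rewrite /table_of mem_foldl_add_rec. Qed.

Lemma all_of_lt q x : q \in all_of -> x \in q.2 -> x < N.
Proof. by move=> /all_ofP[r [rec [_ ->]]] /= /mapP[a _ ->]. Qed.

Lemma mem_graph u v :
  (v \in graph_of u) = ((u == N) && (v == N)) ||
    has (fun q => (u \in N :: q.2) && (v \in N :: q.2)) all_of.
Proof.
rewrite /graph_of foldl_add_rec2 mem_foldl_ins mem_ins xpair_eqE /=.
rewrite (eq_sym N u) (eq_sym N v); congr (_ || _).
apply/flatten_mapP/hasP => [[q qa /allpairsP[[x y] /= [xq yq [-> ->]]]]|[q qa /andP[uq
  vq]]].
  by exists q; rewrite // xq yq.
by exists q => //; apply/allpairsP; exists (u, v).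
Qed.

Lemma graph_ofP : graph N nr graph_of table_of.
Proof.
split.
- by rewrite mem_graph !eqxx.
- move=> u v; rewrite !mem_graph eqxx => /orP[/andP[_ ->] //|/hasP[q qa /andP[_ vq]]].
  by apply/orP; right; apply/hasP; exists q; rewrite // vq mem_head.
- move=> u; rewrite /graph_of foldl_add_rec2; apply: uniq_foldl_ins => x; exact: uniq_ins.
- move=> v; rewrite mem_graph => /orP[/andP[_ /eqP ->] //|/hasP[q qa /andP[_]]].
  by rewrite inE => /orP[/eqP -> //|/(all_of_lt qa)/ltnW].
- move=> r ds; rewrite table_ofE => ta x y xd yd; rewrite mem_graph.
  by apply/orP; right; apply/hasP; exists (r, ds); rewrite // !inE xd yd !orbT.
Qed.

Lemma sum_recs : \sum_(p <- arities) size (recs p.1) = nrec A.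
Proof.
rewrite /arities big_map big_enum /nrec; apply: eq_bigr => r _.
by rewrite /= recsE size_map.
Qed.

Lemma size_all_of : size all_of = nrec A.
Proof.
rewrite -sum_recs /all_of /all_recs size_flatten /shape -map_comp sumnE big_map.
by apply: eq_bigr => p _; rewrite /= size_map.
Qed.

(** One entry comes from the loop at N, and each record inserts the ordered pairs among its entries
    and N. *)
Lemma degrees_le a : (forall r : 'I_nr, arity r <= a) ->
  \sum_(u <- L) size (graph_of u) <= 1 + a.+1 ^ 2 * nrec A.
Proof.
move=> aa; have uL := graph_uniq graph_ofP N.
rewrite [X in X <= _](_ : _ = \sum_(u <- L) size (foldl ins (fun=> [::]) ((N, N) :: flatten
  [seq pairs N q.2 | q <- all_of]) u)).
  apply: leq_trans (size_foldl_ins _ _ uL) _; rewrite big1 // add0n /= ltnS.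
  rewrite size_flatten /shape -map_comp sumnE big_map.
  apply: (@leq_trans (\sum_(q <- all_of) a.+1 ^ 2)).
    rewrite big_seq [leqRHS]big_seq; apply: leq_sum => q /all_ofP[r [rec [_ ->]]].
    rewrite -[X in X <= _]/(size (pairs N [seq nat_of_ord a | a <- rec])).
    by rewrite /pairs (size_allpairs pair) /= size_map size_tuple mulnn leq_exp2r // ltnS.
  by rewrite big_const_seq iter_addn count_predT addn0 size_all_of.
by apply: eq_bigr => u _; rewrite /graph_of foldl_add_rec2.
Qed.

(** An object is in L exactly if it occurs in a record; all others are merged into N. *)
Definition collapse (y : 'I_N) : nat := if nat_of_ord y \in L then nat_of_ord y else N.

Lemma collapse_L y : collapse y \in L.
Proof. by rewrite /collapse; case: ifP => // _; exact: graph_ghost graph_ofP. Qed.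

Lemma collapse_lt y : collapse y < N -> collapse y = nat_of_ord y.
Proof. by rewrite /collapse; case: ifP => //; rewrite ltnn. Qed.

Lemma collapse_active q y : q \in all_of -> nat_of_ord y \in q.2 -> collapse y = nat_of_ord
  y.
Proof.
move=> qa yq; rewrite /collapse mem_graph; case: ifP => // /negbT /negP[].
by apply/orP; right; apply/hasP; exists q; rewrite // !inE yq eqxx orbT.
Qed.

Section Tuples.
Variables (k l : nat).
Implicit Types (x : k.-tuple 'I_N) (y : l.-tuple 'I_N).

Lemma nth_assign x y z :
  nth 0 ([seq collapse a | a <- x] ++ [seq collapse a | a <- y]) (vidx z) =
  collapse (assign x y z).
Proof.
case: z => i /=; rewrite nth_cat size_map size_tuple.
  by rewrite ltn_ord (nth_map (tnth x i)) ?size_tuple // -tnth_nth.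
by rewrite ltnNge leq_addr /= addKn (nth_map (tnth y i)) ?size_tuple // -tnth_nth.
Qed.

(** Merging is invisible to relational atoms: the entries of a record are fixed by [collapse], and a
    tuple with a merged entry becomes one containing N, which is in no record. *)
Lemma sat_nsat x y (phi : qf_formula sigma ('I_k + 'I_l)) :
  sat (assign x y) phi =
  nsat table_of (nth 0 ([seq collapse a | a <- x] ++ [seq collapse a | a <- y])) phi.
Proof.
elim: phi => [|r args|p IH|p IHp q IHq|p IHp q IHq] //=; rewrite ?IH ?IHp ?IHq //.
under eq_map => z do rewrite nth_assign.
rewrite table_ofE; apply/idP/all_ofP => [h|[r' [rec [rr [/val_inj rE E]]]]].
  exists r, (map_tuple (assign x y) args); split=> //; congr (_, _).
  rewrite /= -map_comp; apply/eq_in_map => z za /=.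
  apply: (@collapse_active (nat_of_ord r, [seq nat_of_ord a | a <- map_tuple (assign x y)
    args])).
    by apply/all_ofP; exists r, (map_tuple (assign x y) args).
  by rewrite /= map_f // map_f.
subst r'; suff -> : map_tuple (assign x y) args = rec by [].
apply: val_inj; apply: (inj_map val_inj); rewrite /= -E -map_comp.
apply/eq_in_map => z za /=; apply/esym/collapse_lt.
have : collapse (assign x y z) \in [seq collapse (assign x y z) | z <- args] by apply:
  map_f.
by rewrite E => /mapP[a _ ->].
Qed.

End Tuples.

(** * Sums over objects as weighted sums over nodes *)

Section Sums.
Variable K : comPzRingType.
Local Notation wt := (weight N graph_of K).
Local Open Scope ring_scope.

Lemma count_ghost : \sum_(v <- L) (v < N)%N%:R = (size L)%:R - 1 :> K.
Proof.
have uL := graph_uniq graph_ofP N.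
rewrite (bigD1_seq N (graph_ghost graph_ofP) uL) /= ltnn add0r.
have -> : (size L)%:R = 1 + \sum_(v <- L | v != N) 1 :> K.
  by rewrite -sum1_size natr_sum (bigD1_seq N (graph_ghost graph_ofP) uL).
rewrite [RHS]addrAC subrr add0r big_seq_cond [RHS]big_seq_cond; apply: eq_bigr => v
  /andP[vL vN].
by rewrite ltn_neqAle vN (graph_le graph_ofP vL).
Qed.

(** Fibres over nodes below N are singletons. The fibre over N is found by subtraction, since all
    fibres together have N elements. *)
Lemma collapse_count v : v \in L -> \sum_(y : 'I_N) (collapse y == v)%:R = wt v :> K.
Proof.
move=> vL; have vN := graph_le graph_ofP vL.
have lt_count u : (u < N)%N -> u \in L -> \sum_(y : 'I_N) (collapse y == u)%:R = 1 :> K.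
  move=> uN uL; rewrite (bigD1 (Ordinal uN)) //= /collapse uL eqxx big1 ?addr0 // => y ne.
  case: eqP => // E; case/eqP: ne; apply: val_inj => /=.
  by move: E; case: ifP => // _ E; rewrite E ltnn in uN.
have [lt|ge] := ltnP v N.
  by rewrite lt_count // /weight lt (ltn_eqF lt) mul0r addr0.
have -> : v = N by apply/eqP; rewrite eqn_leq vN.
rewrite /weight ltnn eqxx mul1r add0r.
have tot : \sum_(u <- L) \sum_(y : 'I_N) (collapse y == u)%:R = N%:R :> K.
  rewrite exchange_big /= (eq_bigr (fun=> 1)) => [|y _].
    by rewrite sumr_const card_ord.
  rewrite (bigD1_seq (collapse y) (collapse_L y) (graph_uniq graph_ofP N)) /= eqxx.
  by rewrite big1 ?addr0 // => u /negbTE; rewrite eq_sym => ->.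
rewrite (bigD1_seq N (graph_ghost graph_ofP) (graph_uniq graph_ofP N)) /= in tot.
have E : \sum_(u <- L | u != N) \sum_(y : 'I_N) (collapse y == u)%:R = (size L)%:R - 1 :> K.
  rewrite -count_ghost [RHS](bigD1_seq N (graph_ghost graph_ofP) (graph_uniq graph_ofP N))
    /=.
  rewrite ltnn add0r big_seq_cond [RHS]big_seq_cond; apply: eq_bigr => u /andP[uL uN].
  have uN' : (u < N)%N by rewrite ltn_neqAle uN (graph_le graph_ofP uL).
  by rewrite lt_count // uN'.
by rewrite E in tot; rewrite -tot; ring.
Qed.

Lemma collapse_sum (F : nat -> K) :
  \sum_(y : 'I_N) F (collapse y) = \sum_(v <- L) wt v * F v.
Proof.
rewrite (eq_bigr (fun y => \sum_(v <- L) (collapse y == v)%:R * F v)) => [|y _].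
  rewrite exchange_big /=; apply: eq_big_seq => v vL.
  by rewrite -mulr_suml collapse_count.
rewrite (bigD1_seq (collapse y) (collapse_L y) (graph_uniq graph_ofP N)) /= eqxx mul1r.
by rewrite big1 ?addr0 // => u /negbTE; rewrite eq_sym => ->; rewrite mul0r.
Qed.

(** Tuples of objects are grouped by their images; the fibre of a tuple of nodes is the product of
    the fibres of its entries. *)
Lemma tuple_sum l (F : seq nat -> K) :
  \sum_(y : l.-tuple 'I_N) F [seq collapse a | a <- y] =
  \sum_(u <- tups l L) (\prod_(v <- u) wt v) * F u.
Proof.
elim: l F => [|l IH] F.
  rewrite big_seq1 big_nil mul1r (big_pred1 [tuple]) // => y /=.
  by rewrite tuple0.
rewrite big_tups_cons.
rewrite (reindex (fun p : 'I_N * l.-tuple 'I_N => [tuple of p.1 :: p.2])) /=; last first.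
  exists (fun t => (thead t, [tuple of behead t])) => [[a t] _|t _] /=.
    by congr (_, _); apply: val_inj.
  by rewrite -tuple_eta.
rewrite -(pair_bigA _ (fun a (t : l.-tuple 'I_N) => F (collapse a :: [seq collapse b | b <-
  t]))) /=.
rewrite (eq_bigr (fun a => \sum_(u <- tups l L) (\prod_(v <- u) wt v) * F (collapse a ::
  u))) => [|a _].
  rewrite (collapse_sum (fun c => \sum_(u <- tups l L) (\prod_(v <- u) wt v) * F (c :: u))).
  apply: eq_bigr => a _; rewrite mulr_sumr; apply: eq_bigr => u _.
  by rewrite big_cons mulrA.
exact: (IH (fun u => F (collapse a :: u))).
Qed.

End Sums.

(** If y is merged into N, it is missing from L, so L has at most N of the N + 1 numbers up to N. *)
Lemma valid_collapse (y : 'I_N) : 0 < wtn N graph_of (collapse y).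
Proof.
rewrite /wtn; case: (ltnP (collapse y) N) => // ge; rewrite subn_gt0 ltnS.
have yL : nat_of_ord y \notin L.
  by move: ge; rewrite /collapse; case: ifP => // _; rewrite leqNgt ltn_ord.
have uL := graph_uniq graph_ofP N.
have : size (nat_of_ord y :: L) <= size (iota 0 N.+1).
  apply: uniq_leq_size; first by rewrite /= yL uL.
  move=> v; rewrite inE mem_iota add0n ltnS => /orP[/eqP ->|/(graph_le graph_ofP) //].
  exact: ltnW.
by rewrite size_iota.
Qed.

(** Positive weight at N means that L misses a number up to N; as it contains N, it misses an
    object, which is then merged into N. *)
Lemma valid_surj v : v \in L -> 0 < wtn N graph_of v -> exists y, collapse y = v.
Proof.
move=> vL; rewrite /wtn; case: (ltnP v N) => [vN _|ge wp].
  by exists (Ordinal vN); rewrite /collapse vL.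
have vN : v = N by apply/eqP; rewrite eqn_leq (graph_le graph_ofP vL).
case: (pickP (fun y : 'I_N => nat_of_ord y \notin L)) => [y yL|all].
  by exists y; rewrite /collapse (negbTE yL) vN.
have : size (iota 0 N.+1) <= size L.
  apply: uniq_leq_size; first exact: iota_uniq.
  move=> u; rewrite mem_iota add0n ltnS /= leq_eqVlt => /orP[/eqP ->|uN].
    exact: graph_ghost graph_ofP.
  by have := all (Ordinal uN) => /= /negbFE.
by rewrite size_iota; move: wp; rewrite subn_gt0 ltnS leqNgt => /negbTE ->.
Qed.

(** With [valid_collapse] this identifies the valid tuples of nodes with the images of tuples of
    objects, so both searches have the same optimum. *)
Lemma valid_tuple k xs : xs \in tups k L -> valid N graph_of xs ->
  exists x : k.-tuple 'I_N, [seq collapse a | a <- x] = xs.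
Proof.
elim: k xs => [|k IH] xs.
  by rewrite inE => /eqP -> _; exists [tuple].
move=> /allpairsP[[v t] /= [vL tL ->]] /andP[vp tp].
have [y yE] := valid_surj vL vp; have [x xE] := IH t tL tp.
by exists [tuple of y :: x]; rewrite /= yE xE.
Qed.

End Structure.

(** * The algorithm *)

(** r is least with m <= r * r. The factor 4 comes from r <= 2 (r - 1) for r >= 2, as the square of
    r - 1 is below m. *)
Lemma ceil_sqrt m : 0 < m -> exists r, [/\ 0 < r, m <= r * r & r * r <= 4 * m].
Proof.
move=> m0; have ex : exists r, m <= r * r by exists m; rewrite leq_pmulr.
case: (ex_minnP ex) => -[|r] h hmin; first by move: h; rewrite mul0n; lia.
exists r.+1; split=> //.
have : r * r < m by rewrite ltnNge; apply/negP => /hmin; rewrite ltnn.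
case: r h hmin => [|r] h hmin; nia.
Qed.

Lemma leq_exp_base a b e : a <= b -> a ^ e <= b ^ e.
Proof. by case: e => // e ab; rewrite leq_exp2r. Qed.

(** The summands are parsing, O(m), counting, m^n times O(m r), and the search, m^k with k <= n + 1;
    m^(n+1) r dominates each of them. *)
Lemma time_bound (pc qc x bc c n k m r m0 Ls tr : nat) :
  0 < m -> 0 < r -> m0 <= m -> Ls <= c * m -> tr <= (2 + r + c * r) * (c * m) -> k <= n.+1
    ->
  pc * m0.+1 + (Ls.+1 ^ n * (qc * tr + 1 + x) + (10 + Ls.+1 ^ k * bc)) <=
  (2 * pc + c.+1 ^ n * (qc * ((3 + c) * c) + 1 + x) + 10 + c.+1 ^ n.+1 * bc) *
    (m ^ n.+1 * r).
Proof.
move=> m1 r1 m0m LsL trL kn; set M := m ^ n.+1 * r.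
have L1 : Ls.+1 <= c.+1 * m by lia.
have mM : m <= M.
  by rewrite /M expnS -mulnA leq_pmulr // muln_gt0 expn_gt0 m1.
have M1 : 0 < M by lia.
have h1 : pc * m0.+1 <= (2 * pc) * M by nia.
have tr' : tr <= (3 + c) * c * (r * m) by nia.
have rm1 : 0 < r * m by rewrite muln_gt0 r1.
have h2 : Ls.+1 ^ n * (qc * tr + 1 + x) <= c.+1 ^ n * (qc * ((3 + c) * c) + 1 + x) * M.
  apply: (@leq_trans ((c.+1 * m) ^ n * ((qc * ((3 + c) * c) + 1 + x) * (r * m)))).
    apply: leq_mul; first exact: leq_exp_base.
    have : qc * tr <= qc * ((3 + c) * c * (r * m)) by rewrite leq_mul2l tr' orbT.
    have : x <= x * (r * m) by rewrite leq_pmulr.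
    rewrite !mulnDl mul1n mulnA; lia.
  by rewrite expnMn /M expnS; apply/eq_leq; ring.
have h3 : Ls.+1 ^ k * bc <= c.+1 ^ n.+1 * bc * M.
  apply: (@leq_trans ((c.+1 * m) ^ n.+1 * bc)).
    rewrite leq_mul2r; apply/orP; right.
    apply: (@leq_trans (Ls.+1 ^ n.+1)); first by rewrite leq_pexp2l.
    by rewrite leq_exp2r.
  rewrite expnMn mulnAC leq_mul2l; apply/orP; right.
  by rewrite /M leq_pmulr.
rewrite !mulnDl; lia.
Qed.

(** * The solver, its word size and its running time *)

Section Solve.
Variables (sigma : signature) (k l : nat) (psi : optsp sigma k l).
Hypothesis hl : 2 <= l.
Hypothesis hkl : 3 <= k + l.
Let nr := nrel sigma.
Let n := k + l - 3.
Let P := poly (Defs.matrix psi).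

Definition max_arity := \max_(r < nr) arity r.

Definition solver :=
  CSeq (parse_prog nr (arities sigma))
    (CSeq (count_prog nr k n P) (best_prog nr k (opt psi))).

(** Room for the indices of tables (the arity), of counters (k) and of the adjacency arrays (2). The
    summand l puts the largest possible count, N^l, below B^(D+2). *)
Let D := max_arity + k + l + 2.
Definition base_coef :=
  max_arity + 2 * nr + 20 + sumn [seq p.2 | p <- arities sigma].

Lemma arity_le (r : 'I_nr) : arity r <= max_arity.
Proof. exact: leq_bigmax. Qed.

Section Run.
Variables (A : structure sigma) (w : nat).
Hypothesis hw : (nobj A + nrec A + 2) ^ (base_coef.+1 * (D + 2)) <= 2 ^ w.
Let N := nobj A.
Let B := size (encode A) + N + (nr + 10 + sumn [seq p.2 | p <- arities sigma]).
Let G := graph_of A.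
Let tbl := table_of A.
Local Notation L := (G N).

(** With positive arity every record occupies a cell of the input. With arity 0 records occupy none,
    but a list without duplicates then has at most one. *)
Lemma size_rel_enc (r : 'I_nr) : size (rel_of A r) < (size (encode A)).+1.
Proof.
rewrite ltnS encodeE /=.
have [a0|a0] := posnP (arity r).
  have := rel_uniq A r; move: (rel_of A r); rewrite a0 => s us.
  apply: (@leq_trans 1); last by [].
  have := max_card (mem s); rewrite card_tuple expn0.
  by have /card_uniqP -> := us.
apply: leqW; rewrite /block_enc size_flatten /shape -map_comp sumnE big_map.
rewrite /arities big_map (bigD1_seq r) ?mem_enum ?enum_uniq //=.
apply: leq_trans (leq_addr _ _).
rewrite recsE /records (@size_flatten_const _ (arity r)).
  by rewrite size_map; apply: leqW; rewrite leq_pmulr.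
by apply/allP => _ /mapP[rec _ ->]; rewrite size_map size_tuple.
Qed.

Lemma size_encode : size (encode A) <= 1 + nr + max_arity * nrec A.
Proof.
rewrite encodeE /= /block_enc size_flatten /shape -map_comp sumnE big_map /arities big_map.
rewrite add1n addSn ltnS big_enum /=.
have -> : nr + max_arity * nrec A = \sum_(r < nr) (1 + max_arity * size (rel_of A r)).
  by rewrite big_split /= sum1_card card_ord /nrec big_distrr.
apply: leq_sum => r _; rewrite add1n ltnS recsE (@size_flatten_const _ (arity r)).
  by rewrite size_map mulnC leq_mul2r arity_le orbT.
by apply/allP => _ /mapP[rec _ ->]; rewrite size_map size_tuple.
Qed.

(** B is at most c X for X = N + m + 2 and c = [base_coef], and c <= 2^c <= X^c turns this into
    X^(c+1). This is the origin of the exponent demanded of the word size. *)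
Lemma base_word : B ^ (D + 2) <= 2 ^ w.
Proof.
apply: leq_trans hw; rewrite expnM; apply: leq_exp_base.
set X := N + nrec A + 2; set c := base_coef.
apply: (@leq_trans (c * X)).
  have := size_encode; rewrite /B /c /base_coef /X; move: (sumn _) (size (encode A)) => S e.
  nia.
rewrite expnSr leq_mul2r; apply/orP; right.
apply: (@leq_trans (2 ^ c)); first exact/ltnW/ltn_expl.
by apply: leq_exp_base; rewrite /X; lia.
Qed.

Lemma w_gt0 : 0 < w.
Proof.
have B2 : 1 < B by rewrite /B; lia.
have h : B ^ 1 <= B ^ (D + 2) by rewrite leq_pexp2l //; lia.
case: (posnP w) => // w0; have := base_word; rewrite [in X in _ <= X]w0.
by rewrite expn1 in h; move/(leq_trans h); rewrite leqNgt B2.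
Qed.

(** ['Z_p] is the ring of residues modulo p only for p > 1, hence the need for [w_gt0]. *)
Definition ring_of := 'Z_(2 ^ w).

Lemma ring_mod m : ((m %% 2 ^ w)%:R = m%:R :> ring_of)%R.
Proof. by rewrite Zp_nat_mod // word_gt1 // w_gt0. Qed.

Lemma ring_inj a b : a < 2 ^ w -> b < 2 ^ w -> (a%:R = b%:R :> ring_of)%R -> a = b.
Proof.
move=> aw bw /(congr1 (@nat_of_ord _)).
by rewrite !val_Zp_nat ?word_gt1 ?w_gt0 // !modn_small.
Qed.

Lemma region_size : nr.+4.+3 < B. Proof. by rewrite /B; lia. Qed.

Lemma object_size : N.+1 < B. Proof. by rewrite /B; lia. Qed.

Lemma graph_ok_A : graph_ok N G.
Proof.
split=> [u|u v vu]; first exact: (graph_uniq (graph_ofP A)).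
exact: (graph_le (graph_ofP A) (graph_sub (graph_ofP A) vu)).
Qed.

Lemma env_A : env w B D N nr G.
Proof.
split.
- exact: base_word.
- exact: w_gt0.
- exact: region_size.
- exact/ltnW/object_size.
- by rewrite /D; lia.
- by move=> u; apply: leq_ltn_trans (graph_ok_size u graph_ok_A) object_size.
Qed.

Lemma kn : k <= n.+1. Proof. by rewrite /n; lia. Qed.

Lemma poly_ok : (forall q, q \in P -> wf D nr q.2) /\
  (forall q a v, q \in P -> a \in q.2 -> v \in a.2 -> v < n.+3).
Proof.
have -> : n.+3 = k + l by rewrite /n; lia.
apply: poly_wf => r; apply: leq_trans (arity_le r) _; rewrite /D; lia.
Qed.

Lemma run_spec :
  runs w solver (init A) (fun s => exists V : seq nat -> nat,
     reg s 0 = foldl (fun b t => best_step (opt psi) (valid N G) V t b)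
       (if opt psi is Max then 0 else (2 ^ w).-1) (tups k L) /\
     (forall xs, V xs < 2 ^ w) /\
     (forall x : k.-tuple 'I_N, V [seq collapse a | a <- x] = value psi x))
  (parse_cost (arities sigma) * (nrec A).+1 +
    ((size L).+1 ^ n * (poly_cost nr k n P * trisum N G + 1 + loop_cost * n) +
     (10 + (size L).+1 ^ k * (best_cost nr k (opt psi) + loop_cost * k)))).
Proof.
have w0 := w_gt0; have E := env_A; have GR := graph_ofP A.
have [wfP varP] := poly_ok.
have kD : k <= D by rewrite /D; lia.
apply: runs_seq.
rewrite -[in (nrec A).+1](sum_recs A).
have encB : size (encode A) < B by rewrite /B; lia.
have D2 : 2 <= D by rewrite /D; lia.
have H := @parse_spec w B D N nr (encode A) base_word w0 region_size object_size D2 encB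
  (recs A) (arities sigma) (encodeE A) erefl.
apply: runs_weaken (H _) _ (leqnn _) => {H}.
  move=> p /mapP[r _ ->] /=; rewrite recsE size_map ltn_ord; split.
    split=> //; first by apply: leq_trans (arity_le r) _; rewrite /D; lia.
      by apply: leq_trans (size_rel_enc r) _; rewrite /B; lia.
    have le : arity r <= sumn [seq p.2 | p <- arities sigma].
      rewrite /arities -map_comp sumnE big_map (bigD1_seq r) ?mem_enum ?enum_uniq //=.
      exact: leq_addr.
    by rewrite /B; lia.
  apply/allP => _ /mapP[rec _ ->]; rewrite size_map size_tuple eqxx /=.
  by apply/allP => _ /mapP[a _ ->]; exact/ltnW.
move=> s1 [[[R1 R2] _ ST [Sd Sa _] Sc] _].
have st1 : static B D N nr G tbl s1 by split.
have cI1 : counts_are B N nr k (fun=> 0%R : ring_of) s1.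
  move=> xs szx xN; rewrite Sc //; apply: (good_le E) => //; by rewrite szx.
apply: runs_seq.
have H := count_spec E GR ring_mod kn kD wfP varP st1 cI1.
apply: runs_weaken H _ (leqnn _) => s2 [st2 cI2].
have H := best_spec E GR ring_mod ring_inj kn kD (opt psi) st2.
apply: runs_weaken H _ (leqnn _) => s3 r0.
exists (fun xs => cell B s2 (Rcnt nr) xs %% 2 ^ w); split=> //; split.
  by move=> xs; rewrite ltn_mod expn_gt0.
(* Counter and value are compared in the ring; both are words, the value because it is at most N^l,
   below B^l and so below 2^w. *)
move=> x; apply: ring_inj.
- by rewrite ltn_mod expn_gt0.
- apply: leq_ltn_trans (max_card _) _; rewrite card_tuple card_ord.
  apply: leq_trans base_word.
  apply: (@leq_trans (B ^ l)).
    by rewrite ltn_exp2r; [apply: ltnW object_size|lia].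
  by rewrite leq_pexp2l // /D; lia.
have xsL : [seq collapse a | a <- x] \in tups k L.
  apply/tupsP; rewrite size_map size_tuple; split=> // _ /mapP[a _ ->].
  exact: collapse_L.
have xN : all (geq N) [seq collapse a | a <- x].
  by apply/allP => _ /mapP[a _ ->]; exact: (graph_le GR (collapse_L a)).
rewrite ring_mod cI2 ?size_map ?size_tuple //.
rewrite (count_sum E GR _ kn kD varP (l := l)) //; last by rewrite /n; lia.
under eq_bigr => u _ do rewrite pv_poly.
rewrite -(@tuple_sum sigma A ring_of l (fun u => (nsat tbl (nth 0 ([seq collapse a | a <-
  x] ++ u)) (Defs.matrix psi))%:R)%R).
under eq_bigr => y _ do rewrite -sat_nsat.
by rewrite -natr_sum -big_mkcond /= sum1_card /value cardsE.
Qed.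

(** The start values 0 and 2^w - 1 are on the worse side of every word. If one of them survives, the
    comparison with the optimal tuple [x0] shows that it equals v. *)
Lemma solver_spec v : is_optimum psi A v ->
  runs w solver (init A) (fun s => reg s 0 = v)
  (parse_cost (arities sigma) * (nrec A).+1 +
    ((size L).+1 ^ n * (poly_cost nr k n P * trisum N G + 1 + loop_cost * n) +
     (10 + (size L).+1 ^ k * (best_cost nr k (opt psi) + loop_cost * k)))).
Proof.
move=> [[x0 vx0] hopt]; apply: runs_weaken run_spec _ (leqnn _) => s [V [-> [VW Vx]]].
have x0L : [seq collapse a | a <- x0] \in tups k L.
  apply/tupsP; rewrite size_map size_tuple; split=> // _ /mapP[a _ ->].
  exact: collapse_L.
have x0v : valid N G [seq collapse a | a <- x0].
  by apply/allP => _ /mapP[a _ ->]; exact: valid_collapse.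
have Vt t : t \in tups k L -> valid N G t -> exists x : k.-tuple 'I_N, V t = value psi x.
  by move=> tL tv; have [x <-] := valid_tuple tL tv; exists x; rewrite Vx.
have Wx := VW [seq collapse a | a <- x0]; rewrite Vx vx0 in Wx.
have := best_foldP (opt psi) (valid N G) V (tups k L) (if opt psi is Max then 0 else (2 ^
  w).-1).
set r := foldl _ _ _; move=> [H1 [H2 _]].
have := H2 _ x0L x0v; rewrite Vx vx0 => {H2}.
case: (opt psi) hopt H1 => hopt H1 H2.
- case: H1 => [r0|[t [tL tv rt]]]; first by move: H2; rewrite r0; lia.
  by have [x Vtx] := Vt t tL tv; have := hopt x; lia.
- case: H1 => [r0|[t [tL tv rt]]]; first by move: H2; rewrite r0; lia.
  by have [x Vtx] := Vt t tL tv; have := hopt x; lia.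
Qed.

End Run.

(** [c] is the constant of [degrees_le], so that the degrees sum to at most c m; the rest is the
    constant of [time_bound]. *)
Definition solver_time :=
  let c := (1 + max_arity.+1 ^ 2) in
  2 * parse_cost (arities sigma) +
  c.+1 ^ n * (poly_cost nr k n P * ((3 + c) * c) + 1 + loop_cost * n) + 10 +
  c.+1 ^ n.+1 * (best_cost nr k (opt psi) + loop_cost * k).

Lemma solver_bound (A : structure sigma) v w r : is_optimum psi A v ->
  (nobj A + nrec A + 2) ^ (base_coef.+1 * (D + 2)) <= 2 ^ w ->
  0 < r -> maxn (nrec A) 1 <= r * r ->
  runs w solver (init A) (fun s => reg s 0 = v)
    (solver_time * (maxn (nrec A) 1 ^ n.+1 * r)).
Proof.
move=> hopt hw r0 mr; set m := maxn (nrec A) 1 in mr *.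
apply: runs_weaken (solver_spec hw hopt) _ _ => //.
set c := 1 + max_arity.+1 ^ 2.
have m0 : nrec A <= m by rewrite leq_maxl.
have m1 : 0 < m by rewrite leq_maxr.
have GR := graph_ofP A.
have degE : \sum_(u <- graph_of A (nobj A)) size (graph_of A u) <= c * m.
  apply: leq_trans (degrees_le A arity_le) _.
  by rewrite mulnDl mul1n; apply: leq_add => //; rewrite leq_mul2l m0 orbT.
have szL : size (graph_of A (nobj A)) <= c * m.
  apply: leq_trans degE; rewrite (big_rem (nobj A) (graph_ghost GR)); exact: leq_addr.
apply: time_bound => //; last by rewrite /n; lia.
(* Here E = c m and q = c r, so E <= q r follows from m <= r * r. *)
apply: trisum_bound GR degE _.
by rewrite -mulnA leq_mul2l mr orbT.
Qed.

End Solve.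

Local Open Scope ring_scope.

Theorem theorem20 (R : realType) (k l : nat) (hl : (2 <= l)%N)
    (hkl : (3 <= k + l)%N) (sigma : signature) (psi : optsp sigma k l) :
  solvable_in_time psi
    (fun m : nat => (m%:R : R) `^ (k%:R + l%:R - 3 / 2)).
Proof.
(* The factor 2 pays for replacing r by twice the square root of m. *)
exists (solver psi), ((base_coef sigma).+1 * (max_arity sigma + k + l + 2 + 2))%N,
  (solver_time psi * 2)%:R.
move=> A v hopt w hw; set m := maxn (nrec A) 1.
have m0 : (0 < m)%N by rewrite leq_maxr.
have [r [r0 mr rm]] := ceil_sqrt m0.
have [s [t [ex sv tb]]] := solver_bound hl hkl hopt hw r0 mr.
exists s, t; split=> //.
have mR : 0 < m%:R :> R by rewrite ltr0n.
(* The exponent is split into the integer n + 1 and 1/2, the power of m that r stands for. *)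
have -> : k%:R + l%:R - 3 / 2 = (k + l - 3).+1%:R + 2^-1 :> R.
  have -> : k%:R + l%:R = (k + l - 3 + 3)%:R :> R by rewrite subnK // natrD.
  by rewrite -addn1 !natrD; field.
rewrite powRD; last by rewrite (gt_eqF mR) implybT.
rewrite powR_mulrn ?ler0n // powR12_sqrt ?ler0n //.
have rs : r%:R <= 2 * Num.sqrt m%:R :> R.
  rewrite -(@ler_pXn2r _ 2) ?nnegrE ?ler0n ?mulr_ge0 ?sqrtr_ge0 //.
  rewrite exprMn sqr_sqrtr ?ler0n // -natrX -natrX -natrM ler_nat.
  by rewrite -mulnn; apply: leq_trans rm _.
apply: le_trans (_ : (solver_time psi * (m ^ (k + l - 3).+1 * r))%:R <= _).
  by rewrite ler_nat.
rewrite !natrM natrX -!mulrA ler_wpM2l ?ler0n // mulrCA ler_wpM2l ?exprn_ge0 ?ler0n //.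
Qed.
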